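(* Let $\mathbb B=\{x\in\mathbb R^2:|x|<1\}$ be the standard unit disk, let $\alpha_1,\alpha_2>-1$ and let $\rho_1,\rho_2>0$ satisfy $$\rho_1^2-\rho_1\rho_2+\rho_2^2-4\pi(1+\alpha_1)\rho_1-4\pi(1+\alpha_2)\rho_2\ge0.$$ Then there are no solutions $u=(u_1,u_2)$ to the system $$\begin{cases}-\Delta u_1=2\rho_1\dfrac{|x|^{2\alpha_1}e^{u_1}}{\int_{\mathbb B}|x|^{2\alpha_1}e^{u_1(x)}\,dx}-\rho_2\dfrac{|x|^{2\alpha_2}e^{u_2}}{\int_{\mathbb B}|x|^{2\alpha_2}e^{u_2(x)}\,dx}&\text{in }\mathbb B\\[2mm]-\Delta u_2=2\rho_2\dfrac{|x|^{2\alpha_2}e^{u_2}}{\int_{\mathbb B}|x|^{2\alpha_2}e^{u_2(x)}\,dx}-\rho_1\dfrac{|x|^{2\alpha_1}e^{u_1}}{\int_{\mathbb B}|x|^{2\alpha_1}e^{u_1(x)}\,dx}&\text{in }\mathbb B\\[2mm]u_1|_{\partial\mathbb B}=u_2|_{\partial\mathbb B}=0.\end{cases}$$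
   Context: The disk carries the flat metric and $\Delta$ is the Euclidean Laplacian. Solutions are understood as weak solutions in $H^1_0(\mathbb B)^2$. *)

(* Defs.v *)
From HB Require Import structures.
From mathcomp Require Import all_boot all_order all_algebra.
From mathcomp Require Import all_classical all_reals all_analysis.

Set Implicit Arguments.
Unset Strict Implicit.
Unset Printing Implicit Defensive.

Import Order.TTheory GRing.Theory Num.Theory.
Import numFieldNormedType.Exports.

Local Open Scope classical_set_scope.
Local Open Scope ring_scope.

Section WeakSolutions.
Context {R : realType}.

(* The library's norm on [R * R] is the max norm, hence an explicit one. *)
Definition enorm (x : R * R) : R := Num.sqrt (x.1 ^+ 2 + x.2 ^+ 2).

Definition dot (v w : R * R) : R := v.1 * w.1 + v.2 * w.2.

Definition disk : set (R * R) := [set x | enorm x < 1].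

Notation leb2 := (@lebesgue_measure R \x @lebesgue_measure R)%E.

Definition e1 : R * R := (1, 0).
Definition e2 : R * R := (0, 1).

Definition grad (f : R * R -> R) (x : R * R) : R * R :=
  ('D_e1 f x, 'D_e2 f x).

Fixpoint Ck (k : nat) (f : R * R -> R) : Prop :=
  continuous f /\
  if k is k'.+1 then
    [/\ forall x, derivable f x e1, forall x, derivable f x e2,
        Ck k' ('D_e1 f) & Ck k' ('D_e2 f)]
  else True.

Definition smooth (f : R * R -> R) : Prop := forall k, Ck k f.

Definition supp (f : R * R -> R) : set (R * R) :=
  closure [set x | f x != 0].

(* C_c^oo(disk), each element being extended by zero to the plane. *)
Definition test_function (phi : R * R -> R) : Prop :=
  [/\ smooth phi, compact (supp phi) & supp phi `<=` disk].

Definition L2disk (u : R * R -> R) : Prop :=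
  measurable_fun disk u /\
  (\int[leb2]_(x in disk) (u x ^+ 2)%:E < +oo)%E.

Definition weak_gradient (u : R * R -> R) (G : R * R -> R * R) : Prop :=
  forall phi, test_function phi ->
    (\int[leb2]_(x in disk) (u x * (grad phi x).1) =
       - (\int[leb2]_(x in disk) ((G x).1 * phi x)))%R /\
    (\int[leb2]_(x in disk) (u x * (grad phi x).2) =
       - (\int[leb2]_(x in disk) ((G x).2 * phi x)))%R.

(* [u] is in H^1(disk) with weak gradient [G]; values outside the disk are
   irrelevant. *)
Definition H1 (u : R * R -> R) (G : R * R -> R * R) : Prop :=
  [/\ L2disk u, L2disk (fun x => (G x).1), L2disk (fun x => (G x).2) &
      weak_gradient u G].

Definition H1_sqdist (u : R * R -> R) (G : R * R -> R * R)
    (v : R * R -> R) (H : R * R -> R * R) : \bar R :=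
  (\int[leb2]_(x in disk)
     ((u x - v x) ^+ 2 + dot (G x - H x) (G x - H x))%:E)%E.

(* H^1_0 is the H^1-closure of C_c^oo. *)
Definition H10 (u : R * R -> R) (G : R * R -> R * R) : Prop :=
  H1 u G /\
  exists phi : nat -> R * R -> R,
    (forall n, test_function (phi n)) /\
    (fun n => H1_sqdist u G (phi n) (grad (phi n))) @ \oo --> 0%E.

(* - Laplacian u = f in the disk, u = 0 on the circle, with u in H^1_0. *)
Definition weak_dirichlet (u f : R * R -> R) : Prop :=
  exists2 G, H10 u G &
    forall phi, test_function phi ->
      (\int[leb2]_(x in disk) dot (G x) (grad phi x) =
       \int[leb2]_(x in disk) (f x * phi x))%R.

Definition weighted_exp (alpha : R) (u : R * R -> R) (x : R * R) : R :=
  enorm x `^ (2 * alpha) * expR (u x).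

(* For u in H^1_0 and alpha > -1 the integral is finite and positive by the
   Moser-Trudinger inequality, so the value 0 given to an infinite [Rintegral]
   and the convention y / 0 = 0 are never used; finiteness is therefore not
   made part of the notion of solution. *)
Definition normalized_exp (alpha : R) (u : R * R -> R) (x : R * R) : R :=
  weighted_exp alpha u x / (\int[leb2]_(y in disk) weighted_exp alpha u y)%R.

Definition toda_solution (alpha1 alpha2 rho1 rho2 : R)
    (u1 u2 : R * R -> R) : Prop :=
  weak_dirichlet u1 (fun x => 2 * rho1 * normalized_exp alpha1 u1 x
                              - rho2 * normalized_exp alpha2 u2 x) /\
  weak_dirichlet u2 (fun x => 2 * rho2 * normalized_exp alpha2 u2 x
                              - rho1 * normalized_exp alpha1 u1 x).

End WeakSolutions.

(* Main.v *)
Require Import Defs.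
From mathcomp Require Import all_boot all_order all_algebra.
From mathcomp Require Import all_classical all_reals all_analysis.
From mathcomp Require Import measurable_realfun ring lra.
Import Order.TTheory GRing.Theory Num.Theory.
Import numFieldNormedType.Exports.

Set Implicit Arguments.
Unset Strict Implicit.
Unset Printing Implicit Defensive.

Local Open Scope classical_set_scope.
Local Open Scope ring_scope.

(** The usual route to such a statement is a Pohozaev identity, that is, testing
    the equations with [x . grad u_i]; for weak solutions this would require
    regularity at the boundary and at the singular point of the weight.  Here
    the solution is compared instead with its dilations [u_i (s x)], [s > 1],
    extended by zero, and [s] tends to 1.  Only an inequality survives, and it
    is the one that is needed.

    Write [V_i = |x|^(2 alpha_i)], [I_i] for the integral of [V_i e^(u_i)],
    [E_i] for that of [V_i], and [N_i = V_i e^(u_i) / I_i].  Inverting the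
    matrix [(2, -1; -1, 2)] turns the system into equations for
    [(2 u_1 + u_2) / 3] and [(u_1 + 2 u_2) / 3] with right-hand sides
    [rho_i N_i].  Test them with [g_i = u_i - u_i (s x)] and add.

    - The Dirichlet form is invariant under dilations of the plane, so that
      polarization makes the left-hand side one half of the energy of
      [(g_1, g_2)] for the inverse matrix ([energy_le_mass]).
    - On the right, [e^a (a - b) = e^a - e^b] up to a quadratic remainder
      ([expR_tangent_le]), and the weights are homogeneous, so that the main
      term is [rho_i (1 - s^(-2 - 2 alpha_i)) (1 - E_i / I_i)]
      ([integral_weight_dilation]).  The remainder is a small multiple of the
      energy plus [O((s - 1)^2)] ([weighted_sqr],
      [weighted_dilation_difference]).
    - Since [u_i (s x)] vanishes for [|x| >= 1 / s], the energy of [(g_1, g_2)]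
      controls the flux of [grad u_i] through the annulus [1 / s < |x| < 1].
      Pairing with a cut-off [xi] that equals 1 for [|x| <= 1 / s] and has
      Dirichlet energy close to [4 pi / (1 - s^-2)] ([cutoff]) bounds the energy
      from below by nearly
      [2 (rho_1^2 - rho_1 rho_2 + rho_2^2) (1 - s^-2) / (4 pi)]
      ([flux_le_energy], [flux_optimum]).

    Divide by [1 - s^-2] and let [s] tend to 1: then
    [rho_1^2 - rho_1 rho_2 + rho_2^2] is at most [4 pi] times the sum of
    [rho_i (1 + alpha_i) max (0, 1 - E_i / I_i)] ([quad_le_mass]).  Since
    [E_i > 0] this contradicts the hypothesis on [rho_1, rho_2].

    All this is carried out on test functions approximating [u_i], which takes
    exponential integrability.  A planar Sobolev inequality, applied to powers,
    bounds the [2m]-th moments of a test function by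
    [(m!)^2 D^(m-1) N], with [D] its Dirichlet energy and [N] its square
    integral ([disk_C1_moment_bound]).  Such bounds pass to limits and sum up to
    exponential moments of any order as soon as [D] is small
    ([moment_bound_expR]); an element of [H^1_0] is a bounded function plus one
    of small energy, whence [approx_exp_bound].  In particular the [I_i] are
    finite. *)

(** * Lebesgue measure on the plane *)

Section plane_measure.
Context {R : realType}.
Notation leb := (@lebesgue_measure R).
Notation leb2 := (leb \x leb)%E.
Notation line := (measurableTypeR R).
Notation plane := (measurableTypeR R * measurableTypeR R)%type.

(** An open set is the union of the countably many rational boxes it contains. *)
Lemma open_measurable_plane (U : set (R * R)) :
  open U -> measurable (U : set plane).
Proof.
move=> oU.
pose box (p : rat * rat * rat) : set (R * R) :=
  ball (ratr p.1.1 : R) (ratr p.2) `*` ball (ratr p.1.2 : R) (ratr p.2).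
have -> : U = \bigcup_p (if `[< box p `<=` U >] then box p else set0).
  apply/seteqP; split=> [[x y] Uxy|z [p _]]; last first.
    by case: asboolP => // bU /bU.
  have /nbhs_ballP[e /= e0 eU] : nbhs (x, y) U by exact: open_nbhs_nbhs.
  have [r /[!in_itv]/= /andP[r0 re]] := rat_in_itvoo (divr_gt0 e0 (ltr0n R 2)).
  have xr : x - ratr r < x by lra.
  have yr : y - ratr r < y by lra.
  have [p /[!in_itv]/= /andP[p0 pe]] := rat_in_itvoo xr.
  have [q /[!in_itv]/= /andP[q0 qe]] := rat_in_itvoo yr.
  exists (p, q, r) => //; case: asboolP => /= [_|[]].
    by split; rewrite /= -ball_normE /ball_ /= ltr_norml; lra.
  move=> [a b] [/= ]; rewrite -!ball_normE /ball_ /= !ltr_norml => ha hb.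
  by apply: eU; split; rewrite /= -ball_normE /ball_ /= ltr_norml; lra.
apply: countable_bigcupT_measurable => [|p]; first exact: countableP.
case: asboolP => _; last exact: measurable0.
by apply: measurableX; exact: measurable_ball.
Qed.

Lemma continuous_measurable_plane (f : R * R -> R) : continuous f ->
  measurable_fun [set: plane] (f : plane -> line).
Proof.
move=> /continuousP cf.
apply: (measurability _ (RGenOpens.measurableE R)).
move=> _ [_ [a [b ->] <-]]; rewrite setTI; apply: open_measurable_plane.
exact/cf/interval_open.
Qed.

Lemma continuous_fst : continuous (fst : R * R -> R).
Proof. by move=> x; exact: cvg_fst. Qed.

Lemma continuous_snd : continuous (snd : R * R -> R).
Proof. by move=> x; exact: cvg_snd. Qed.

Lemma continuous_sqr_norm : continuous (fun x : R * R => x.1 ^+ 2 + x.2 ^+ 2).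
Proof.
move=> x; apply: cvgD; apply: cvgM;
  [exact: continuous_fst|exact: continuous_fst|exact: continuous_snd|exact: continuous_snd].
Qed.

Lemma continuous_enorm : continuous (@enorm R).
Proof.
move=> x; apply: (@continuous_comp _ _ _ (fun x : R * R => x.1 ^+ 2 + x.2 ^+ 2)).
  exact: continuous_sqr_norm.
exact: sqrt_continuous.
Qed.

Lemma measurable_disk : measurable (@disk R : set plane).
Proof.
apply: open_measurable_plane.
rewrite (_ : disk = @enorm R @^-1` [set x | x < 1])//.
by move/continuousP : continuous_enorm; apply; exact: open_lt.
Qed.

Lemma measurable_scale (c : R) : measurable_fun [set: plane] (fun x : plane => c *: x : plane).
Proof.
have mc : measurable_fun setT ( *%R c : line -> line) by exact: mulrl_measurable.
by apply: measurable_fun_pair; exact: (measurableT_comp mc).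
Qed.

(** The image of Lebesgue measure under a homothety is a multiple of it, by
    uniqueness, since this holds on intervals. *)
Lemma ge0_integral_scale1 (c : R) (F : R -> \bar R) : 0 < c ->
  measurable_fun [set: line] F ->
  (forall x, 0 <= F x)%E ->
  (\int[leb]_x F (c * x)%R = c^-1%:E * \int[leb]_x F x)%E.
Proof.
move=> c0 mF F0.
have mc : measurable_fun setT ( *%R c : line -> line).
  exact: mulrl_measurable.
rewrite -[LHS](ge0_integral_pushforward mc leb measurableT)//.
have ci0 : 0 <= c by exact: ltW.
have E A : measurable A -> leb A = (mscale (NngNum ci0) (pushforward leb ( *%R c : line -> line))) A.
  apply: lebesgue_measure_unique => _ [[a b]/= _ <-].
  rewrite /= /mscale /= /pushforward.
  rewrite (_ : _ @^-1` _ = `]a / c, b / c]%classic); last first.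
    by apply/seteqP; split => x /=; rewrite !in_itv/= ltr_pdivrMr// ler_pdivlMr// mulrC.
  rewrite !lebesgue_measure_itv/= !lte_fin ltr_pM2r ?invr_gt0//.
  case: ifPn => _; last by rewrite mule0.
  by rewrite -!EFinB -EFinM -mulrBl mulrCA mulfV ?mulr1// gt_eqF.
rewrite [X in (_ * X)%E](eq_measure_integral (mscale (NngNum ci0) (pushforward leb ( *%R c : line -> line)))); last first.
  by move=> A mA _; exact: E.
by rewrite ge0_integral_mscale//= muleA -EFinM mulVf ?mul1e// gt_eqF.
Qed.

Lemma ge0_integral_scale2 (c : R) (F : R * R -> \bar R) : 0 < c ->
  measurable_fun [set: plane] F -> (forall x, 0 <= F x)%E ->
  (\int[leb2]_x F (c *: x)%R = (c ^- 2)%:E * \int[leb2]_x F x)%E.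
Proof.
move=> c0 mF F0.
have mc : measurable_fun setT ( *%R c : line -> line).
  exact: mulrl_measurable.
have ci0 : 0 <= c^-1 by rewrite invr_ge0 ltW.
rewrite !fubini_tonelli1//; last first.
  apply: (measurableT_comp mF) => /=; apply: measurable_fun_pair.
    exact: (measurableT_comp mc).
  exact: (measurableT_comp mc).
rewrite /fubini_F /=.
have mG := measurable_fun_fubini_tonelli_F (m2 := leb) _ mF F0.
rewrite /fubini_F in mG.
transitivity (\int[leb]_x (c^-1%:E * \int[leb]_y F ((c * x)%R, y)))%E.
  apply: eq_integral => x _.
  rewrite -(@ge0_integral_scale1 c (fun y => F ((c * x)%R, y)))//.
  apply: (measurableT_comp mF); exact: measurable_fun_pair.
rewrite ge0_integralZl//; last 2 first.
- exact: (measurableT_comp mG).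
- by move=> x _; exact: integral_ge0.
rewrite (@ge0_integral_scale1 c (fun x => \int[leb]_y F (x, y))%E)//.
  by rewrite muleA -EFinM -invfM -expr2.
by move=> x; exact: integral_ge0.
Qed.

Lemma diskE (x : R * R) : disk x = (x.1 ^+ 2 + x.2 ^+ 2 < 1) :> Prop.
Proof.
rewrite /disk /enorm /=; congr is_true.
by rewrite -[X in _ < X]sqrtr1 ltr_sqrt.
Qed.

(** Substitute [x = sin t]; a primitive of [2 (cos t)^2] is [t + sin t cos t]. *)
Lemma integral_sqrt_onem_sqr :
  (\int[leb]_(x in `[(-1)%R, 1%R]) (2 * Num.sqrt (1 - x ^+ 2))%:E = pi%:E)%E.
Proof.
have p0 := @pi_gt0 R.
have pi2 : - (pi / 2) <= pi / 2 :> R by lra.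
have dsin : derive1 (@sin R) = cos.
  by apply/funext => x; rewrite derive1E derive_val.
have -> : `[(-1)%R, 1%R]%classic = `[sin (- (pi / 2)), sin (pi / 2)]%classic :> set R.
  by rewrite sinN sin_pihalf.
have dF (x : R) : is_derive x 1 (fun x : R => x + sin x * cos x) (2 * cos x ^+ 2).
  rewrite (_ : 2 * cos x ^+ 2 = 1 + (sin x *: - sin x + cos x *: cos x)); last first.
    by rewrite /GRing.scale /=; have := cos2Dsin2 x; nra.
  exact: is_deriveD.
have cF (x : R) : {for x, continuous (fun x : R => x + sin x * cos x)}.
  by apply: differentiable_continuous; apply/derivable1_diffP; exact: ex_derive.
rewrite integration_by_substitution_increasing//.
- transitivity (\int[leb]_(x in `[(- (pi / 2))%R, (pi / 2)%R]) (2 * cos x ^+ 2)%:E)%E.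
    apply: eq_integral => x /[!inE]; rewrite /= in_itv /= => xI.
    rewrite dsin /= !fctE /= -cos2sin2 sqrtr_sqr ger0_norm ?expr2 ?mulrA//.
    exact: cos_ge0_pihalf.
  rewrite (@continuous_FTC2 _ _ (fun x => x + sin x * cos x)); last 4 first.
  + lra.
  + apply: continuous_subspaceT => x; apply: cvgM; first exact: cvg_cst.
    by apply: cvgM; exact: continuous_cos.
  + split; [by move=> x _; exact: ex_derive|apply: cvg_at_right_filter|apply: cvg_at_left_filter]; exact: cF.
  + by move=> x _; rewrite derive1E derive_val.
  by rewrite sinN cosN sin_pihalf cos_pihalf !mulr0 !addr0 -EFinB; congr EFin; lra.
- by move=> x y xI yI; rewrite ltr_sin.
- by rewrite dsin => x _; exact: continuous_cos.
- by rewrite dsin; apply: cvgP; apply: cvg_at_right_filter; exact: continuous_cos.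
- by rewrite dsin; apply: cvgP; apply: cvg_at_left_filter; exact: continuous_cos.
- split; [by []|apply: cvg_at_right_filter|apply: cvg_at_left_filter]; exact: continuous_sin.
- apply: continuous_subspaceT => x; apply: cvgM; first exact: cvg_cst.
  apply: (@continuous_comp _ _ _ (fun x : R => 1 - x ^+ 2)); last exact: sqrt_continuous.
  by apply: cvgB; [exact: cvg_cst|exact: exprn_continuous].
Qed.

Lemma area_disk : leb2 disk = pi%:E.
Proof.
rewrite /product_measure1 /= -integral_sqrt_onem_sqr [RHS]integral_mkcond.
apply: eq_integral => x _ /=.
have x2 : 0 <= x ^+ 2 by exact: sqr_ge0.
rewrite patchE; have [x1|x1] := boolP (-1 <= x <= 1).
  rewrite mem_set /= ?in_itv//.
  have x3 : 0 <= 1 - x ^+ 2 by case/andP: x1; nra.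
  rewrite (_ : xsection _ _ = `]- Num.sqrt (1 - x ^+ 2), Num.sqrt (1 - x ^+ 2)[%classic).
    rewrite lebesgue_measure_itv/= lte_fin; case: ifPn => h.
      by rewrite -EFinB opprK -mulr2n mulr_natl.
    have := sqrtr_ge0 (1 - x ^+ 2); rewrite le_eqVlt => /predU1P[<-|h1].
      by rewrite mulr0.
    exfalso; lra.
  apply/seteqP; split => y; rewrite /xsection /= inE diskE /= in_itv/= -ltr_norml -[`|y|]sqrtr_sqr.
    move=> xy; rewrite ltr_sqrt//; last by have := sqr_ge0 y; lra.
    lra.
  have [h|h] := ltP 0 (1 - x ^+ 2).
    rewrite ltr_sqrt//; lra.
  rewrite (ler0_sqrtr h) ltNge sqrtr_ge0//.
rewrite memNset /= ?in_itv/=; last exact/negP.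
rewrite (_ : xsection _ _ = set0) ?measure0//.
apply/seteqP; split => y //; rewrite /xsection /= inE diskE /= => h.
have y2 : 0 <= y ^+ 2 by exact: sqr_ge0.
by case/negP: x1; apply/andP; split; nra.
Qed.

End plane_measure.

(** * Integrable real functions *)

Section real_integrable.
Context d (T : measurableType d) (R : realType).
Variables (mu : {measure set T -> \bar R}) (D : set T) (mD : measurable D).
Implicit Types f g : T -> R.
Local Notation L1 f := (mu.-integrable D (EFin \o f)).

Lemma integrable_measurable f : L1 f -> measurable_fun D f.
Proof. by move=> /(measurable_int mu)/measurable_EFinP. Qed.

Lemma integrable_addr f g : L1 f -> L1 g -> L1 (fun x => f x + g x).
Proof. by move=> L1f L1g; exact: (integrableD mD L1f L1g). Qed.

Lemma integrable_subr f g : L1 f -> L1 g -> L1 (fun x => f x - g x).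
Proof. by move=> L1f L1g; exact: (integrableB mD L1f L1g). Qed.

Lemma integrable_scaler (k : R) f : L1 f -> L1 (fun x => k * f x).
Proof. by move=> L1f; exact: (integrableZl mD k L1f). Qed.

Lemma integrable_dominated f g : measurable_fun D f -> L1 g ->
  (forall x, D x -> `|f x| <= g x) -> L1 f.
Proof.
move=> mf L1g fg; apply: le_integrable L1g => //; first exact/measurable_EFinP.
by move=> x Dx /=; rewrite lee_fin; apply: le_trans (fg _ Dx) _; exact: ler_norm.
Qed.

Lemma integrable_sqr_mul f g : measurable_fun D f -> measurable_fun D g ->
  L1 (fun x => f x ^+ 2) -> L1 (fun x => g x ^+ 2) ->
  L1 (fun x => f x * g x).
Proof.
move=> mf mg L1f L1g; apply: integrable_dominated (integrable_addr L1f L1g) _.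
  exact: measurable_funM.
move=> x _; rewrite normrM -(real_normK (num_real (f x))) -(real_normK (num_real (g x))).
have := sqr_ge0 (`|f x| - `|g x|); have := sqr_ge0 (`|f x|); have := sqr_ge0 (`|g x|).
nra.
Qed.

Lemma Rintegral_quadratic (a b : R) f g : measurable_fun D f -> measurable_fun D g ->
  L1 (fun x => f x ^+ 2) -> L1 (fun x => g x ^+ 2) ->
  \int[mu]_(x in D) (a * f x + b * g x) ^+ 2 =
  a ^+ 2 * \int[mu]_(x in D) (f x ^+ 2) + 2 * a * b * \int[mu]_(x in D) (f x * g x)
  + b ^+ 2 * \int[mu]_(x in D) (g x ^+ 2).
Proof.
move=> mf mg L1f L1g; have L1fg := integrable_sqr_mul mf mg L1f L1g.
rewrite -!RintegralZl//.
have A := integrable_scaler (a ^+ 2) L1f.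
have B := integrable_scaler (2 * a * b) L1fg.
have C := integrable_scaler (b ^+ 2) L1g.
have AB := integrable_addr A B.
rewrite -RintegralD// -RintegralD//.
by apply: eq_Rintegral => x _; ring.
Qed.

(** The quadratic form of [Rintegral_quadratic] is nonnegative; evaluate it at
    its minimum. *)
Lemma Rintegral_cauchy_schwarz f g : measurable_fun D f -> measurable_fun D g ->
  L1 (fun x => f x ^+ 2) -> L1 (fun x => g x ^+ 2) ->
  (\int[mu]_(x in D) (f x * g x)) ^+ 2 <=
  \int[mu]_(x in D) (f x ^+ 2) * \int[mu]_(x in D) (g x ^+ 2).
Proof.
move=> mf mg L1f L1g.
have Q a b : 0 <= a ^+ 2 * \int[mu]_(x in D) (f x ^+ 2)
    + 2 * a * b * \int[mu]_(x in D) (f x * g x) + b ^+ 2 * \int[mu]_(x in D) (g x ^+ 2).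
  by rewrite -Rintegral_quadratic//; apply: Rintegral_ge0 => x _; exact: sqr_ge0.
have F0 : 0 <= \int[mu]_(x in D) (f x ^+ 2) by apply: Rintegral_ge0 => x _; exact: sqr_ge0.
set F := \int[mu]_(x in D) (f x ^+ 2) in F0 Q *.
set G := \int[mu]_(x in D) (g x ^+ 2) in Q *.
set X := \int[mu]_(x in D) (f x * g x) in Q *.
have [F_eq0|F_neq0] := eqVneq F 0.
  have [->|X0] := eqVneq X 0; first by rewrite F_eq0 mul0r expr0n.
  have := Q (- (G + 1) / (2 * X)) 1; rewrite F_eq0.
  have -> : 2 * (- (G + 1) / (2 * X)) * 1 * X = - (G + 1) by field.
  lra.
have := Q (- X) F.
have : 0 < F by rewrite lt_neqAle eq_sym F_neq0.
nra.
Qed.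

Lemma Rintegral_EFin f : L1 f -> (\int[mu]_(x in D) (f x)%:E = (\int[mu]_(x in D) f x)%R%:E)%E.
Proof. by move=> L1f; rewrite /Rintegral fineK//; exact: integrable_fin_num. Qed.

Lemma ge0_integral_bounded (M : R) f : measurable_fun D f -> (forall x, D x -> 0 <= f x) ->
  (\int[mu]_(x in D) (f x)%:E <= M%:E)%E ->
  L1 f /\ \int[mu]_(x in D) f x <= M.
Proof.
move=> mf f0 fM; have L1f : L1 f.
  apply/integrableP; split; first exact/measurable_EFinP.
  under eq_integral => x /[!inE] Dx do rewrite /= ger0_norm ?f0//.
  by apply: le_lt_trans fM _; rewrite ltry.
by split => //; rewrite -lee_fin -Rintegral_EFin.
Qed.

End real_integrable.

(** * Functions with a continuous derivative on the line *)

Section one_variable.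
Context {R : realType}.
Notation leb := (@lebesgue_measure R).

Lemma continuous_is_derive (f f' : R -> R) :
  (forall x : R, is_derive x 1 f (f' x)) -> continuous f.
Proof.
by move=> df x; apply: differentiable_continuous; apply/derivable1_diffP; exact: ex_derive.
Qed.

Lemma integral_is_derive (f f' : R -> R) (a b : R) : a < b ->
  (forall x : R, is_derive x 1 f (f' x)) -> continuous f' ->
  (\int[leb]_(x in `[a, b]) (f' x)%:E = (f b - f a)%:E)%E.
Proof.
move=> ab df cf'; have cf := continuous_is_derive df.
rewrite (@continuous_FTC2 _ f' f)//; first exact: continuous_subspaceT.
- split; [by move=> x _; exact: ex_derive|apply: cvg_at_right_filter|apply: cvg_at_left_filter]; exact: cf.
- by move=> x _; rewrite derive1E derive_val.
Qed.

Lemma norm_le_integral_derive (f f' : R -> R) (a : R) :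
  (forall x : R, is_derive x 1 f (f' x)) -> continuous f' ->
  (forall x, x <= a -> f x = 0) ->
  (forall x, `|f x|%:E <= \int[leb]_s `|f' s|%:E)%E.
Proof.
move=> df cf' fa x.
have mf' : measurable_fun [set: measurableTypeR R] (fun s => `|f' s|%:E).
  by apply/measurable_EFinP; apply: measurableT_comp => //; exact: continuous_measurable_fun.
have [xa|ax] := leP x a.
  by rewrite fa// normr0; apply: integral_ge0 => s _; rewrite lee_fin.
apply: (@le_trans _ _ (\int[leb]_(s in `[a, x]) `|f' s|%:E)%E); last first.
  by apply: ge0_subset_integral => // s _; rewrite lee_fin.
have -> : `|f x|%:E = (`|\int[leb]_(s in `[a, x]) (f' s)%:E|)%E.
  by rewrite integral_is_derive// (fa a)// subr0.
apply: le_abse_integral => //.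
by apply/measurable_EFinP; apply: measurable_funTS; exact: continuous_measurable_fun.
Qed.

End one_variable.

(** * Continuously differentiable functions vanishing off the disk *)

Section disk_C1.
Context {R : realType}.
Notation leb := (@lebesgue_measure R).
Notation leb2 := (leb \x leb)%E.
Notation plane := (measurableTypeR R * measurableTypeR R)%type.
Implicit Types (f g : R * R -> R).

Lemma is_derive_slice1 f (x y d : R) :
  is_derive (x, y) (e1 : R * R) f d <-> is_derive x 1 (fun s => f (s, y)) d.
Proof.
have E : (fun h : R => h^-1 *: ((f \o shift (x, y)) (h *: (e1 : R * R)) - f (x, y)))
   = (fun h : R => h^-1 *: (((fun s => f (s, y)) \o shift x) (h *: 1) - f (x, y))).
  apply/funext => h /=; congr (_ *: (f _ - _)).
  by apply: injective_projections => //=; rewrite scaler0 add0r.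
split=> -[]; rewrite /derivable /derive => A B; apply: DeriveDef; rewrite /derivable /derive /=.
- by move: A; rewrite E.
- by move: B; rewrite E.
- by rewrite E.
- by rewrite E.
Qed.

Lemma is_derive_slice2 f (x y d : R) :
  is_derive (x, y) (e2 : R * R) f d <-> is_derive y 1 (fun s => f (x, s)) d.
Proof.
have E : (fun h : R => h^-1 *: ((f \o shift (x, y)) (h *: (e2 : R * R)) - f (x, y)))
   = (fun h : R => h^-1 *: (((fun s => f (x, s)) \o shift y) (h *: 1) - f (x, y))).
  apply/funext => h /=; congr (_ *: (f _ - _)).
  by apply: injective_projections => //=; rewrite scaler0 add0r.
split=> -[]; rewrite /derivable /derive => A B; apply: DeriveDef; rewrite /derivable /derive /=.
- by move: A; rewrite E.
- by move: B; rewrite E.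
- by rewrite E.
- by rewrite E.
Qed.

(** The partial derivatives are arguments, rather than computed, because the
    class is then visibly stable under differences, powers and dilations, and
    the estimates never have to unfold a directional derivative. *)
Record disk_C1 f f1 f2 := DiskC1 {
  C1_cont : continuous f;
  C1_cont1 : continuous f1;
  C1_cont2 : continuous f2;
  C1_derive1 : forall x : R * R, is_derive x (e1 : R * R) f (f1 x);
  C1_derive2 : forall x : R * R, is_derive x (e2 : R * R) f (f2 x);
  C1_out : forall x, ~ disk x -> f x = 0;
  C1_out1 : forall x, ~ disk x -> f1 x = 0;
  C1_out2 : forall x, ~ disk x -> f2 x = 0 }.

Lemma near_derive0 f x (v : R * R) : (\forall y \near x, f y = 0) -> 'D_v f x = 0.
Proof.
move=> f0; rewrite /derive.
apply/cvg_lim => //; apply: cvg_near_cst.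
have fx : f x = 0 by exact: nbhs_singleton f0.
have cv : h *: v + x @[h --> (0 : R)^'] --> x.
  have {2}<- : 0 *: v + x = x by rewrite scale0r add0r.
  apply: cvgD; last exact: cvg_cst.
  by apply: cvgZ; [exact: cvg_within|exact: cvg_cst].
have h0 : \forall h \near (0 : R)^', f (h *: v + x) = 0 by exact: (cv _ f0).
apply: filterS h0 => h /= ->.
by rewrite fx subr0 scaler0.
Qed.

Lemma test_function_disk_C1 f : test_function f -> disk_C1 f ('D_e1 f) ('D_e2 f).
Proof.
move=> [sf cf fd]; have [c [d1 d2 [c1 _] [c2 _]]] := sf 1%N.
have out x : ~ disk x -> \forall y \near x, f y = 0.
  move=> dx.
  have : open (~` supp f) by apply: closed_openC; exact: closed_closure.
  rewrite openE => /(_ x); rewrite /interior => h.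
  have : nbhs x (~` supp f) by apply: h => /fd.
  apply: filterS => y; apply: contra_notP => /eqP fy; exact: subset_closure.
split => // x.
- by move=> /out /nbhs_singleton.
- by move=> /out /near_derive0.
- by move=> /out /near_derive0.
Qed.

Lemma disk_C1_sub f f1 f2 g g1 g2 : disk_C1 f f1 f2 -> disk_C1 g g1 g2 ->
  disk_C1 (fun x => f x - g x) (fun x => f1 x - g1 x) (fun x => f2 x - g2 x).
Proof.
move=> [c c1 c2 d1 d2 o o1 o2] [c' c1' c2' d1' d2' o' o1' o2']; split.
- by move=> x; apply: cvgB; [exact: c|exact: c'].
- by move=> x; apply: cvgB; [exact: c1|exact: c1'].
- by move=> x; apply: cvgB; [exact: c2|exact: c2'].
- by move=> x; exact: is_deriveB.
- by move=> x; exact: is_deriveB.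
- by move=> x xd; rewrite o// o'// subr0.
- by move=> x xd; rewrite o1// o1'// subr0.
- by move=> x xd; rewrite o2// o2'// subr0.
Qed.

Lemma enormZ (c : R) x : 0 <= c -> enorm (c *: x) = c * enorm x.
Proof.
move=> c0; rewrite /enorm /= /GRing.scale /=.
by rewrite !exprMn -mulrDr sqrtrM ?sqr_ge0// sqrtr_sqr ger0_norm.
Qed.

Lemma continuous_scale (c : R) : continuous (fun x : R * R => c *: x).
Proof. by move=> x; apply: cvgZr; exact: cvg_id. Qed.

Lemma continuous_comp_scale (c : R) f : continuous f -> continuous (fun x : R * R => f (c *: x)).
Proof.
move=> cf x; apply: (@continuous_comp _ _ _ (fun x : R * R => c *: x) f).
  exact: continuous_scale.
exact: cf.
Qed.

Lemma is_derive_mulrl (c x : R) : is_derive x 1 ( *%R c) c.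
Proof.
by apply: is_derive_eq (is_deriveZ c (is_derive_id x (1 : R))) _; rewrite /GRing.scale /= mulr1.
Qed.

Lemma is_derive_scale1 f (c d : R) (x : R * R) : is_derive (c *: x) (e1 : R * R) f d ->
  is_derive x (e1 : R * R) (fun x => f (c *: x)) (c * d).
Proof.
case: x => x y /is_derive_slice1 h; apply/is_derive_slice1; rewrite mulrC.
apply: (@is_derive1_comp _ (fun s => f (s, c * y)) ( *%R c)) => //.
exact: is_derive_mulrl.
Qed.

Lemma is_derive_scale2 f (c d : R) (x : R * R) : is_derive (c *: x) (e2 : R * R) f d ->
  is_derive x (e2 : R * R) (fun x => f (c *: x)) (c * d).
Proof.
case: x => x y /is_derive_slice2 h; apply/is_derive_slice2; rewrite mulrC.
apply: (@is_derive1_comp _ (fun s => f (c * x, s)) ( *%R c)) => //.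
exact: is_derive_mulrl.
Qed.

Lemma disk_C1_scale (c : R) f f1 f2 : 1 <= c -> disk_C1 f f1 f2 ->
  disk_C1 (fun x => f (c *: x)) (fun x => c * f1 (c *: x)) (fun x => c * f2 (c *: x)).
Proof.
move=> c1 [cf cf1 cf2 d1 d2 o o1 o2].
have c0 : 0 <= c by exact: le_trans c1.
have out x : ~ disk x -> ~ disk (c *: x).
  rewrite /disk /= enormZ// => /negP; rewrite -leNgt => h; apply/negP; rewrite -leNgt.
  by rewrite (le_trans h)// ler_peMl// sqrtr_ge0.
have cs : continuous (fun x : R * R => c *: x) by exact: continuous_scale.
split.
- exact: continuous_comp_scale.
- by move=> x; apply: cvgM; [exact: cvg_cst|exact: continuous_comp_scale].
- by move=> x; apply: cvgM; [exact: cvg_cst|exact: continuous_comp_scale].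
- by move=> x; apply: is_derive_scale1.
- by move=> x; apply: is_derive_scale2.
- by move=> x /out/o.
- by move=> x /out/o1 ->; rewrite mulr0.
- by move=> x /out/o2 ->; rewrite mulr0.
Qed.

Lemma disk_box (x : R * R) : disk x -> (`|x.1| <= 1) /\ (`|x.2| <= 1).
Proof.
rewrite diskE => h; have := sqr_ge0 x.1; have := sqr_ge0 x.2.
by rewrite !ler_norml; split; apply/andP; split; nra.
Qed.

Lemma continuous_disk_bounded f : continuous f -> (forall x, ~ disk x -> f x = 0) ->
  exists M, 0 <= M /\ forall x, `|f x| <= M.
Proof.
move=> cf f0.
have : compact (f @` (`[-1, 1]%classic `*` `[-1, 1]%classic)).
  apply: continuous_compact; first exact: continuous_subspaceT.
  by apply: compact_setX; exact: segment_compact.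
move=> /compact_bounded[M [_ /(_ (`|M| + 1))]].
have -> : M < `|M| + 1 by rewrite (le_lt_trans (ler_norm _))// ltrDl.
move=> /(_ erefl) fM; exists (`|M| + 1); split; first by rewrite addr_ge0.
move=> x; have [/disk_box[x1 x2]|/f0 ->] := pselect (disk x); last first.
  by rewrite normr0 addr_ge0.
by apply: fM; exists x => //; split; rewrite /= in_itv/= -ler_norml.
Qed.

Lemma finite_disk : (leb2 disk < +oo)%E.
Proof. by rewrite area_disk ltry. Qed.

Lemma integrable_disk_bounded (M : R) f : measurable_fun (disk : set plane) f ->
  (forall x, disk x -> `|f x| <= M) -> leb2.-integrable disk (EFin \o f).
Proof.
move=> mf fM; apply: measurable_bounded_integrable => //.
- exact: measurable_disk.
- exact: finite_disk.
- exists M; split; first by rewrite num_real.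
  by move=> N MN x /fM /le_trans; apply; exact: ltW.
Qed.

Lemma integrable_disk_continuous f : continuous f -> (forall x, ~ disk x -> f x = 0) ->
  leb2.-integrable disk (EFin \o f).
Proof.
move=> cf /(continuous_disk_bounded cf)[M [_ fM]].
apply: (@integrable_disk_bounded M) => //.
by apply: measurable_funTS; exact: continuous_measurable_plane.
Qed.

Lemma integral_planeE f : (forall x, ~ disk x -> f x = 0) ->
  (\int[leb2]_x (f x)%:E = \int[leb2]_(x in disk) (f x)%:E)%E.
Proof.
move=> f0; rewrite [RHS]integral_mkcond; apply: eq_integral => x _.
rewrite patchE; case: ifPn => // /negP xd.
by rewrite f0// => dx; apply: xd; rewrite inE.
Qed.

End disk_C1.

(** * Planar Sobolev inequalities *)

Section sobolev.
Context {R : realType}.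
Notation leb := (@lebesgue_measure R).
Notation leb2 := (leb \x leb)%E.
Notation line := (measurableTypeR R).
Notation plane := (measurableTypeR R * measurableTypeR R)%type.
Implicit Types (f g : R * R -> R).

Lemma continuous_slice1 f (y : R) : continuous f -> continuous (fun x : R => f (x, y)).
Proof.
move=> cf x; apply: (@continuous_comp _ _ _ (fun x : R => (x, y)) f); last exact: cf.
by move=> A; apply: (cvg_pair (f := id) (g := cst y) cvg_id (cvg_cst _)).
Qed.

Lemma continuous_slice2 f (x : R) : continuous f -> continuous (fun y : R => f (x, y)).
Proof.
move=> cf y; apply: (@continuous_comp _ _ _ (fun y : R => (x, y)) f); last exact: cf.
by move=> A; apply: (cvg_pair (f := cst x) (g := id) (cvg_cst _) cvg_id).
Qed.

Lemma measurable_EFin_norm f : continuous f ->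
  measurable_fun [set: plane] (fun x : R * R => `|f x|%:E).
Proof.
move=> cf; apply/measurable_EFinP; apply: measurableT_comp => //.
exact: continuous_measurable_plane.
Qed.

(** Each of the two slice integrals bounds [|f (x, y)|], by integration from the
    left, respectively from below, where [f] vanishes. *)
Lemma slice_bound f f1 f2 : disk_C1 f f1 f2 -> forall x y : R,
  ((f (x, y) ^+ 2)%:E <=
   (\int[leb]_s `|f1 (s, y)|%:E) * (\int[leb]_s `|f2 (x, s)|%:E))%E.
Proof.
move=> C x y; have out (z : R * R) : (z.1 <= -1) \/ (z.2 <= -1) -> f z = 0.
  move=> h; apply: (C1_out C); rewrite diskE => h'.
  have := sqr_ge0 z.1; have := sqr_ge0 z.2; case: h; nra.
have A := @norm_le_integral_derive _ (fun s => f (s, y)) (fun s => f1 (s, y)) (-1).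
have B := @norm_le_integral_derive _ (fun s => f (x, s)) (fun s => f2 (x, s)) (-1).
rewrite -(real_normK (num_real _)) expr2 EFinM; apply: lee_pmul => //.
- apply: A => [s||s s1]; first by apply/is_derive_slice1; exact: C1_derive1 C _.
    by apply: continuous_slice1; exact: C1_cont1 C.
  by apply: out; left.
- apply: B => [s||s s1]; first by apply/is_derive_slice2; exact: C1_derive2 C _.
    by apply: continuous_slice2; exact: C1_cont2 C.
  by apply: out; right.
Qed.

(** Integrate [slice_bound]: the first factor depends on [y] only and the second
    on [x] only (Gagliardo's argument). *)
Lemma integral_sqr_le_prod f f1 f2 : disk_C1 f f1 f2 ->
  \int[leb2]_(x in disk) (f x ^+ 2) <=
  \int[leb2]_(x in disk) `|f1 x| * \int[leb2]_(x in disk) `|f2 x|.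
Proof.
move=> C; have [cf cf1 cf2 _ _ o o1 o2] := C.
have nc (g : R * R -> R) : continuous g -> continuous (fun x => `|g x|).
  by move=> cg x; apply: cvg_norm; exact: cg.
have L1 (g : R * R -> R) : continuous g -> (forall x, ~ disk x -> g x = 0) ->
    leb2.-integrable disk (EFin \o (fun x => `|g x|)).
  move=> cg og; apply: integrable_disk_continuous; first exact: nc.
  by move=> x /og ->; rewrite normr0.
have L2 : leb2.-integrable disk (EFin \o (fun x => f x ^+ 2)).
  apply: integrable_disk_continuous => [x|x /o ->]; last by rewrite expr0n.
  by apply: cvgM; exact: cf.
have L11 := L1 _ cf1 o1; have L12 := L1 _ cf2 o2.
rewrite -lee_fin EFinM -(Rintegral_EFin measurable_disk L2) -(Rintegral_EFin measurable_disk L11) -(Rintegral_EFin measurable_disk L12).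
rewrite -(@integral_planeE _ (fun x => f x ^+ 2)); last by move=> x /o ->; rewrite expr0n.
rewrite -(@integral_planeE _ (fun x => `|f1 x|)); last by move=> x /o1 ->; rewrite normr0.
rewrite -(@integral_planeE _ (fun x => `|f2 x|)); last by move=> x /o2 ->; rewrite normr0.
rewrite fubini_tonelli1; last 2 first.
- by apply/measurable_EFinP; apply: measurable_funX; exact: continuous_measurable_plane.
- by move=> x; rewrite lee_fin sqr_ge0.
rewrite (@fubini_tonelli2 _ _ _ _ _ leb leb (fun x => `|f1 x|%:E)); last 2 first.
- exact: measurable_EFin_norm.
- by [].
rewrite (@fubini_tonelli1 _ _ _ _ _ leb leb (fun x => `|f2 x|%:E)); last 2 first.
- exact: measurable_EFin_norm.
- by [].
rewrite /fubini_F /fubini_G.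
have n0 (g : R * R -> R) x : (0 <= `|g x|%:E)%E by rewrite lee_fin.
have m1 := measurable_fun_fubini_tonelli_G (m1 := leb) _ (measurable_EFin_norm cf1) (n0 f1).
have m2 := measurable_fun_fubini_tonelli_F (m2 := leb) _ (measurable_EFin_norm cf2) (n0 f2).
rewrite /fubini_F in m2; rewrite /fubini_G in m1.
have i10 : (0 <= \int[leb]_y \int[leb]_x `|f1 (x, y)|%:E)%E.
  by apply: integral_ge0 => y _; apply: integral_ge0.
rewrite -ge0_integralZl//; last by move=> x _; exact: integral_ge0.
have mm : measurable_fun [set: line] (fun x => \int[leb]_y (f (x, y) ^+ 2)%:E)%E.
  apply: (measurable_fun_fubini_tonelli_F (m2 := leb) (fun z => (f z ^+ 2)%:E)) => //.
    by apply/measurable_EFinP; apply: measurable_funX; exact: continuous_measurable_plane.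
  by move=> x; rewrite lee_fin sqr_ge0.
apply: ge0_le_integral => //.
- by move=> x _; apply: integral_ge0 => y _; rewrite lee_fin sqr_ge0.
- by apply: emeasurable_funM.
move=> x _; rewrite muleC -ge0_integralZl//; last first.
- exact: integral_ge0.
- by move=> y _; exact: integral_ge0.
apply: ge0_le_integral => //.
- by move=> y _; rewrite lee_fin sqr_ge0.
- apply/measurable_EFinP; apply: measurable_funX; apply: continuous_measurable_fun.
  exact: continuous_slice2.
- by apply: emeasurable_funM.
by move=> y _; rewrite muleC; exact: slice_bound.
Qed.

Definition dirichlet f1 f2 : R := \int[leb2]_(x in disk) (f1 x ^+ 2 + f2 x ^+ 2).

Lemma disk_C1_expS f f1 f2 m : disk_C1 f f1 f2 ->
  disk_C1 (fun x => f x ^+ m.+1) (fun x => m.+1%:R * f x ^+ m * f1 x)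
    (fun x => m.+1%:R * f x ^+ m * f2 x).
Proof.
move=> [cf cf1 cf2 d1 d2 o o1 o2].
have cX k : continuous (fun x => f x ^+ k).
  move=> x; apply: (@continuous_comp _ _ _ f (fun y => y ^+ k)); first exact: cf.
  exact: exprn_continuous.
have E : (fun x => f x ^+ m.+1) = f ^+ m.+1 by apply/funext => x; rewrite exprfctE.
split.
- exact: cX.
- by move=> x; apply: cvgM; [apply: cvgM; [exact: cvg_cst|exact: cX]|exact: cf1].
- by move=> x; apply: cvgM; [apply: cvgM; [exact: cvg_cst|exact: cX]|exact: cf2].
- move=> x; rewrite E; apply: is_derive_eq (is_deriveX m.+1 (d1 x)) _.
  by rewrite /GRing.scale /= mulr_natl.
- move=> x; rewrite E; apply: is_derive_eq (is_deriveX m.+1 (d2 x)) _.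
  by rewrite /GRing.scale /= mulr_natl.
- by move=> x /o ->; rewrite expr0n.
- by move=> x /o1 ->; rewrite mulr0.
- by move=> x /o2 ->; rewrite mulr0.
Qed.

Lemma continuous_exprn f n : continuous f -> continuous (fun x : R * R => f x ^+ n).
Proof.
move=> cf x; apply: (@continuous_comp _ _ _ f (fun y => y ^+ n)); first exact: cf.
exact: exprn_continuous.
Qed.

Lemma integrable_disk_exprn f n : continuous f -> (forall x, ~ disk x -> f x = 0) ->
  leb2.-integrable disk (EFin \o (fun x => f x ^+ n)).
Proof.
move=> cf f0; have [M [M0 fM]] := continuous_disk_bounded cf f0.
apply: (@integrable_disk_bounded _ (M ^+ n)) => [|x _].
  by apply: measurable_funTS; apply: continuous_measurable_plane; exact: continuous_exprn.
by rewrite normrX lerXn2r ?nnegrE.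
Qed.

Lemma dirichletE f f1 f2 : disk_C1 f f1 f2 ->
  dirichlet f1 f2 = \int[leb2]_(x in disk) (f1 x ^+ 2) + \int[leb2]_(x in disk) (f2 x ^+ 2).
Proof.
move=> [_ cf1 cf2 _ _ _ o1 o2]; rewrite /dirichlet RintegralD//.
- exact: measurable_disk.
- exact: integrable_disk_exprn.
- exact: integrable_disk_exprn.
Qed.

Lemma dirichlet_ge0 f1 f2 : 0 <= dirichlet f1 f2.
Proof. by apply: Rintegral_ge0 => x _; rewrite addr_ge0// sqr_ge0. Qed.

Lemma mul_le_of_sqr_le (X Y a c p q : R) :
  X ^+ 2 <= c * (a * p) -> Y ^+ 2 <= c * (a * q) -> X * Y <= c * (a * (p + q)).
Proof.
move=> hX hY; have := sqr_ge0 X; have := sqr_ge0 Y; have := sqr_ge0 (X - Y).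
nra.
Qed.

(** [integral_sqr_le_prod] for [f^(m+1)], followed by the Cauchy-Schwarz
    inequality for [f^m] against each partial derivative. *)
Lemma integral_exp_step f f1 f2 m : disk_C1 f f1 f2 ->
  \int[leb2]_(x in disk) (f x ^+ (2 * m.+1)) <=
  m.+1%:R ^+ 2 * dirichlet f1 f2 * \int[leb2]_(x in disk) (f x ^+ (2 * m)).
Proof.
move=> C; have [cf cf1 cf2 _ _ o o1 o2] := C.
under eq_Rintegral do rewrite mulnC exprM.
apply: le_trans (integral_sqr_le_prod (disk_C1_expS m C)) _.
have md (g : R * R -> R) : continuous g -> measurable_fun (disk : set plane) g.
  by move=> cg; apply: measurable_funTS; exact: continuous_measurable_plane.
have cXm : continuous (fun x => f x ^+ m) by exact: continuous_exprn.
have bound (g : R * R -> R) : continuous g -> (forall x, ~ disk x -> g x = 0) ->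
    (\int[leb2]_(x in disk) `|m.+1%:R * f x ^+ m * g x|) ^+ 2 <=
    m.+1%:R ^+ 2 * (\int[leb2]_(x in disk) (f x ^+ (2 * m)) * \int[leb2]_(x in disk) (g x ^+ 2)).
  move=> cg og.
  have Ig : leb2.-integrable disk (EFin \o (fun x => `|g x| ^+ 2)).
    under eq_fun do rewrite real_normK ?num_real//.
    exact: integrable_disk_exprn.
  have If : leb2.-integrable disk (EFin \o (fun x => `|f x ^+ m| ^+ 2)).
    have [M [M0 fM]] := continuous_disk_bounded cf o.
    apply: (@integrable_disk_bounded _ ((M ^+ m) ^+ 2)) => [|x _].
      apply: measurable_funX; apply: measurableT_comp => //; exact: md.
    by rewrite normrX normr_id lerXn2r ?nnegrE ?exprn_ge0// normrX lerXn2r ?nnegrE.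
  have mg : measurable_fun (disk : set plane) (fun x => `|g x|).
    by apply: measurableT_comp => //; exact: md.
  have mf : measurable_fun (disk : set plane) (fun x => `|f x ^+ m|).
    by apply: measurableT_comp => //; exact: md.
  under eq_Rintegral do rewrite 2!normrM normr_nat -mulrA.
  rewrite RintegralZl//; last 2 first.
  - exact: measurable_disk.
  - exact: (integrable_sqr_mul measurable_disk mf mg If Ig).
  rewrite exprMn ler_wpM2l ?sqr_ge0//.
  apply: le_trans (Rintegral_cauchy_schwarz measurable_disk mf mg If Ig) _.
  under eq_Rintegral do rewrite real_normK ?num_real// -exprM mulnC.
  by under [X in _ * X <= _]eq_Rintegral do rewrite real_normK ?num_real//.
have B1 := bound _ cf1 o1; have B2 := bound _ cf2 o2.
rewrite (dirichletE C).
set X := \int[leb2]_(x in disk) `|_ * f1 _| in B1 *.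
set Y := \int[leb2]_(x in disk) `|_ * f2 _| in B2 *.
by rewrite -mulrA [X in _ <= _ * X]mulrC; exact: mul_le_of_sqr_le B1 B2.
Qed.

(** [D] stands for a bound on the Dirichlet energy and [N] for a bound on the
    square integral.  Unlike the Sobolev inequality itself, moment bounds make
    sense without derivatives and pass to almost everywhere limits. *)
Definition moment_bound (g : R * R -> R) (D N : R) : Prop :=
  measurable_fun (disk : set plane) g /\
  forall m, (0 < m)%N ->
    leb2.-integrable disk (EFin \o (fun x => g x ^+ (2 * m))) /\
    \int[leb2]_(x in disk) (g x ^+ (2 * m)) <= (m`!%:R) ^+ 2 * D ^+ m.-1 * N.

Lemma disk_C1_moment_bound f f1 f2 D N : disk_C1 f f1 f2 ->
  dirichlet f1 f2 <= D -> \int[leb2]_(x in disk) (f x ^+ 2) <= N ->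
  moment_bound f D N.
Proof.
move=> C fD fN; have [cf cf1 cf2 _ _ o o1 o2] := C; split.
  by apply: measurable_funTS; exact: continuous_measurable_plane.
have D0 := dirichlet_ge0 f1 f2.
case=> // m _; split; first exact: integrable_disk_exprn.
elim: m => [|m IHm] /=; first by rewrite muln1 expr1n expr0 !mul1r.
apply: le_trans (integral_exp_step m.+1 C) _.
rewrite factS natrM exprMn (_ : D ^+ m.+2.-1 = D * D ^+ m); last exact: exprS.
have I0 : 0 <= \int[leb2]_(x in disk) (f x ^+ (2 * m.+1)).
  by apply: Rintegral_ge0 => x _; rewrite exprM exprn_ge0// sqr_ge0.
apply: (@le_trans _ _ (m.+2%:R ^+ 2 * D * \int[leb2]_(x in disk) (f x ^+ (2 * m.+1)))).
  by rewrite ler_wpM2r// ler_wpM2l// sqr_ge0.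
have D1 : 0 <= m.+2%:R ^+ 2 * D by rewrite mulr_ge0 ?sqr_ge0//; exact: le_trans fD.
have := ler_wpM2l D1 IHm; rewrite /=; move/le_trans; apply.
by rewrite le_eqVlt; apply/orP; left; apply/eqP; ring.
Qed.

End sobolev.

(** * Square integrals of dilation differences *)

Section square_dilation.
Context {R : realType}.
Notation leb := (@lebesgue_measure R).
Notation leb2 := (leb \x leb)%E.
Notation line := (measurableTypeR R).
Notation plane := (measurableTypeR R * measurableTypeR R)%type.

Section tonelli.
Variable F : R * R -> \bar R.
Hypotheses (mF : measurable_fun [set: plane] F) (F0 : forall z, (0 <= F z)%E).

Lemma tonelli1 : (\int[leb2]_z F z = \int[leb]_x \int[leb]_y F (x, y))%E.
Proof. exact: fubini_tonelli1. Qed.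

Lemma tonelli2 : (\int[leb2]_z F z = \int[leb]_y \int[leb]_x F (x, y))%E.
Proof. exact: fubini_tonelli2. Qed.

End tonelli.

(** [f (s x) - f x] is the integral of [x f' (r x)] over [1 <= r <= s], and
    [|x| <= 1] wherever [f' (r x)] does not vanish. *)
Lemma sqr_scale_sub_le (f f' : R -> R) (s x : R) : 1 < s ->
  (forall x : R, is_derive x 1 f (f' x)) -> continuous f' ->
  (forall x, 1 < `|x| -> f' x = 0) ->
  (((f (s * x) - f x) ^+ 2)%:E <=
   (s - 1)%:E * \int[leb]_(r in `[1%R, s]) (f' (r * x) ^+ 2)%:E)%E.
Proof.
move=> s1 df cf' f'0.
have cg : continuous (fun r : R => f' (r * x)).
  move=> r; apply: (@continuous_comp _ _ _ (fun r : R => r * x) f'); last exact: cf'.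
  by apply: cvgM; [exact: cvg_id|exact: cvg_cst].
have ch : continuous (fun r : R => f' (r * x) * x).
  by move=> r; apply: cvgM; [exact: cg|exact: cvg_cst].
have mI : measurable (`[1, s]%classic : set line) by exact: measurable_itv.
have I1 (g : R -> R) : continuous g -> leb.-integrable `[1, s] (EFin \o g).
  move=> cg'; apply: continuous_compact_integrable; first exact: segment_compact.
  exact: continuous_subspaceT.
have csq (g : R -> R) : continuous g -> continuous (fun x => g x ^+ 2).
  by move=> cg' y; apply: cvgM; exact: cg'.
have F : \int[leb]_(r in `[1, s]) (f' (r * x) * x) = f (s * x) - f x.
  have dF (r : R) : is_derive r 1 (fun r : R => f (r * x)) (f' (r * x) * x).
    apply: (@is_derive1_comp _ f (fun r : R => r * x)) => //.
    by rewrite (_ : (fun r => _) = *%R x)//; [exact: is_derive_mulrl|apply/funext => z; rewrite mulrC].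
  by rewrite /Rintegral (integral_is_derive s1 dF ch) ?mul1r.
have m1 : measurable_fun (`[1, s]%classic : set line) (cst (1 : R)) by exact: measurable_cst.
have mh : measurable_fun (`[1, s]%classic : set line) (fun r : R => f' (r * x) * x).
  by apply: measurable_funTS; exact: continuous_measurable_fun.
have J1 : leb.-integrable `[1, s] (EFin \o (fun r : R => cst (1 : R) r ^+ 2)).
  apply: (I1 (fun r => cst 1 r ^+ 2)).
  exact: (@cst_continuous _ _ (1 ^+ 2 : R)).
have := Rintegral_cauchy_schwarz mI m1 mh J1 (I1 _ (csq _ ch)).
under eq_Rintegral do rewrite mul1r.
rewrite F; under [X in _ <= X * _]eq_Rintegral do rewrite expr1n.
rewrite Rintegral_cst// mul1r.
rewrite (_ : fine _ = s - 1); last first.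
  by rewrite (_ : _ `[1, s]%classic = (s - 1)%:E)// [LHS]lebesgue_measure_itv/= lte_fin s1 -EFinB.
move=> CS.
apply: (@le_trans _ _ ((s - 1) * \int[leb]_(r in `[1, s]) (f' (r * x) ^+ 2))%:E).
  rewrite lee_fin; apply: le_trans CS _; rewrite ler_wpM2l//; first lra.
  apply: le_Rintegral => //; [exact: (I1 _ (csq _ ch))|exact: (I1 _ (csq _ cg))|].
  move=> r; rewrite /= in_itv/= => /andP[r1 rs].
  have [x1|x1] := leP `|x| 1.
    rewrite exprMn ler_piMr ?sqr_ge0// -(real_normK (num_real x)) expr_le1//.
  rewrite f'0 ?mul0r// normrM; apply: (lt_le_trans x1); rewrite ler_peMl//.
  by rewrite (le_trans r1)// ler_norm.
by rewrite EFinM -(Rintegral_EFin mI (I1 _ (csq _ cg))).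
Qed.

Lemma integral_sqr_scale_sub_le (f f' : R -> R) (s : R) : 1 <= s ->
  (forall x : R, is_derive x 1 f (f' x)) -> continuous f' ->
  (forall x, 1 < `|x| -> f' x = 0) ->
  (\int[leb]_x ((f (s * x) - f x) ^+ 2)%:E <=
   ((s - 1) ^+ 2)%:E * \int[leb]_x (f' x ^+ 2)%:E)%E.
Proof.
rewrite le_eqVlt => /predU1P[<- _ _ _|s1 df cf' f'0].
  under eq_integral do rewrite mul1r subrr expr0n.
  by rewrite integral0 subrr expr0n mul0e.
have cf := continuous_is_derive df.
have s0 : 0 < s by lra.
pose G (z : R * R) : \bar R := (f' (z.2 * z.1) ^+ 2 * \1_(`[1, s]%classic) z.2)%:E.
have cF : continuous (fun z : R * R => f' (z.2 * z.1) ^+ 2).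
  move=> z; apply: (@continuous_comp _ _ _ (fun z : R * R => z.2 * z.1) (fun y => f' y ^+ 2)).
    by apply: cvgM; [exact: continuous_snd|exact: continuous_fst].
  by apply: cvgM; exact: cf'.
have mG : measurable_fun [set: plane] G.
  apply/measurable_EFinP; apply: measurable_funM.
    exact: continuous_measurable_plane.
  by apply: (@measurableT_comp _ _ _ _ _ _ (\1_(`[1, s]%classic) : line -> R) _ (snd : plane -> line)).
have G0 z : (0 <= G z)%E by rewrite lee_fin mulr_ge0// ?sqr_ge0.
have mf2 : measurable_fun [set: line] (fun x => (f' x ^+ 2)%:E).
  by apply/measurable_EFinP; apply: measurable_funX; exact: continuous_measurable_fun.
have E x : (\int[leb]_(r in `[1%R, s]) (f' (r * x) ^+ 2)%:E = \int[leb]_r G (x, r))%E.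
  rewrite integral_mkcond; apply: eq_integral => r _; rewrite /G patchE indicE /=.
  by case: ifPn => _; rewrite ?mulr1 ?mulr0.
apply: (@le_trans _ _ (\int[leb]_x ((s - 1)%:E * \int[leb]_r G (x, r)))%E).
  apply: ge0_le_integral => //.
  - by move=> x _; rewrite lee_fin sqr_ge0.
  - apply/measurable_EFinP; apply: measurable_funX; apply: continuous_measurable_fun => x.
    apply: cvgB; last exact: cf.
    by apply: (@continuous_comp _ _ _ ( *%R s) f); [exact: mulrl_continuous|exact: cf].
  - by apply: measurable_funeM; exact: (measurable_fun_fubini_tonelli_F (m2 := leb) _ mG G0).
  by move=> x _; rewrite -E; exact: sqr_scale_sub_le.
rewrite ge0_integralZl//; last 3 first.
- exact: (measurable_fun_fubini_tonelli_F (m2 := leb) _ mG G0).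
- by move=> x _; exact: integral_ge0.
- by rewrite lee_fin; lra.
rewrite fubini_tonelli// expr2 EFinM -muleA lee_pmul2l//; last by rewrite lte_fin; lra.
have I0 : (0 <= \int[leb]_x (f' x ^+ 2)%:E)%E.
  by apply: integral_ge0 => x _; rewrite lee_fin sqr_ge0.
apply: (@le_trans _ _ (\int[leb]_r ((\1_(`[1, s]%classic) r)%:E * \int[leb]_x (f' x ^+ 2)%:E))%E).
  apply: ge0_le_integral => //.
  - by move=> r _; exact: integral_ge0.
  - exact: (measurable_fun_fubini_tonelli_G (m1 := leb) _ mG G0).
  - apply: emeasurable_funM => //; apply/measurable_EFinP; exact: measurable_indic.
  move=> r _; rewrite /G /= indicE; have [rI|rI] := boolP (r \in _); last first.
    by under eq_integral do rewrite mulr0; rewrite integral0 mul0e.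
  under eq_integral do rewrite mulr1.
  move: rI; rewrite inE /= in_itv/= => /andP[r1 rs].
  have r0 : 0 < r by lra.
  rewrite (@ge0_integral_scale1 _ r (fun x => (f' x ^+ 2)%:E))//; last first.
    by move=> x; rewrite lee_fin sqr_ge0.
  by rewrite mul1e gee_pMl// lee_fin invf_le1.
rewrite ge0_integralZr//; last first.
  by apply/measurable_EFinP; exact: measurable_indic.
rewrite integral_indic// setIT.
by rewrite (_ : _ `[1, s]%classic = (s - 1)%:E)// [LHS]lebesgue_measure_itv/= lte_fin s1 -EFinB.
Qed.

Lemma slice_out (f f1 f2 : R * R -> R) : disk_C1 f f1 f2 ->
  forall z : R * R, 1 < `|z.1| \/ 1 < `|z.2| -> f1 z = 0 /\ f2 z = 0.
Proof.
move=> C z h; have nd : ~ disk z by move=> /disk_box[]; case: h; lra.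
by rewrite (C1_out1 C nd) (C1_out2 C nd).
Qed.

(** Dilate one coordinate at a time, so that the one-dimensional estimate applies
    on slices. *)
Lemma integral_sqr_dilation_sub_le (f f1 f2 : R * R -> R) (s : R) : 1 <= s ->
  disk_C1 f f1 f2 ->
  \int[leb2]_(x in disk) ((f x - f (s *: x)) ^+ 2) <= 2 * (s - 1) ^+ 2 * dirichlet f1 f2.
Proof.
move=> s1 C; have [cf cf1 cf2 d1 d2 o o1 o2] := C.
have C' := disk_C1_sub C (disk_C1_scale s1 C); have [cg _ _ _ _ og _ _] := C'.
have s0 : 0 < s by lra.
have I1 := integrable_disk_exprn 2 cf1 o1; have I2 := integrable_disk_exprn 2 cf2 o2.
have Ig := integrable_disk_exprn 2 cg og.
rewrite (dirichletE C) -lee_fin EFinM EFinD -(Rintegral_EFin measurable_disk I1).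
rewrite -(Rintegral_EFin measurable_disk I2) -(Rintegral_EFin measurable_disk Ig).
rewrite -(@integral_planeE _ (fun x => (f x - f (s *: x)) ^+ 2)); last by move=> x /og ->; rewrite expr0n.
rewrite -(@integral_planeE _ (fun x => f1 x ^+ 2)); last by move=> x /o1 ->; rewrite expr0n.
rewrite -(@integral_planeE _ (fun x => f2 x ^+ 2)); last by move=> x /o2 ->; rewrite expr0n.
pose a (z : R * R) := (f (s *: z) - f (z.1, s * z.2)) ^+ 2.
pose b (z : R * R) := (f (z.1, s * z.2) - f z) ^+ 2.
have ch : continuous (fun z : R * R => f (z.1, s * z.2)).
  move=> z; apply: (@continuous_comp _ _ _ (fun z : R * R => (z.1, s * z.2)) f); last exact: cf.
  have c1 := @continuous_fst R z.
  have c2 : s * x.2 @[x --> z] --> s * z.2 by apply: cvgM; [exact: cvg_cst|exact: continuous_snd].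
  by move=> A; exact: (cvg_pair c1 c2).
have mE (g : R * R -> R) : continuous g -> measurable_fun [set: plane] (fun x => (g x ^+ 2)%:E).
  by move=> cg'; apply/measurable_EFinP; apply: measurable_funX; exact: continuous_measurable_plane.
have ma : measurable_fun [set: plane] (fun z => (a z)%:E).
  by apply: mE => z; apply: cvgB; [exact: continuous_comp_scale|exact: ch].
have mb : measurable_fun [set: plane] (fun z => (b z)%:E).
  by apply: mE => z; apply: cvgB; [exact: ch|exact: cf].
have q0 (g : R * R -> R) (x : R * R) : (0 <= (g x ^+ 2)%:E)%E by rewrite lee_fin sqr_ge0.
have mf1 := mE _ cf1; have mf2 := mE _ cf2.
have sup1 (x y : R) : 1 < `|x| -> f1 (x, y) = 0 by move=> h; case: (slice_out C (z := (x, y)) (or_introl h)).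
have sup2 (x y : R) : 1 < `|y| -> f2 (x, y) = 0 by move=> h; case: (slice_out C (z := (x, y)) (or_intror h)).
have q1 : (0 <= ((s - 1) ^+ 2)%:E)%E by rewrite lee_fin sqr_ge0.
have mG1 := measurable_fun_fubini_tonelli_G (m1 := leb) _ mf1 (q0 f1).
have mF2 := measurable_fun_fubini_tonelli_F (m2 := leb) _ mf2 (q0 f2).
have a0 z : (0 <= (a z)%:E)%E by rewrite lee_fin sqr_ge0.
have b0 z : (0 <= (b z)%:E)%E by rewrite lee_fin sqr_ge0.
have Ga := measurable_fun_fubini_tonelli_G (m1 := leb) _ ma a0.
have Fb := measurable_fun_fubini_tonelli_F (m2 := leb) _ mb b0.
rewrite /fubini_G in mG1 Ga; rewrite /fubini_F in mF2 Fb.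
have A : (\int[leb2]_z (a z)%:E <= ((s - 1) ^+ 2)%:E * \int[leb2]_z (f1 z ^+ 2)%:E)%E.
  rewrite (tonelli2 ma a0).
  rewrite (tonelli2 mf1 (q0 f1)).
  pose H y := (\int[leb]_x (f1 (x, y) ^+ 2)%:E)%E.
  have H0 y : (0 <= H y)%E by apply: integral_ge0 => x _; rewrite lee_fin sqr_ge0.
  apply: (@le_trans _ _ (\int[leb]_y (((s - 1) ^+ 2)%:E * H (s * y)%R))%E).
    apply: ge0_le_integral => //.
    - by move=> y _; apply: integral_ge0 => x _; rewrite lee_fin sqr_ge0.
    - apply: measurable_funeM; exact: (measurableT_comp mG1).
    move=> y _; rewrite /a /H.
    have := @integral_sqr_scale_sub_le (fun x => f (x, s * y)) (fun x => f1 (x, s * y)) s s1.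
    apply.
    - by move=> x; apply/is_derive_slice1; exact: d1.
    - exact: continuous_slice1.
    - by move=> x /sup1.
  rewrite ge0_integralZl//; last exact: (measurableT_comp mG1).
  rewrite lee_wpmul2l// (ge0_integral_scale1 (F := H))//.
  rewrite gee_pMl// ?lee_fin ?invf_le1//; last by rewrite integral_ge0.
have B : (\int[leb2]_z (b z)%:E <= ((s - 1) ^+ 2)%:E * \int[leb2]_z (f2 z ^+ 2)%:E)%E.
  rewrite (tonelli1 mb b0).
  rewrite (tonelli1 mf2 (q0 f2)) -ge0_integralZl//; last by move=> x _; apply: integral_ge0 => y _; rewrite lee_fin sqr_ge0.
  apply: ge0_le_integral => //.
  - by move=> x _; apply: integral_ge0 => y _; rewrite lee_fin sqr_ge0.
  - by apply: measurable_funeM.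
  move=> x _; rewrite /b.
  apply: (@integral_sqr_scale_sub_le (fun y => f (x, y)) (fun y => f2 (x, y)) s s1).
  - by move=> y; apply/is_derive_slice2; exact: d2.
  - exact: continuous_slice2.
  - by move=> y /sup2.
have two0 : (0 <= 2%:E :> \bar R)%E by rewrite lee_fin.
apply: (@le_trans _ _ (\int[leb2]_z (2%:E * ((a z)%:E + (b z)%:E)))%E).
  apply: ge0_le_integral => //.
  - by move=> z _; rewrite lee_fin sqr_ge0.
  - exact: mE.
  - by apply: measurable_funeM; exact: emeasurable_funD.
  move=> z _; rewrite -EFinD -EFinM lee_fin /a /b.
  set X := f (s *: z); set Y := f (z.1, _).
  have := sqr_ge0 (X - Y - (Y - f z)); nra.
rewrite ge0_integralZl//; last 2 first.
- exact: emeasurable_funD.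
- by move=> z _; rewrite adde_ge0.
rewrite ge0_integralD//.
rewrite EFinM -muleA lee_wpmul2l// muleDr// ?leeD//.
by apply: ge0_adde_def; rewrite inE; apply: integral_ge0.
Qed.

End square_dilation.

(** * Limits of bounded integrals *)

Section fatou_lemmas.
Context d (T : measurableType d) (R : realType).
Variables (mu : {measure set T -> \bar R}) (D : set T) (mD : measurable D).
Implicit Types f g : T -> R.

Lemma measurable_limn_einf (f : nat -> T -> \bar R) :
  (forall n, measurable_fun D (f n)) -> measurable_fun D (fun x => limn_einf (f ^~ x)).
Proof.
move=> mf; rewrite /limn_einf; apply: measurableT_comp => //.
by apply: measurable_fun_limn_esup => n; exact: measurableT_comp.
Qed.

Lemma limn_einf_le (u : nat -> \bar R) (M : \bar R) :
  (forall n, u n <= M)%E -> (limn_einf u <= M)%E.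
Proof.
move=> uM; rewrite limn_einf_lim; apply: lime_le; first exact: is_cvg_einfs.
by apply: nearW => n; apply: le_trans (uM n); apply: ereal_inf_lbound; exists n => /=.
Qed.

Lemma ae_mono (P Q : T -> Prop) : (forall x, P x -> Q x) ->
  {ae mu, forall x, P x} -> {ae mu, forall x, Q x}.
Proof. by move=> PQ; apply: filterS. Qed.

Lemma fatou_le (f_ : nat -> T -> R) f (M : R) :
  (forall n, measurable_fun D (f_ n)) -> measurable_fun D f ->
  (forall n x, D x -> 0 <= f_ n x) -> (forall x, D x -> 0 <= f x) ->
  {ae mu, forall x, D x -> f_ n x @[n --> \oo] --> f x} ->
  (forall n, (\int[mu]_(x in D) (f_ n x)%:E <= M%:E)%E) ->
  (\int[mu]_(x in D) (f x)%:E <= M%:E)%E.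
Proof.
move=> mf_ mf f_0 f0 cf fM.
have mE n : measurable_fun D (EFin \o f_ n) by exact/measurable_EFinP.
have -> : (\int[mu]_(x in D) (f x)%:E =
           \int[mu]_(x in D) limn_einf (fun n => (f_ n x)%:E))%E.
  apply: ae_eq_integral => //; first exact/measurable_EFinP.
    exact: (measurable_limn_einf (f := fun n => EFin \o f_ n)).
  apply: filterS cf => x fx Dx; have {}fx := fx Dx.
  have /cvg_limn_einf_sup[-> //] : (f_ n x)%:E @[n --> \oo] --> (f x)%:E.
  by apply: cvg_comp fx _ => //; exact: cvg_id.
apply: le_trans (fatou _ _ _ _) _ => //.
exact: limn_einf_le.
Qed.

(** The terms of a convergent series tend to zero. *)
Lemma square_summable_cvg0 (u : nat -> R) :
  (\sum_(k <oo) (u k ^+ 2)%:E)%E \is a fin_num -> u @ \oo --> (0 : R).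
Proof.
move=> S; pose v k := u k ^+ 2.
have v0 k : 0 <= v k by exact: sqr_ge0.
have : v @ \oo --> (0 : R).
  apply: cvg_series_cvg_0; apply: nondecreasing_is_cvgn.
    by apply/nondecreasing_seqP => n; rewrite seriesSr /= lerDl.
  exists (fine (\sum_(k <oo) (u k ^+ 2)%:E)%E) => _ [n _ <-].
  rewrite -lee_fin fineK// /series /= -sumEFin.
  by apply: nneseries_lim_ge => k _ _; rewrite lee_fin.
move=> cv; apply: norm_cvg0.
have -> : (fun k => `|u k|) = Num.sqrt \o v by apply/funext => k /=; rewrite sqrtr_sqr.
rewrite -(sqrtr0 R).
by apply: cvg_comp cv _; exact: sqrt_continuous.
Qed.

(** Along a subsequence the square integrals are summable, so that the sum of the
    squares is integrable, hence finite almost everywhere. *)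
Lemma ae_subsequence (h : nat -> T -> R) :
  (forall n, measurable_fun D (h n)) ->
  (forall e : R, 0 < e -> exists N, forall n, (N <= n)%N ->
    (\int[mu]_(x in D) (h n x ^+ 2)%:E <= e%:E)%E) ->
  exists sigma : nat -> nat, (forall n, (n <= sigma n)%N) /\
    {ae mu, forall x, D x -> h (sigma n) x @[n --> \oo] --> (0 : R)}.
Proof.
move=> mh h0.
have /choice[sigma sigmaP] : forall k : nat, exists n, (k <= n)%N /\
    (\int[mu]_(x in D) (h n x ^+ 2)%:E <= (1 / (2 ^ (k + 1))%:R)%:E)%E.
  move=> k; have e0 : 0 < 1 / (2 ^ (k + 1))%:R :> R by rewrite divr_gt0// ltr0n expn_gt0.
  have [N NP] := h0 _ e0.
  by exists (maxn k N); rewrite leq_maxl; split => //; apply: NP; rewrite leq_maxr.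
exists sigma; split; first by move=> n; case: (sigmaP n).
have m2 n : measurable_fun D (fun x => (h (sigma n) x ^+ 2)%:E).
  by apply/measurable_EFinP; exact: measurable_funX.
have q0 n x : (0 <= (h n x ^+ 2)%:E)%E by rewrite lee_fin sqr_ge0.
have S0 x : (0 <= \sum_(k <oo) (h (sigma k) x ^+ 2)%:E)%E by apply: nneseries_ge0.
have I : (\int[mu]_(x in D) \sum_(k <oo) (h (sigma k) x ^+ 2)%:E < +oo)%E.
  rewrite integral_nneseries//.
  apply: (@le_lt_trans _ _ (\sum_(k <oo) (1 / (2 ^ (k + 1))%:R)%:E)%E).
    apply: lee_nneseries => n _; first by move=> _; exact: integral_ge0.
    by case: (sigmaP n).
  have /cvg_lim -> // := @cvg_geometric_eseries_half R 1 0.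
  by rewrite ltry.
have L : mu.-integrable D (fun x => \sum_(k <oo) (h (sigma k) x ^+ 2)%:E)%E.
  apply/integrableP; split; first by apply: ge0_emeasurable_sum.
  by under eq_integral do rewrite gee0_abs//.
apply: filterS (integrable_ae mD L) => x fx Dx.
exact: square_summable_cvg0 (fx Dx).
Qed.

End fatou_lemmas.

(** * Exponential moments *)

Section exponential.
Context {R : realType}.
Notation leb := (@lebesgue_measure R).
Notation leb2 := (leb \x leb)%E.
Notation plane := (measurableTypeR R * measurableTypeR R)%type.

Lemma Rintegral_disk_cst (c : R) : \int[leb2]_(x in disk) (cst c x) = c * pi.
Proof.
apply: etrans (Rintegral_cst leb2 measurable_disk c) _.
by congr (c * _); exact: (congr1 fine area_disk).
Qed.

Lemma fact_sqr_le (j : nat) : ((j`!%:R : R) ^+ 2 <= (2 * j)`!%:R).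
Proof.
rewrite -natrX ler_nat mul2n -addnn -(bin_fact (leq_addr j j)) addnK expnS expn1.
by rewrite leq_pmull// bin_gt0 leq_addr.
Qed.

(** Partial sums of [2 cosh y]: its even powers are the ones that
    [moment_bound] controls. *)
Definition cosh_sum (M : nat) (y : R) : R :=
  \sum_(0 <= j < M) 2 * y ^+ (2 * j) / (2 * j)`!%:R.

Lemma cosh_sumE M y :
  cosh_sum M y = series (exp_coeff y) (2 * M)%N + series (exp_coeff (- y)) (2 * M)%N.
Proof.
elim: M => [|M IH]; first by rewrite /cosh_sum muln0 /series /= !big_geq// addr0.
rewrite /cosh_sum big_nat_recr//= -/(cosh_sum M y) IH.
rewrite (_ : (2 * M.+1)%N = (2 * M).+2); last by rewrite mulnS.
have h1 : (- y) ^+ (2 * M) = y ^+ (2 * M) by rewrite !exprM sqrrN.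
have h2 : (- y) ^+ (2 * M).+1 = - y ^+ (2 * M).+1 by rewrite exprS h1 exprS mulNr.
by rewrite !seriesSr /exp_coeff /= h1 h2; ring.
Qed.

Lemma cosh_sum_cvg y : cosh_sum M y @[M --> \oo] --> expR y + expR (- y).
Proof.
have c2 : (2 * M)%N @[M --> \oo] --> \oo.
  apply/cvgnyPge => A; near=> n; rewrite (@leq_trans n)//; last by rewrite leq_pmull.
  by near: n; exact: nbhs_infty_ge.
under eq_fun do rewrite cosh_sumE.
have h z : series (exp_coeff z) (2 * M)%N @[M --> \oo] --> expR z.
  by apply: (cvg_comp (fun M : nat => (2 * M)%N) (series (exp_coeff z)) c2); exact: is_cvg_series_exp_coeff.
by apply: cvgD; exact: h.
Unshelve. all: by end_near. Qed.

(** [(m!)^2 <= (2m)!], so that consecutive terms gain a factor [k^2 D <= 1/2] and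
    the series is dominated by a geometric one. *)
Lemma moment_bound_cosh_sum g D N k M : moment_bound g D N -> 0 <= N -> 0 <= D ->
  k ^+ 2 * D <= 2^-1 ->
  leb2.-integrable disk (EFin \o (fun x => cosh_sum M.+1 (k * g x))) /\
  \int[leb2]_(x in disk) cosh_sum M.+1 (k * g x) <=
    2 * pi + 4 * k ^+ 2 * N * (1 - 2^-1 ^+ M).
Proof.
move=> [mg hg] N0 D0 kD; elim: M => [|M [IH1 IH2]].
  rewrite expr0 subrr mulr0 addr0.
  have E x : cosh_sum 1 (k * g x) = 2.
    by rewrite /cosh_sum big_nat1 muln0 expr0 fact0 mulr1 divr1.
  have -> : (fun x => cosh_sum 1 (k * g x)) = cst 2 by apply/funext => x; rewrite E.
  split; last by rewrite Rintegral_disk_cst.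
  by apply: (@integrable_disk_bounded _ 2) => // x _; rewrite ger0_norm.
have [I1 I2] := hg M.+1 isT.
pose c := 2 * k ^+ (2 * M.+1) / (2 * M.+1)`!%:R.
have E x : cosh_sum M.+2 (k * g x) = cosh_sum M.+1 (k * g x) + c * g x ^+ (2 * M.+1).
  rewrite /cosh_sum (big_nat_recr M.+1)//=; congr (_ + _).
  by rewrite exprMn /c; ring.
have I3 := integrable_scaler measurable_disk c I1.
split.
  apply: eq_integrable (integrable_addr measurable_disk IH1 I3).
  - exact: measurable_disk.
  - by move=> x _; rewrite /= -E.
under eq_Rintegral do rewrite E.
rewrite RintegralD ?RintegralZl//; [|exact: measurable_disk|exact: measurable_disk].
have c0 : 0 <= c by rewrite divr_ge0// mulr_ge0// exprM exprn_ge0// sqr_ge0.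
have -> : 2 * pi + 4 * k ^+ 2 * N * (1 - 2^-1 ^+ M.+1) =
  2 * pi + 4 * k ^+ 2 * N * (1 - 2^-1 ^+ M) + 2 * k ^+ 2 * N * 2^-1 ^+ M.
  by rewrite (exprS 2^-1); move: (2^-1 ^+ M) => a; field.
apply: lerD => //; apply: le_trans (ler_wpM2l c0 I2) _ => /=.
have F : (M.+1)`!%:R ^+ 2 / (2 * M.+1)`!%:R <= 1 :> R.
  by rewrite ler_pdivrMr ?mul1r ?fact_sqr_le// ltr0n fact_gt0.
have -> : c * ((M.+1)`!%:R ^+ 2 * D ^+ M * N) =
   2 * k ^+ 2 * N * ((k ^+ 2 * D) ^+ M) * ((M.+1)`!%:R ^+ 2 / (2 * M.+1)`!%:R).
  rewrite /c (_ : k ^+ (2 * M.+1) = k ^+ 2 * (k ^+ 2) ^+ M); last by rewrite mulnS exprD exprM.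
  rewrite [(k ^+ 2 * D) ^+ M]exprMn; move: ((2 * M.+1)`!%:R^-1) ((M.+1)`!%:R : R) => a b.
  by move: (D ^+ M) ((k ^+ 2) ^+ M) => a' b'; ring.
have A0 : 0 <= 2 * k ^+ 2 * N by apply: mulr_ge0 => //; apply: mulr_ge0 => //; exact: sqr_ge0.
have B0 : 0 <= k ^+ 2 * D by rewrite mulr_ge0// sqr_ge0.
apply: (@le_trans _ _ (2 * k ^+ 2 * N * ((k ^+ 2 * D) ^+ M))).
  by rewrite ler_piMr// mulr_ge0// exprn_ge0.
by rewrite ler_wpM2l// lerXn2r// nnegrE.
Qed.

Lemma measurable_expR_norm (g : R * R -> R) (k : R) :
  measurable_fun (disk : set plane) g ->
  measurable_fun (disk : set plane) (fun x => expR (k * `|g x|)).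
Proof.
move=> mg; apply: measurableT_comp => //; apply: measurable_funM => //.
exact: measurableT_comp.
Qed.

(** Fatou's lemma for the partial sums of [2 cosh (k g) >= e^(k |g|)].  This is
    the fragment of the Moser-Trudinger inequality used below. *)
Lemma moment_bound_expR g D N k : moment_bound g D N -> 0 <= N -> 0 <= D ->
  0 <= k -> k ^+ 2 * D <= 2^-1 ->
  leb2.-integrable disk (EFin \o (fun x => expR (k * `|g x|))) /\
  \int[leb2]_(x in disk) expR (k * `|g x|) <= 2 * pi + 4 * k ^+ 2 * N.
Proof.
move=> mb N0 D0 k0 kD; have [mg _] := mb.
have me := measurable_expR_norm k mg.
apply: (ge0_integral_bounded measurable_disk me); first by move=> x _; exact: expR_ge0.
have mc : measurable_fun (disk : set plane) (fun x => expR (k * g x) + expR (- (k * g x))).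
  apply: measurable_funD; apply: measurableT_comp => //.
    by apply: measurable_funM.
  by apply: measurableT_comp => //; apply: measurable_funM.
apply: (@le_trans _ _ (\int[leb2]_(x in disk) (expR (k * g x) + expR (- (k * g x)))%:E)%E).
  apply: ge0_le_integral => //.
  - exact: measurable_disk.
  - exact/measurable_EFinP.
  - exact/measurable_EFinP.
  move=> x _; rewrite lee_fin; have [g0|g0] := leP 0 (g x).
    by rewrite ger0_norm// lerDl expR_ge0.
  by rewrite ltr0_norm// mulrN lerDr expR_ge0.
have cs M := moment_bound_cosh_sum M mb N0 D0 kD.
apply: (@fatou_le _ _ _ leb2 _ measurable_disk (fun M x => cosh_sum M.+1 (k * g x))) => //.
- by move=> M; have [/integrable_measurable] := cs M.
- move=> M x _; rewrite /cosh_sum; apply: sumr_ge0 => j _.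
  by rewrite divr_ge0// mulr_ge0// exprM exprn_ge0// sqr_ge0.
- apply: aeW => x _ /=.
  by have := @cosh_sum_cvg (k * g x); rewrite -cvg_shiftS.
move=> M; have [I1 I2] := cs M.
rewrite (Rintegral_EFin measurable_disk I1) lee_fin; apply: le_trans I2 _.
rewrite lerD2l ler_piMr//; first by rewrite !mulr_ge0// sqr_ge0.
Qed.

Lemma integral_sum_sqr_bound (p q r : R * R -> R) (eta : R) :
  measurable_fun (disk : set plane) p -> measurable_fun (disk : set plane) q ->
  measurable_fun (disk : set plane) r ->
  (\int[leb2]_(x in disk) (p x ^+ 2 + (q x * q x + r x * r x))%:E <= eta%:E)%E ->
  [/\ leb2.-integrable disk (EFin \o (fun x => p x ^+ 2)),
      \int[leb2]_(x in disk) (p x ^+ 2) <= eta,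
      leb2.-integrable disk (EFin \o (fun x => q x ^+ 2)),
      leb2.-integrable disk (EFin \o (fun x => r x ^+ 2)) &
      \int[leb2]_(x in disk) (q x ^+ 2 + r x ^+ 2) <= eta].
Proof.
move=> mp mq mr hle.
have m0 := measurable_funX 2 mp; have m1 := measurable_funX 2 mq; have m2 := measurable_funX 2 mr.
have P (f : R * R -> R) : measurable_fun (disk : set plane) f -> (forall x, 0 <= f x) ->
    (forall x, f x <= p x ^+ 2 + (q x ^+ 2 + r x ^+ 2)) ->
    leb2.-integrable disk (EFin \o f) /\ \int[leb2]_(x in disk) f x <= eta.
  move=> mf f0 fle; apply: (ge0_integral_bounded measurable_disk mf) => //.
  apply: le_trans hle; apply: ge0_le_integral.
  - exact: measurable_disk.
  - by move=> x _; rewrite lee_fin.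
  - exact/measurable_EFinP.
  - apply/measurable_EFinP; apply: measurable_funD => //.
    by apply: measurable_funD; exact: measurable_funM.
  - by move=> x _; rewrite lee_fin -!expr2; exact: fle.
have [I0 J0] := P _ m0 (fun x => sqr_ge0 _) (fun x => ltac:(by rewrite lerDl addr_ge0// sqr_ge0)).
have [I1 _] := P _ m1 (fun x => sqr_ge0 _) (fun x => ltac:(by rewrite addrCA lerDl addr_ge0// sqr_ge0)).
have [I2 _] := P _ m2 (fun x => sqr_ge0 _) (fun x => ltac:(by rewrite addrA lerDr addr_ge0// sqr_ge0)).
have [_ J] := P _ (measurable_funD m1 m2) (fun x => ltac:(by rewrite addr_ge0// sqr_ge0)) (fun x => ltac:(by rewrite lerDr sqr_ge0)).
by split; [exact: I0|exact: J0|exact: I1|exact: I2|exact: J].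
Qed.

Lemma H1_sqdist_bound (u : R * R -> R) G phi eta : H1 u G -> test_function phi ->
  (H1_sqdist u G phi (grad phi) <= eta%:E)%E ->
  [/\ leb2.-integrable disk (EFin \o (fun x => (u x - phi x) ^+ 2)),
      \int[leb2]_(x in disk) ((u x - phi x) ^+ 2) <= eta,
      leb2.-integrable disk (EFin \o (fun x => ((G x).1 - 'D_e1 phi x) ^+ 2)),
      leb2.-integrable disk (EFin \o (fun x => ((G x).2 - 'D_e2 phi x) ^+ 2)) &
      \int[leb2]_(x in disk) (((G x).1 - 'D_e1 phi x) ^+ 2 + ((G x).2 - 'D_e2 phi x) ^+ 2) <= eta].
Proof.
move=> [[mu _] [mG1 _] [mG2 _] _] tphi; have [c c1 c2 _ _ _ _ _] := test_function_disk_C1 tphi.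
have md (f g : R * R -> R) : measurable_fun (disk : set plane) f -> continuous g ->
    measurable_fun (disk : set plane) (fun x => f x - g x).
  move=> mf cg; apply: measurable_funB => //.
  by apply: measurable_funTS; exact: continuous_measurable_plane.
exact: (integral_sum_sqr_bound (md _ _ mu c) (md _ _ mG1 c1) (md _ _ mG2 c2)).
Qed.

End exponential.

(** * Approximation by test functions *)

Section approximation.
Context {R : realType}.
Notation leb := (@lebesgue_measure R).
Notation leb2 := (leb \x leb)%E.
Notation plane := (measurableTypeR R * measurableTypeR R)%type.

Lemma two_two_le (a b eta : R) : a <= eta -> b <= eta -> 2 * a + 2 * b <= 4 * eta.
Proof. by move=> *; lra. Qed.

Lemma sub_sqr_le (p a b : R) : (a - b) ^+ 2 <= 2 * (p - a) ^+ 2 + 2 * (p - b) ^+ 2.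
Proof. by have := sqr_ge0 (p - a + (p - b)); nra. Qed.

Lemma integral_sub_sqr_le (p a b : R * R -> R) eta :
  leb2.-integrable disk (EFin \o (fun x => (a x - b x) ^+ 2)) ->
  leb2.-integrable disk (EFin \o (fun x => (p x - a x) ^+ 2)) ->
  leb2.-integrable disk (EFin \o (fun x => (p x - b x) ^+ 2)) ->
  \int[leb2]_(x in disk) ((p x - a x) ^+ 2) <= eta ->
  \int[leb2]_(x in disk) ((p x - b x) ^+ 2) <= eta ->
  \int[leb2]_(x in disk) ((a x - b x) ^+ 2) <= 4 * eta.
Proof.
move=> Iab Ia Ib la lb; have mD := @measurable_disk R.
have Ia2 := integrable_scaler mD 2 Ia; have Ib2 := integrable_scaler mD 2 Ib.
apply: le_trans (two_two_le la lb).
rewrite -(@RintegralZl _ _ _ _ _ _ 2 mD Ia) -(@RintegralZl _ _ _ _ _ _ 2 mD Ib).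
rewrite -(RintegralD mD Ia2 Ib2); apply: (le_Rintegral mD Iab (integrable_addr mD Ia2 Ib2)).
by move=> x _; exact: sub_sqr_le.
Qed.

Lemma integral_sub_sqr2_le (p q a a' b b' : R * R -> R) eta :
  leb2.-integrable disk (EFin \o (fun x => (a x - b x) ^+ 2)) ->
  leb2.-integrable disk (EFin \o (fun x => (a' x - b' x) ^+ 2)) ->
  leb2.-integrable disk (EFin \o (fun x => (p x - a x) ^+ 2)) ->
  leb2.-integrable disk (EFin \o (fun x => (q x - a' x) ^+ 2)) ->
  leb2.-integrable disk (EFin \o (fun x => (p x - b x) ^+ 2)) ->
  leb2.-integrable disk (EFin \o (fun x => (q x - b' x) ^+ 2)) ->
  \int[leb2]_(x in disk) ((p x - a x) ^+ 2 + (q x - a' x) ^+ 2) <= eta ->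
  \int[leb2]_(x in disk) ((p x - b x) ^+ 2 + (q x - b' x) ^+ 2) <= eta ->
  \int[leb2]_(x in disk) ((a x - b x) ^+ 2 + (a' x - b' x) ^+ 2) <= 4 * eta.
Proof.
move=> Iab Iab' Ipa Iqa Ipb Iqb la lb; have mD := @measurable_disk R.
have Iab2 := integrable_addr mD Iab Iab'.
have Ia := integrable_addr mD Ipa Iqa; have Ib := integrable_addr mD Ipb Iqb.
have Ia2 := integrable_scaler mD 2 Ia; have Ib2 := integrable_scaler mD 2 Ib.
apply: le_trans (two_two_le la lb).
rewrite -(@RintegralZl _ _ _ _ _ _ 2 mD Ia) -(@RintegralZl _ _ _ _ _ _ 2 mD Ib).
rewrite -(RintegralD mD Ia2 Ib2); apply: (le_Rintegral mD Iab2 (integrable_addr mD Ia2 Ib2)).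
move=> x _; rewrite !mulrDr addrACA; apply: lerD; exact: sub_sqr_le.
Qed.

Variables (u : R * R -> R) (G : R * R -> R * R) (phi : nat -> R * R -> R).
Hypothesis uG : H1 u G.
Hypothesis tphi : forall n, test_function (phi n).
Hypothesis phi_cvg : H1_sqdist u G (phi n) (grad (phi n)) @[n --> \oo] --> 0%E.

Lemma approx_le (eta : R) : 0 < eta -> exists N, forall n, (N <= n)%N ->
  (H1_sqdist u G (phi n) (grad (phi n)) <= eta%:E)%E.
Proof.
move=> eta0.
have [N _ NP] : \forall n \near \oo, (H1_sqdist u G (phi n) (grad (phi n)) <= eta%:E)%E.
  move/fine_cvgP : phi_cvg => [fin cv].
  have cv' : \forall n \near \oo, `|0 - fine (H1_sqdist u G (phi n) (grad (phi n)))| < eta.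
    by move/cvgrPdist_lt : cv; apply.
  near=> n.
  rewrite -(@fineK _ (H1_sqdist u G (phi n) (grad (phi n)))); last by near: n.
  rewrite lee_fin; apply: le_trans (ler_norm _) _.
  by rewrite -normrN -sub0r; apply: ltW; near: n.
by exists N => n Nn; exact: NP.
Unshelve. all: by end_near. Qed.

Lemma approx_sub_moment (eta : R) m n :
  (H1_sqdist u G (phi m) (grad (phi m)) <= eta%:E)%E ->
  (H1_sqdist u G (phi n) (grad (phi n)) <= eta%:E)%E ->
  moment_bound (fun x => phi m x - phi n x) (4 * eta) (4 * eta).
Proof.
move=> /(H1_sqdist_bound uG (tphi m))[a1 a2 a3 a4 a5] /(H1_sqdist_bound uG (tphi n))[b1 b2 b3 b4 b5].
have C := disk_C1_sub (test_function_disk_C1 (tphi m)) (test_function_disk_C1 (tphi n)).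
have [c c1 c2 _ _ o o1 o2] := C.
have mD := @measurable_disk R.
apply: (disk_C1_moment_bound C).
- have I1 := integrable_disk_exprn 2 c1 o1; have I2 := integrable_disk_exprn 2 c2 o2.
  exact: (integral_sub_sqr2_le I1 I2 a3 a4 b3 b4 a5 b5).
- have I := integrable_disk_exprn 2 c o.
  exact: (integral_sub_sqr_le I a1 b1 a2 b2).
Qed.

Lemma measurable_u : measurable_fun (disk : set plane) u.
Proof. by case: uG => -[]. Qed.

Lemma measurable_phi n : measurable_fun (disk : set plane) (phi n).
Proof.
apply: measurable_funTS; apply: continuous_measurable_plane.
exact: C1_cont (test_function_disk_C1 (tphi n)).
Qed.

Lemma approx_ae_subsequence : exists sigma : nat -> nat, (forall n, (n <= sigma n)%N) /\
  {ae leb2, forall x, disk x -> phi (sigma n) x @[n --> \oo] --> u x}.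
Proof.
have [||sigma [s1 s2]] := @ae_subsequence _ _ _ leb2 _ (@measurable_disk R) (fun n x => u x - phi n x).
- by move=> n; apply: measurable_funB; [exact: measurable_u|exact: measurable_phi].
- move=> e e0; have [N NP] := approx_le e0; exists N => n /NP/(H1_sqdist_bound uG (tphi n))[I1 I2 _ _ _].
  by rewrite (Rintegral_EFin measurable_disk I1) lee_fin.
exists sigma; split => //; apply: (@ae_mono _ _ _ leb2 _ _ _ s2) => x h dx.
have -> : (fun n => phi (sigma n) x) = (fun n => u x - (u x - phi (sigma n) x)).
  by apply/funext => n; rewrite subKr.
by rewrite -[X in _ --> X]subr0; apply: cvgB; [exact: cvg_cst|exact: h].
Qed.

(** The differences [phi m - phi n] are test functions of small Dirichlet energy,
    and Fatou's lemma along an almost everywhere convergent subsequence carries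
    their moment bounds over to [u - phi n]. *)
Lemma approx_moment (e : R) : 0 < e -> exists N, forall n, (N <= n)%N ->
  [/\ forall m, (N <= m)%N -> moment_bound (fun x => phi m x - phi n x) e e,
      moment_bound (fun x => u x - phi n x) e e &
      (H1_sqdist u G (phi n) (grad (phi n)) <= (e / 4)%:E)%E].
Proof.
move=> e0; have e4 : 0 < e / 4 by rewrite divr_gt0.
have [N NP] := approx_le e4; exists N => n Nn.
have P m : (N <= m)%N -> moment_bound (fun x => phi m x - phi n x) e e.
  move=> Nm; rewrite (_ : e = 4 * (e / 4)); last by field.
  by apply: approx_sub_moment; exact: NP.
split => //; last exact: NP.
have mun : measurable_fun (disk : set plane) (fun x => u x - phi n x).
  by apply: measurable_funB; [exact: measurable_u|exact: measurable_phi].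
split => // m m0.
have [sigma [s1 s2]] := approx_ae_subsequence.
have q0 (x : R) : 0 <= x ^+ (2 * m) by rewrite exprM exprn_ge0// sqr_ge0.
apply: (ge0_integral_bounded measurable_disk) => //; first exact: measurable_funX.
apply: (@fatou_le _ _ _ leb2 _ measurable_disk (fun k x => (phi (sigma (N + k)%N) x - phi n x) ^+ (2 * m))) => //.
- by move=> k; apply: measurable_funX; apply: measurable_funB; exact: measurable_phi.
- exact: measurable_funX.
- apply: (@ae_mono _ _ _ leb2 _ _ _ s2) => x h dx.
  have sh : phi (sigma (N + k)%N) x @[k --> \oo] --> u x.
    have := h dx; rewrite -(cvg_shiftn N); apply: cvg_trans.
    by apply: near_eq_cvg; near=> k; rewrite /= addnC.
  apply: (cvg_comp _ (fun y : R => y ^+ (2 * m)) (cvgB sh (cvg_cst (phi n x)))).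
  exact: exprn_continuous.
- move=> k; have [_ /(_ m m0)[I1 I2]] := P (sigma (N + k)%N) (leq_trans (leq_addr k N) (s1 _)).
  by rewrite (Rintegral_EFin measurable_disk I1) lee_fin.
Unshelve. all: by end_near. Qed.

(** Both [u] and the later [phi n] differ from the bounded function [phi N] by a
    function of energy so small that [moment_bound_expR] applies with the given
    [k]. *)
Lemma approx_exp_bound (k : R) : 0 <= k -> exists N M, 0 <= M /\
  (forall n, (N <= n)%N ->
    leb2.-integrable disk (EFin \o (fun x => expR (k * `|phi n x|))) /\
    \int[leb2]_(x in disk) expR (k * `|phi n x|) <= M) /\
  leb2.-integrable disk (EFin \o (fun x => expR (k * `|u x|))) /\
    \int[leb2]_(x in disk) expR (k * `|u x|) <= M.
Proof.
move=> k0.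
(* chosen so that [k ^+ 2 * e <= 1 / 2], also for [k = 0] *)
pose e := (2 * (k ^+ 2 + 1))^-1 : R.
have k2 : 0 <= k ^+ 2 by exact: sqr_ge0.
have e0 : 0 < e by rewrite invr_gt0; lra.
have ke : k ^+ 2 * e <= 2^-1 by rewrite /e ler_pdivrMr; lra.
have [N NP] := approx_moment e0; have [P1 P2 _] := NP N (leqnn N).
have CN := test_function_disk_C1 (tphi N).
have [B [B0 HB]] := continuous_disk_bounded (C1_cont CN) (C1_out CN).
pose M0 : R := 2 * pi + 4 * k ^+ 2 * e.
have M00 : 0 <= M0 by rewrite addr_ge0 ?mulr_ge0 ?pi_ge0//; lra.
exists N, (expR (k * B) * M0); split; first by rewrite mulr_ge0// expR_ge0.
have H (f : R * R -> R) : measurable_fun (disk : set plane) f ->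
    moment_bound (fun x => f x - phi N x) e e ->
    leb2.-integrable disk (EFin \o (fun x => expR (k * `|f x|))) /\
    \int[leb2]_(x in disk) expR (k * `|f x|) <= expR (k * B) * M0.
  move=> mf mb; have [I1 I2] := moment_bound_expR mb (ltW e0) (ltW e0) k0 ke.
  have I3 := integrable_scaler measurable_disk (expR (k * B)) I1.
  have le x : disk x -> expR (k * `|f x|) <= expR (k * B) * expR (k * `|f x - phi N x|).
    move=> _; rewrite -expRD ler_expR -mulrDr ler_wpM2l//.
    apply: (@le_trans _ _ (`|phi N x| + `|f x - phi N x|)); last by rewrite lerD2r.
    by apply: le_trans (ler_normD _ _); rewrite addrC subrK.
  have I4 : leb2.-integrable disk (EFin \o (fun x => expR (k * `|f x|))).
    apply: (integrable_dominated measurable_disk _ I3); first exact: measurable_expR_norm.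
    by move=> x dx; rewrite ger0_norm ?expR_ge0//; exact: le.
  split => //; apply: le_trans (le_Rintegral _ I4 I3 le) _; first exact: measurable_disk.
  by rewrite RintegralZl ?ler_wpM2l ?expR_ge0//; exact: measurable_disk.
split; last exact: (H u measurable_u P2).
by move=> n Nn; exact: (H _ (measurable_phi n) (P1 n Nn)).
Qed.

End approximation.

(** * Power weights *)

Section weights.
Context {R : realType}.
Notation leb := (@lebesgue_measure R).
Notation leb2 := (leb \x leb)%E.
Notation plane := (measurableTypeR R * measurableTypeR R)%type.

Lemma measurable_enorm_powR (a : R) :
  measurable_fun [set: plane] (fun x : R * R => enorm x `^ a).
Proof.
apply: (measurableT_comp (measurable_powR a)).
exact: (continuous_measurable_plane continuous_enorm).
Qed.

(** Comparing the unit disk with the disk of radius [1 / 2] by a homothety gives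
    [J <= 2^(- a - 2) J + 2^(- a) pi] for the truncated integral [J], whence a
    bound that does not depend on the truncation. *)
Lemma truncated_powR_bound (a M : R) : -2 < a -> a <= 0 -> 0 < M ->
  (\int[leb2]_(x in disk) (Num.min (enorm x `^ a) M)%:E <=
   (2 `^ (- a) * pi / (1 - 2 `^ (- a - 2)))%:E)%E.
Proof.
move=> a2 a0 M0; set F := fun x : R * R => Num.min (enorm x `^ a) M.
have F0 x : 0 <= F x by rewrite /F le_min powR_ge0 ltW.
have mF : measurable_fun [set: plane] F.
  by apply: measurable_minr => //; exact: measurable_enorm_powR.
have IF : leb2.-integrable disk (EFin \o F).
  apply: (@integrable_disk_bounded _ M); first exact: measurable_funTS.
  by move=> x _; rewrite ger0_norm// /F ge_min lexx orbT.
rewrite (Rintegral_EFin measurable_disk IF) lee_fin.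
set J := \int[leb2]_(x in disk) F x.
pose c : R := 2 `^ (- a).
have c1 : 1 <= c by rewrite /c -[leLHS](powRr0 2) ler_powR// ?ler1n// lerNr oppr0.
have c0 : 0 <= c by exact: le_trans ler01 c1.
have cn0 : c != 0 by rewrite gt_eqF// (lt_le_trans ltr01 c1).
have E4 : 2 `^ (- a - 2) = c / 4.
  rewrite powRD ?pnatr_eq0 ?implybT//; congr (_ * _); rewrite powRN (powR_mulrn 2)//.
  by rewrite -natrX.
have c4 : c / 4 < 1.
  rewrite -E4 -[_ - 2]opprK powRN invf_lt1 ?powR_gt0//.
  apply: (@le_lt_trans _ _ (1 `^ (- (- a - 2)))); first by rewrite powR1.
  by apply: gt0_ltr_powR; rewrite ?nnegrE//; [lra|rewrite ltr1n].
suff : J <= c / 4 * J + c * pi.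
  move=> h; rewrite E4 -/c ler_pdivlMr ?subr_gt0// mulrBr mulr1 lerBlDr.
  by rewrite [J * _]mulrC addrC.
have dbl (x : R * R) : enorm (2 *: x) `^ a = c^-1 * enorm x `^ a.
  by rewrite enormZ// powRM ?sqrtr_ge0// /c powRN invrK.
have mD := @measurable_disk R.
pose H (x : R * R) : R := (\1_(@disk R) (2 *: x : R * R) : R) * F x.
have mdil : measurable_fun [set: plane] (fun x : R * R => \1_(@disk R) (2 *: x : R * R) : R).
  apply: (measurableT_comp (measurable_indic (@measurable_disk R))).
  exact: measurable_scale.
have mH : measurable_fun [set: plane] H by exact: measurable_funM.
have H0 x : 0 <= H x by rewrite mulr_ge0.
have IH : leb2.-integrable disk (EFin \o H).
  apply: (integrable_dominated mD _ IF); first exact: measurable_funTS.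
  by move=> x _; rewrite ger0_norm// /H ler_piMl// indicE; case: (_ \in _).
have Icst : leb2.-integrable disk (EFin \o cst c).
  by apply: (@integrable_disk_bounded _ c) => // x _; rewrite ger0_norm.
(* outside the disk of radius 1/2 the integrand is at most [2^(-a)] *)
have A : J <= \int[leb2]_(x in disk) H x + c * pi.
  rewrite -Rintegral_disk_cst -(RintegralD mD IH Icst).
  apply: (le_Rintegral mD IF (integrable_addr mD IH Icst)) => x dx.
  rewrite /H indicE; have [d2|d2] := boolP (2 *: x \in _).
    by rewrite mul1r lerDl /=; lra.
  rewrite mul0r add0r /= /F ge_min; apply/orP; left.
  have : 1 <= enorm (2 *: x).
    by rewrite leNgt; apply: contra d2 => d2; rewrite inE.
  move=> e1; rewrite -[leLHS](mulVKf cn0) -dbl.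
  rewrite ler_piMr//.
  rewrite -[a]opprK powRN invf_le1 ?powR_gt0//; last by rewrite (lt_le_trans _ e1).
  apply: (@le_trans _ _ (1 `^ (- a))); first by rewrite powR1.
  apply: ge0_ler_powR; rewrite ?nnegrE ?oppr_ge0//.
  by rewrite (le_trans _ e1).
have B : \int[leb2]_(x in disk) H x <= c / 4 * J.
  have H_out x : ~ disk x -> H x = 0.
    move=> dx; rewrite /H indicE memNset ?mul0r// => d2; apply: dx.
    move: d2; rewrite /disk /= enormZ//; have := sqrtr_ge0 (x.1 ^+ 2 + x.2 ^+ 2).
    by rewrite -/(enorm x); lra.
  pose K y : R := c * (\1_(@disk R) y * F y).
  have mK : measurable_fun [set: plane] K.
    by apply: measurable_funM => //; apply: measurable_funM => //; exact: measurable_indic.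
  have K0 x : 0 <= K x by rewrite mulr_ge0// mulr_ge0.
  rewrite -lee_fin -(Rintegral_EFin mD IH) -(integral_planeE H_out).
  apply: (@le_trans _ _ (\int[leb2]_x (K (2 *: x))%:E)%E).
    apply: ge0_le_integral => //.
    - by move=> x _; rewrite lee_fin.
    - exact/measurable_EFinP.
    - by apply/measurable_EFinP; apply: (measurableT_comp mK); exact: measurable_scale.
    move=> x _; rewrite lee_fin /H /K mulrCA ler_wpM2l// /F dbl.
    have h : enorm x `^ a = c * (c^-1 * enorm x `^ a).
      by rewrite mulrA mulfV ?mul1r.
    have [h1|h1] := leP (c^-1 * enorm x `^ a) M.
      by rewrite -h ge_min lexx.
    by rewrite ge_min; apply/orP; right; rewrite ler_peMl// ltW.
  rewrite (ge0_integral_scale2 (F := fun x => (K x)%:E))//; last exact/measurable_EFinP.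
  rewrite integral_planeE; last first.
    by move=> x dx; rewrite /K indicE memNset// mul0r mulr0.
  rewrite (_ : (\int[leb2]_(x in disk) (K x)%:E)%E = (c * J)%:E).
    by rewrite -EFinM lee_fin -natrX; lra.
  rewrite EFinM -(Rintegral_EFin mD IF).
  transitivity (\int[leb2]_(x in disk) (c%:E * (F x)%:E))%E.
    by apply: eq_integral => x xd; rewrite /K indicE xd mul1r.
  exact: (integralZl mD IF c).
by apply: le_trans A _; rewrite lerD2r.
Qed.

Lemma integrable_enorm_powR (a : R) : -2 < a ->
  leb2.-integrable disk (EFin \o (fun x => enorm x `^ a)).
Proof.
move=> a2; have [a0|a0] := leP 0 a.
  apply: (@integrable_disk_bounded _ 1).
    by apply: measurable_funTS; exact: measurable_enorm_powR.
  move=> x dx; rewrite ger0_norm ?powR_ge0//.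
  apply: (@le_trans _ _ (1 `^ a)); last by rewrite powR1.
  by apply: ge0_ler_powR => //; rewrite ?nnegrE ?sqrtr_ge0//; exact: ltW.
have mf : measurable_fun (disk : set plane) (fun x => enorm x `^ a).
  by apply: measurable_funTS; exact: measurable_enorm_powR.
have [] // := @ge0_integral_bounded _ _ _ leb2 _ (@measurable_disk R)
  (2 `^ (- a) * pi / (1 - 2 `^ (- a - 2))) _ mf.
- by move=> x _; exact: powR_ge0.
apply: (@fatou_le _ _ _ leb2 _ measurable_disk (fun M x => Num.min (enorm x `^ a) M.+1%:R)) => //.
- move=> M; apply: measurable_funTS; apply: measurable_minr => //.
  exact: measurable_enorm_powR.
- by move=> M x _; rewrite le_min powR_ge0 ler0n.
- by move=> x _; exact: powR_ge0.
- apply: aeW => x _; apply: cvg_near_cst; near=> M.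
  apply/min_idPl; apply: (@le_trans _ _ M%:R); last by rewrite ler_nat.
  by near: M; exact: nbhs_infty_ger.
- by move=> M; apply: truncated_powR_bound => //; exact: ltW.
Unshelve. all: by end_near. Qed.

(** Compare [y] with [tau c]. *)
Lemma exprn_young (n : nat) (c y tau : R) : 0 <= c -> 0 <= y -> 0 < tau ->
  c ^+ n * y <= tau * c ^+ n.+1 + tau^-1 ^+ n * y ^+ n.+1.
Proof.
move=> c0 y0 tau0; have [yc|cy] := leP y (tau * c).
  apply: (@le_trans _ _ (tau * c ^+ n.+1)); last first.
    by rewrite lerDl mulr_ge0// exprn_ge0// invr_ge0 ltW.
  by rewrite exprS mulrA [leLHS]mulrC ler_wpM2r ?exprn_ge0.
apply: (@le_trans _ _ (tau^-1 ^+ n * y ^+ n.+1)); last first.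
  by rewrite lerDr mulr_ge0// ?exprn_ge0// ltW.
rewrite (exprS y) [leRHS]mulrCA -exprMn [leLHS]mulrC ler_wpM2l// lerXn2r ?nnegrE//.
  by rewrite mulr_ge0// invr_ge0 ltW.
by rewrite mulrC ler_pdivlMr// mulrC ltW.
Qed.

(** For [n] large [(n+1)/n] is close to 1, and [2 alpha > -2]. *)
Lemma exists_exponent (alpha : R) : -1 < alpha ->
  exists n : nat, (0 < n)%N /\ -2 < 2 * alpha * (n.+1%:R / n%:R) ^+ 2.
Proof.
move=> a1; have [a0|a0] := leP 0 alpha.
  by exists 1%N; split => //; rewrite (@lt_le_trans _ _ 0)// mulr_ge0 ?sqr_ge0// mulr_ge0.
have b0 : 0 <= 3 * (- alpha) / (1 + alpha).
  by rewrite divr_ge0 ?mulr_ge0//; lra.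
have [n [n1 nP]] : exists n : nat, 1 <= n%:R :> R /\ 3 * (- alpha) / (1 + alpha) < n%:R.
  exists (Num.truncn (3 * (- alpha) / (1 + alpha))).+1; split; first by rewrite ler1n.
  exact: truncnS_gt.
have np : 0 < n%:R :> R by rewrite (lt_le_trans _ n1).
exists n; split; first by rewrite -(ltr0n R).
have a2 : 0 < 1 + alpha by lra.
move: nP; rewrite ltr_pdivrMr// => nP.
have -> : n.+1%:R / n%:R = 1 + 1 / n%:R :> R by rewrite -natr1 mulrDl mulfV// gt_eqF.
set q := 1 / n%:R.
have q0 : 0 < q by rewrite divr_gt0// (lt_le_trans _ n1).
have qn : q * n%:R = 1 by rewrite /q mul1r mulVf// gt_eqF// (lt_le_trans _ n1).
have q1 : q <= 1 by rewrite /q ler_pdivrMr ?mul1r// (lt_le_trans _ n1).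
have : 3 * - alpha * q < 1 + alpha.
  have : q * (3 * - alpha) < q * (n%:R * (1 + alpha)) by rewrite ltr_pM2l.
  by rewrite [ltRHS]mulrA qn mul1r [ltLHS]mulrC.
clear n1 nP qn np.
nra.
Qed.

Definition weight (alpha : R) (x : R * R) : R := enorm x `^ (2 * alpha).

Lemma weight_ge0 alpha x : 0 <= weight alpha x.
Proof. exact: powR_ge0. Qed.

Lemma measurable_weight alpha : measurable_fun [set: plane] (weight alpha).
Proof. exact: measurable_enorm_powR. Qed.

Section weighted_integrals.
Variables (alpha : R) (n : nat).
Hypothesis n0 : (0 < n)%N.
Hypothesis alphan : -2 < 2 * alpha * (n.+1%:R / n%:R) ^+ 2.

(** The power of the weight that is left after two applications of Young's
    inequality with the exponents [(n+1)/n] and [n+1]: one separates the weight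
    from the exponential, the other separates their product from [g ^+ 2]. *)
Definition weight_bound : R :=
  \int[leb2]_(x in disk) (enorm x `^ (2 * alpha * (n.+1%:R / n%:R) ^+ 2)).

Definition exponent : R := n.+1%:R ^+ 2 / n%:R.

Lemma exponent_ge0 : 0 <= exponent. Proof. by rewrite divr_ge0// sqr_ge0. Qed.

Lemma weight_bound_ge0 : 0 <= weight_bound.
Proof. by apply: Rintegral_ge0 => x _; exact: powR_ge0. Qed.

Let root psi (x : R * R) : R := enorm x `^ (2 * alpha / n%:R) * expR (psi x / n%:R).

Let nR0 : n%:R != 0 :> R. Proof. by rewrite pnatr_eq0 -lt0n. Qed.

Let root_ge0 psi x : 0 <= root psi x.
Proof. by rewrite mulr_ge0 ?powR_ge0 ?expR_ge0. Qed.

Let root_exp psi x : root psi x ^+ n = weight alpha x * expR (psi x).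
Proof.
rewrite exprMn -powR_mulrn ?powR_ge0// -powRrM divfK//; congr (_ * _).
by rewrite -expRM_natl mulrC divfK.
Qed.

Let root_expS psi x : root psi x ^+ n.+1 <=
  enorm x `^ (2 * alpha * (n.+1%:R / n%:R) ^+ 2) + expR (exponent * psi x).
Proof.
pose p := enorm x `^ (2 * alpha * n.+1%:R / n%:R / n%:R).
pose q := expR (psi x * n.+1%:R / n%:R).
have pn : p ^+ n = enorm x `^ (2 * alpha * n.+1%:R / n%:R).
  by rewrite /p -powR_mulrn ?powR_ge0// -powRrM divfK.
have pnS : p ^+ n.+1 = enorm x `^ (2 * alpha * (n.+1%:R / n%:R) ^+ 2).
  by rewrite /p -powR_mulrn ?powR_ge0// -powRrM; congr (_ `^ _); field.
have rn : (enorm x `^ (2 * alpha / n%:R)) ^+ n.+1 = enorm x `^ (2 * alpha * n.+1%:R / n%:R).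
  by rewrite -powR_mulrn ?powR_ge0// -powRrM; congr (_ `^ _); field.
have qn : expR (psi x / n%:R) ^+ n.+1 = q by rewrite -expRM_natl /q; congr expR; field.
have qnS : q ^+ n.+1 = expR (exponent * psi x).
  by rewrite /q -expRM_natl /exponent; congr expR; field.
have := @exprn_young n p q 1 (powR_ge0 _ _) (expR_ge0 _) ltr01.
have -> : root psi x ^+ n.+1 = p ^+ n * q by rewrite /root exprMn rn qn pn.
by rewrite invr1 expr1n !mul1r pnS qnS.
Qed.

Variables (psi : R * R -> R) (M : R).
Hypothesis mpsi : measurable_fun (disk : set plane) psi.
Hypothesis Ipsi : leb2.-integrable disk (EFin \o (fun x => expR (exponent * psi x))).
Hypothesis psiM : \int[leb2]_(x in disk) expR (exponent * psi x) <= M.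

Let mroot : measurable_fun (disk : set plane) (root psi).
Proof.
apply: measurable_funM; first by apply: measurable_funTS; exact: measurable_enorm_powR.
by apply: measurableT_comp => //; apply: measurable_funM.
Qed.

Let mwe : measurable_fun (disk : set plane) (fun x => weight alpha x * expR (psi x)).
Proof.
apply: measurable_funM; first by apply: measurable_funTS; exact: measurable_weight.
exact: measurableT_comp.
Qed.

Let Iroot : leb2.-integrable disk (EFin \o (fun x => root psi x ^+ n.+1)) /\
  \int[leb2]_(x in disk) (root psi x ^+ n.+1) <= weight_bound + M.
Proof.
have mD := @measurable_disk R.
have I1 := integrable_enorm_powR alphan.
have I12 := integrable_addr mD I1 Ipsi.
have I : leb2.-integrable disk (EFin \o (fun x => root psi x ^+ n.+1)).
  apply: (integrable_dominated mD _ I12); first exact: measurable_funX.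
  by move=> x _; rewrite ger0_norm ?exprn_ge0//; exact: root_expS.
split => //; apply: (@le_trans _ _ (weight_bound + \int[leb2]_(x in disk) expR (exponent * psi x))).
  by rewrite /weight_bound -(RintegralD mD I1 Ipsi); apply: (le_Rintegral mD I I12) => x _; exact: root_expS.
by rewrite lerD2l.
Qed.

Lemma weighted_integrable :
  leb2.-integrable disk (EFin \o (fun x => weight alpha x * expR (psi x))) /\
  \int[leb2]_(x in disk) (weight alpha x * expR (psi x)) <= weight_bound + M + pi.
Proof.
have mD := @measurable_disk R; have [I1 I2] := Iroot.
have Ic : leb2.-integrable disk (EFin \o cst (1 : R)).
  by apply: (@integrable_disk_bounded _ 1) => // x _; rewrite normr1.
have I12 := integrable_addr mD I1 Ic.
have le x : disk x -> weight alpha x * expR (psi x) <= root psi x ^+ n.+1 + cst 1 x.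
  move=> _; rewrite -root_exp; have := @exprn_young n (root psi x) 1 1 (root_ge0 _ _) ler01 ltr01.
  by rewrite invr1 !expr1n !mul1r mulr1.
have I : leb2.-integrable disk (EFin \o (fun x => weight alpha x * expR (psi x))).
  apply: (integrable_dominated mD mwe I12) => x dx.
  by rewrite ger0_norm ?mulr_ge0 ?weight_ge0 ?expR_ge0//; exact: le.
split => //; apply: le_trans (le_Rintegral mD I I12 le) _.
by rewrite (RintegralD mD I1 Ic) Rintegral_disk_cst mul1r lerD2r.
Qed.

(** Young's inequality with [c] the [n]-th root of the weighted exponential and
    [y = g^2 / D]: the factor [D] cancels in the moment of order [2 (n+1)] and
    remains in front of the exponential term, where [tau] makes it small. *)
Lemma weighted_sqr g D N tau : moment_bound g D N -> 0 < D -> 0 < tau ->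
  leb2.-integrable disk (EFin \o (fun x => weight alpha x * expR (psi x) * g x ^+ 2)) /\
  \int[leb2]_(x in disk) (weight alpha x * expR (psi x) * g x ^+ 2) <=
    tau * D * (weight_bound + M) + tau^-1 ^+ n * (n.+1`!%:R ^+ 2 * N).
Proof.
move=> [mg hg] D0 tau0; have mD := @measurable_disk R; have [I1 I2] := Iroot.
have [J1 J2] := hg n.+1 isT.
pose c2 := tau^-1 ^+ n * D^-1 ^+ n.
have K1 := integrable_scaler mD (tau * D) I1.
have K2 := integrable_scaler mD c2 J1.
have K12 := integrable_addr mD K1 K2.
have c20 : 0 <= c2 by rewrite mulr_ge0// exprn_ge0// invr_ge0 ltW.
have le x : disk x -> weight alpha x * expR (psi x) * g x ^+ 2 <=
    tau * D * root psi x ^+ n.+1 + c2 * g x ^+ (2 * n.+1).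
  move=> _; rewrite -root_exp.
  have y0 : 0 <= g x ^+ 2 / D by rewrite divr_ge0 ?sqr_ge0// ltW.
  have := @exprn_young n (root psi x) (g x ^+ 2 / D) tau (root_ge0 _ _) y0 tau0.
  rewrite -(ler_pM2l D0) => h.
  have -> : root psi x ^+ n * g x ^+ 2 = D * (root psi x ^+ n * (g x ^+ 2 / D)).
    by field; rewrite gt_eqF.
  apply: le_trans h _; rewrite le_eqVlt; apply/orP; left; apply/eqP.
  rewrite /c2 (exprM (g x)) [(g x ^+ 2 / D) ^+ n.+1]exprMn (exprS D^-1 n).
  move: (root psi x ^+ n.+1) ((g x ^+ 2) ^+ n.+1) (tau^-1 ^+ n) (D^-1 ^+ n) => A B C E.
  by field; rewrite gt_eqF.
have I : leb2.-integrable disk (EFin \o (fun x => weight alpha x * expR (psi x) * g x ^+ 2)).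
  apply: (integrable_dominated mD _ K12).
    by apply: measurable_funM; [exact: mwe|exact: measurable_funX].
  move=> x dx; rewrite ger0_norm; first exact: le.
  by rewrite mulr_ge0 ?sqr_ge0// mulr_ge0 ?weight_ge0 ?expR_ge0.
split => //; apply: le_trans (le_Rintegral mD I K12 le) _.
rewrite (RintegralD mD K1 K2) (@RintegralZl _ _ _ _ _ _ (tau * D) mD I1) (@RintegralZl _ _ _ _ _ _ c2 mD J1).
apply: lerD; first by rewrite ler_wpM2l// mulr_ge0// ltW.
apply: le_trans (ler_wpM2l c20 J2) _.
rewrite /c2 /= le_eqVlt; apply/orP; left; apply/eqP.
have E : D^-1 ^+ n * D ^+ n = 1 by rewrite -exprMn mulVf ?gt_eqF// expr1n.
move: (D^-1 ^+ n) (D ^+ n) (tau^-1 ^+ n) E => a b c E.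
by rewrite -[RHS]mul1r -E; ring.
Qed.

End weighted_integrals.

End weights.

(** * A smooth step *)

Section smooth_functions.
Context {R : realType}.
Notation leb := (@lebesgue_measure R).
Notation line := (measurableTypeR R).
Implicit Types (f g h : R -> R) (x d k s : R).

Lemma is_derive_cvg f x d :
  ((fun h : R => h^-1 *: (f (h + x) - f x)) h @[h --> (0 : R)^'] --> d) <-> is_derive x 1 f d.
Proof.
have E : (fun h : R => h^-1 *: ((f \o shift x) (h *: 1) - f x)) =
         (fun h : R => h^-1 *: (f (h + x) - f x)).
  by apply/funext => h /=; rewrite /GRing.scale /= mulr1.
split=> [fd|[fd <-]]; last first.
  by rewrite /derivable E in fd; rewrite /derive E.
apply: DeriveDef; first by rewrite /derivable E; exact: cvgP fd.
by rewrite /derive E; exact/cvg_lim.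
Qed.

Lemma is_derive_near f g x d : (\forall y \near x, f y = g y) ->
  is_derive x 1 f d -> is_derive x 1 g d.
Proof.
move=> fg /is_derive_cvg fd; apply/is_derive_cvg; apply: cvg_trans fd.
apply: near_eq_cvg.
have cv : h + x @[h --> (0 : R)^'] --> x.
  rewrite -[X in _ --> X]add0r; apply: cvgD; last exact: cvg_cst.
  exact: cvg_within.
have h0 : \forall h \near (0 : R)^', f (h + x) = g (h + x) by exact: (cv _ fg).
by apply: filterS h0 => h /= ->; rewrite (nbhs_singleton fg).
Qed.

(** Smoothness through a class stable under differentiation replaces an induction
    over the order of the derivatives by a closure computation. *)
Definition derivation_class (C : (R -> R) -> Prop) : Prop :=
  forall f, C f -> exists2 f', C f' & forall x, is_derive x 1 f (f' x).

Definition smooth1 f : Prop := exists2 C, derivation_class C & C f.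

Lemma smooth1_derive f : smooth1 f -> exists2 f', smooth1 f' & forall x, is_derive x 1 f (f' x).
Proof. by move=> [C dC /dC[f' Cf' ff']]; exists f' => //; exists C. Qed.

Lemma smooth1_continuous f : smooth1 f -> continuous f.
Proof. by move=> /smooth1_derive[f' _]; exact: continuous_is_derive. Qed.

Lemma smooth1_primitive f g : smooth1 g -> (forall x, is_derive x 1 f (g x)) -> smooth1 f.
Proof.
move=> [C dC Cg] fg; exists (fun h => C h \/ h = f); last by right.
move=> h [/dC[h' Ch' hh']|->]; first by exists h' => //; left.
by exists g => //; left.
Qed.

Lemma smooth1_scale (c : R) f : smooth1 f -> smooth1 (fun x => c * f x).
Proof.
move=> [C dC Cf]; exists (fun h => exists2 k, C k & h = (fun x => c * k x)); last by exists f.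
move=> _ [k Ck ->]; have [k' Ck' kk'] := dC _ Ck.
exists (fun x => c * k' x); first by exists k'.
by move=> x; exact: is_deriveZ.
Qed.

Definition flat (n : nat) (x : R) : R := if 0 < x then x^-1 ^+ n * expR (- x^-1) else 0.

Lemma flat_sqr_le n x : `|flat n x| <= n.+2`!%:R * x ^+ 2.
Proof.
rewrite /flat; case: ifPn => [x0|_]; last by rewrite normr0 mulr_ge0// sqr_ge0.
have y0 : 0 < x^-1 by rewrite invr_gt0.
have y0' := ltW y0; rewrite ger0_norm ?mulr_ge0 ?exprn_ge0 ?expR_ge0//.
have := @expR_ge1Dxn _ x^-1 n.+1 (ltW y0).
set e := expR x^-1 => he.
have e0 : 0 < e by exact: expR_gt0.
rewrite expRN -/e ler_pdivrMr//.
have : x^-1 ^+ n.+2 <= n.+2`!%:R * e.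
  rewrite mulrC -ler_pdivrMr ?ltr0n ?fact_gt0//; apply: le_trans he.
  by rewrite lerDr.
have x2 : 0 <= x ^+ 2 by exact: sqr_ge0.
move=> /(ler_wpM2r x2).
have -> : x^-1 ^+ n.+2 * x ^+ 2 = x^-1 ^+ n.
  by rewrite -addn2 exprD -mulrA -exprMn mulVf ?gt_eqF// expr1n mulr1.
by rewrite mulrAC.
Qed.

(** At the origin, [flat_sqr_le] makes the difference quotient tend to zero. *)
Lemma is_derive_flat n x : is_derive x 1 (flat n) (flat n.+2 x - n%:R * flat n.+1 x).
Proof.
have [x0|x0|->] := ltgtP x 0.
- have -> : flat n.+2 x - n%:R * flat n.+1 x = 0.
    by rewrite /flat ltNge ltW//= mulr0 subr0.
  apply: (is_derive_near (f := cst 0)).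
  near=> y; rewrite /flat ltNge (_ : y <= 0)//.
  by apply: ltW; near: y; exact: lt_nbhsl.
- apply: (is_derive_near (f := fun y => y^-1 ^+ n * expR (- y^-1))).
    near=> y; rewrite /flat (_ : 0 < y)//.
    by near: y; exact: lt_nbhsr.
  rewrite /flat x0.
  have xn : x != 0 by rewrite gt_eqF.
  have dV : is_derive x 1 (@GRing.inv R) (- x ^- 2).
    by apply: is_derive_eq (is_deriveV xn (is_derive_id x (1 : R))) _; rewrite /GRing.scale /= mulr1.
  have dX : is_derive x 1 (fun y : R => y^-1 ^+ n) (n%:R * x^-1 ^+ n.-1 * - x ^- 2).
    by have := is_deriveX n dV; rewrite exprfctE.
  have dE : is_derive x 1 (fun y : R => expR (- y^-1)) (expR (- x^-1) * x ^- 2).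
    have := @is_derive1_comp _ expR (fun y : R => - y^-1) x _ _ (is_derive_expR _) (is_deriveN dV).
    by rewrite opprK.
  apply: is_derive_eq (is_deriveM dX dE) _; rewrite /GRing.scale /=.
  rewrite -exprVn; case: n {dX} => [|n] /=; first by ring.
  by rewrite !exprS; ring.
- have -> : flat n.+2 0 - n%:R * flat n.+1 0 = 0.
    by rewrite /flat ltxx mulr0 subr0.
  apply/is_derive_cvg.
  have f0 : flat n 0 = 0 by rewrite /flat ltxx.
  apply: norm_cvg0.
  apply: (@squeeze_cvgr _ _ _ _ (cst 0) (fun h : R => n.+2`!%:R * `|h|)).
  + near=> h; rewrite /= normr_ge0/= addr0 f0 subr0 normrZ normfV.
    have hn0 : 0 < `|h| by rewrite normr_gt0; near: h; exact: nbhs_dnbhs_neq.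
    rewrite ler_pdivrMl// mulrCA -expr2 real_normK ?num_real//.
    exact: flat_sqr_le.
  + exact: cvg_cst.
  + rewrite -[X in _ --> X](mulr0 n.+2`!%:R); apply: cvgM; first exact: cvg_cst.
    by rewrite -{2}(@normr0 _ R); apply: cvg_norm; exact: cvg_within.
Unshelve. all: by end_near.
Qed.

Inductive flat_span : (R -> R) -> Prop :=
| FlatSpan n : flat_span (flat n)
| FlatSpanB (c : R) f g : flat_span f -> flat_span g -> flat_span (fun x => f x - c * g x).

Lemma smooth1_flat n : smooth1 (flat n).
Proof.
exists flat_span; last exact: FlatSpan.
move=> f; elim=> [k|c g h _ [g' Cg' gg'] _ [h' Ch' hh']].
  exists (fun x => flat k.+2 x - k%:R * flat k.+1 x); last exact: is_derive_flat.
  by apply: FlatSpanB; exact: FlatSpan.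
exists (fun x => g' x - c * h' x); first exact: FlatSpanB.
by move=> x; apply: is_deriveB; exact: is_deriveZ.
Qed.

(** For [k] large this is close to the indicator function of the unit interval. *)
Definition plateau (k s : R) : R := flat 0 (k * (s * (1 - s))).

Inductive poly_comp (q : R -> R) : (R -> R) -> Prop :=
| PolyCst c : poly_comp q (cst c)
| PolyId : poly_comp q id
| PolyComp h : smooth1 h -> poly_comp q (h \o q)
| PolyD f g : poly_comp q f -> poly_comp q g -> poly_comp q (fun x => f x + g x)
| PolyM f g : poly_comp q f -> poly_comp q g -> poly_comp q (fun x => f x * g x).

Lemma smooth1_plateau k : smooth1 (plateau k).
Proof.
pose q (s : R) := k * (s * (1 - s)).
have dq (s : R) : is_derive s 1 q (k + (- 2 * k) * s).
  have d1 : is_derive s 1 (fun s : R => 1 - s) (0 - 1) by exact: is_deriveB.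
  apply: is_derive_eq (is_deriveZ k (is_deriveM (is_derive_id s (1 : R)) d1)) _.
  by rewrite /GRing.scale /=; ring.
exists (poly_comp q); last by apply: PolyComp; exact: smooth1_flat.
move=> f; elim=> [c||h sh|f1 f2 C1 [f1' C1' d1] C2 [f2' C2' d2]|f1 f2 C1 [f1' C1' d1] C2 [f2' C2' d2]].
- by exists (cst 0); [exact: PolyCst|move=> x; exact: is_derive_cst].
- by exists (cst 1); [exact: PolyCst|move=> x; exact: is_derive_id].
- have [h' sh' hh'] := smooth1_derive sh.
  exists (fun x => (h' \o q) x * (cst k x + cst (- 2 * k) x * id x)).
    by apply: PolyM; [exact: PolyComp|apply: PolyD; [|apply: PolyM]; constructor].
  by move=> x; apply: is_derive1_comp.
- by exists (fun x => f1' x + f2' x); [exact: PolyD|move=> x; exact: is_deriveD].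
- exists (fun x => f1 x * f2' x + f2 x * f1' x); first by apply: PolyD; apply: PolyM.
  by move=> x; exact: is_deriveM.
Qed.

Lemma plateau_ge0 k s : 0 <= plateau k s.
Proof. by rewrite /plateau /flat; case: ifPn => // _; rewrite expr0 mul1r expR_ge0. Qed.

Lemma plateau_le1 k s : plateau k s <= 1.
Proof.
rewrite /plateau /flat; case: ifPn => // h; rewrite expr0 mul1r -[leRHS]expR0 ler_expR.
by rewrite oppr_le0 invr_ge0 ltW.
Qed.

Lemma plateau_out k s : 0 < k -> s <= 0 \/ 1 <= s -> plateau k s = 0.
Proof.
move=> k0 h; rewrite /plateau /flat ifF//; apply/negbTE; rewrite -leNgt.
by rewrite pmulr_rle0//; case: h => h; nra.
Qed.

Lemma plateau_ge (delta s : R) : 0 < delta -> delta <= 2^-1 ->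
  delta <= s <= 1 - delta -> 1 - delta <= plateau (2 / delta ^+ 2) s.
Proof.
move=> d0 d2 /andP[ds sd].
have d20 : 0 < delta ^+ 2 by rewrite exprn_gt0.
have h : delta / 2 <= s * (1 - s) by nra.
have h2 : delta^-1 <= 2 / delta ^+ 2 * (s * (1 - s)).
  apply: (@le_trans _ _ (2 / delta ^+ 2 * (delta / 2))).
    by rewrite le_eqVlt; apply/orP; left; apply/eqP; field; rewrite gt_eqF.
  by rewrite ler_wpM2l// divr_ge0// ltW.
have h3 : 0 < delta^-1 by rewrite invr_gt0.
have h4 := lt_le_trans h3 h2.
rewrite /plateau /flat h4 expr0 mul1r; apply: le_trans (expR_ge1Dx _).
by rewrite lerD2l lerN2 invf_ple ?posrE.
Qed.

Lemma continuous_plateau k : continuous (plateau k).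
Proof. exact/smooth1_continuous/smooth1_plateau. Qed.

Lemma measurable_plateau k (D : set line) : measurable_fun D (fun s : line => (plateau k s)%:E).
Proof.
apply/measurable_EFinP; apply: measurable_funTS; apply: continuous_measurable_fun.
exact: continuous_plateau.
Qed.

Definition ramp0 (k s : R) : R := (\int[leb]_(y in `]-oo, s]) plateau k y)%R.

Lemma ge0_integral_plateau k s : 0 < k -> (0 <= \int[leb]_(y in `]-oo, s]) (plateau k y)%:E <= 1)%E.
Proof.
move=> k0; apply/andP; split; first by apply: integral_ge0 => y _; rewrite lee_fin plateau_ge0.
have -> : (\int[leb]_(y in `]-oo, s]) (plateau k y)%:E = \int[leb]_(y in `]-oo, s] `&` `[0%R, 1%R]) (plateau k y)%:E)%E.
  rewrite integral_mkcond [RHS]integral_mkcond; apply: eq_integral => y _.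
  rewrite !patchE in_setI !mem_setE !in_itv/=; case: (y <= s) => //=.
  case: ifPn => //; rewrite negb_and -!ltNge => h; rewrite plateau_out//.
  by case/orP: h => /ltW; [left|right].
apply: (@le_trans _ _ (\int[leb]_(y in `[0%R, 1%R]) (cst 1 y))%E); last first.
  by rewrite integral_cst//= lebesgue_measure_itv/= lte_fin ltr01 sube0 mule1.
apply: (@le_trans _ _ (\int[leb]_(y in `[0%R, 1%R]) (plateau k y)%:E)%E).
  apply: ge0_subset_integral => //.
  - by apply: measurableI; exact: measurable_itv.
  - exact: measurable_plateau.
  - by move=> y _; rewrite lee_fin plateau_ge0.
apply: ge0_le_integral => //.
- by move=> y _; rewrite lee_fin plateau_ge0.
- exact: measurable_plateau.
- by move=> y _; rewrite lee_fin plateau_le1.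
Qed.

Lemma integrable_plateau k s : 0 < k -> leb.-integrable `]-oo, s] (EFin \o plateau k).
Proof.
move=> k0; apply/integrableP; split; first exact: measurable_plateau.
under eq_integral do rewrite /= ger0_norm ?plateau_ge0//.
by case/andP: (ge0_integral_plateau s k0) => _ /le_lt_trans; apply; rewrite ltry.
Qed.

Lemma is_derive_ramp0 k (s : R) : 0 < k -> is_derive s 1 (ramp0 k) (plateau k s).
Proof.
move=> k0.
have s1 : s < s + 1 by rewrite ltrDl.
have [|||d1 d2] := @continuous_FTC1 R (plateau k) -oo%O s (s + 1) s1.
- exact: integrable_plateau.
- exact: ltNyr.
- exact: continuous_plateau.
by apply: DeriveDef; [exact: d1|rewrite -derive1E; exact: d2].
Qed.

Lemma ramp0E k s : 0 < k -> ((ramp0 k s)%:E = \int[leb]_(y in `]-oo, s]) (plateau k y)%:E)%E.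
Proof.
move=> k0; rewrite /ramp0 /Rintegral fineK// ge0_fin_numE.
  by case/andP: (ge0_integral_plateau s k0) => _ /le_lt_trans; apply; rewrite ltry.
by case/andP: (ge0_integral_plateau s k0).
Qed.

Lemma ramp0_mono k s s' : 0 < k -> s <= s' -> ramp0 k s <= ramp0 k s'.
Proof.
move=> k0 ss; rewrite -lee_fin !ramp0E//.
apply: ge0_subset_integral => //.
- exact: measurable_plateau.
- by move=> y _; rewrite lee_fin plateau_ge0.
- by move=> y /=; rewrite !in_itv/= => /le_trans; apply.
Qed.

Lemma ramp0_le0 k s : 0 < k -> s <= 0 -> ramp0 k s = 0.
Proof.
move=> k0 s0; apply/EFin_inj; rewrite ramp0E//; apply: integral0_eq => y /=.
by rewrite in_itv/= => ys; rewrite plateau_out//; left; exact: le_trans s0.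
Qed.

Lemma ramp0_ge1 k s : 0 < k -> 1 <= s -> ramp0 k s = ramp0 k 1.
Proof.
move=> k0 s1; apply/EFin_inj; rewrite !ramp0E//.
rewrite integral_mkcond [RHS]integral_mkcond; apply: eq_integral => y _.
rewrite !patchE !mem_setE !in_itv/=.
have [y1|y1] := leP y 1; first by rewrite (le_trans y1).
by case: ifP => // _; rewrite plateau_out//; right; exact: ltW.
Qed.

Lemma ramp0_1_ge (delta : R) : 0 < delta -> delta < 2^-1 ->
  1 - 3 * delta <= ramp0 (2 / delta ^+ 2) 1.
Proof.
move=> d0 d2.
have k0 : 0 < 2 / delta ^+ 2 by rewrite divr_gt0// exprn_gt0.
have dd : delta <= 1 - delta by lra.
have h : 1 - 3 * delta <= (1 - delta) * (1 - delta - delta) by nra.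
apply: le_trans h _; rewrite -lee_fin ramp0E//.
apply: (@le_trans _ _ (\int[leb]_(y in `[delta, (1 - delta)%R]) (cst (1 - delta)%:E y))%E).
  by rewrite integral_cst//= lebesgue_measure_itv/= lte_fin (_ : delta < 1 - delta) ?EFinM ?EFinB//; lra.
apply: (@le_trans _ _ (\int[leb]_(y in `[delta, (1 - delta)%R]) (plateau (2 / delta ^+ 2) y)%:E)%E).
  apply: ge0_le_integral => //.
  - by move=> y _; rewrite /= lee_fin; lra.
  - exact: measurable_plateau.
  - by move=> y /=; rewrite in_itv/= lee_fin => yd; apply: plateau_ge => //; exact: ltW.
apply: ge0_subset_integral => //.
- exact: measurable_plateau.
- by move=> y _; rewrite lee_fin plateau_ge0.
- by move=> y /=; rewrite !in_itv/= => /andP[_ h']; rewrite (le_trans h')//; lra.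
Qed.

(** The slope of a smooth unit step supported in the unit interval must exceed 1
    somewhere; normalizing the primitive of a plateau makes it exceed 1 as little
    as desired. *)
Lemma exists_ramp (delta : R) : 0 < delta -> delta <= 1 / 6 ->
  exists S S' : R -> R, [/\ smooth1 S, forall s : R, is_derive s 1 S (S' s),
    forall s, s <= 0 -> S s = 0, forall s, 1 <= s -> S s = 1 &
    [/\ forall s, 0 <= S s <= 1, forall s, 0 <= S' s <= (1 - 3 * delta)^-1 &
        forall s, s <= 0 \/ 1 <= s -> S' s = 0]].
Proof.
move=> d0 d6.
have d2 : delta < 2^-1 by lra.
have d3 : 0 < 1 - 3 * delta by lra.
set k := 2 / delta ^+ 2.
have k0 : 0 < k by rewrite divr_gt0// exprn_gt0.
have c0 := ramp0_1_ge d0 d2; rewrite -/k in c0.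
have cp : 0 < ramp0 k 1 by exact: lt_le_trans c0.
set c := ramp0 k 1 in c0 cp *.
have dS (s : R) : is_derive s 1 (fun s => c^-1 * ramp0 k s) (c^-1 * plateau k s).
  by apply: is_deriveZ; exact: is_derive_ramp0.
exists (fun s => c^-1 * ramp0 k s), (fun s => c^-1 * plateau k s); split => //.
- by apply: smooth1_primitive dS; apply: smooth1_scale; exact: smooth1_plateau.
- by move=> s s0; rewrite ramp0_le0// mulr0.
- by move=> s s1; rewrite ramp0_ge1// mulVf// gt_eqF.
split.
- move=> s; apply/andP; split.
    rewrite mulr_ge0//; first by rewrite invr_ge0 ltW.
    by rewrite -lee_fin ramp0E//; case/andP: (ge0_integral_plateau s k0).
  rewrite ler_pdivrMl// mulr1.
  have [s1|/ltW s1] := leP s 1; first exact: ramp0_mono.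
  by rewrite ramp0_ge1.
- move=> s; rewrite mulr_ge0 ?plateau_ge0 ?invr_ge0 ?(ltW cp)//=.
  rewrite -[leRHS]mulr1 ler_pM ?plateau_ge0 ?plateau_le1 ?invr_ge0 ?(ltW cp)//.
  by rewrite lef_pV2.
- by move=> s h; rewrite plateau_out// mulr0.
Qed.

End smooth_functions.

(** * Radial cut-off functions *)

Section cutoff_functions.
Context {R : realType}.
Notation leb := (@lebesgue_measure R).
Notation leb2 := (leb \x leb)%E.
Notation plane := (measurableTypeR R * measurableTypeR R)%type.
Implicit Types (f g : R * R -> R).

Definition derivation_class2 (C : (R * R -> R) -> Prop) : Prop :=
  forall f, C f -> continuous f /\
    exists f1 f2, [/\ C f1, C f2, forall x : R * R, is_derive x (e1 : R * R) f (f1 x) &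
      forall x : R * R, is_derive x (e2 : R * R) f (f2 x)].

Lemma derivation_class2_smooth C f : derivation_class2 C -> C f -> smooth f.
Proof.
move=> dC Cf k; elim: k f Cf => [|k IH] f Cf; first by split=> //; have [] := dC _ Cf.
have [cf [f1 [f2 [C1 C2 d1 d2]]]] := dC _ Cf.
have -> : Ck k.+1 f = (continuous f /\ [/\ forall x, derivable f x e1, forall x, derivable f x e2,
        Ck k ('D_e1 f) & Ck k ('D_e2 f)]) by [].
split=> //.
have E1 : 'D_e1 f = f1 by apply/funext => x; exact: derive_val.
have E2 : 'D_e2 f = f2 by apply/funext => x; exact: derive_val.
rewrite E1 E2; split; [| |exact: IH..].
- by move=> x; exact: (@ex_derive _ _ _ _ _ _ _ (d1 x)).
- by move=> x; exact: (@ex_derive _ _ _ _ _ _ _ (d2 x)).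
Qed.

Lemma Ck_scale (a c : R) k f : Ck k f -> Ck k (fun x => a * f (c *: x)).
Proof.
have cs (g : R * R -> R) (b : R) : continuous g -> continuous (fun x : R * R => b * g (c *: x)).
  by move=> cg x; apply: cvgM; [exact: cvg_cst|exact: continuous_comp_scale].
elim: k f a => [|k IH] f a /= [cf]; first by split=> //; exact: cs.
move=> [d1 d2 c1 c2]; split; first exact: cs.
have D1 (x : R * R) : is_derive x (e1 : R * R) (fun x => a * f (c *: x)) (a * (c * 'D_e1 f (c *: x))).
  by apply: is_deriveZ; apply: is_derive_scale1; exact: derivableP.
have D2 (x : R * R) : is_derive x (e2 : R * R) (fun x => a * f (c *: x)) (a * (c * 'D_e2 f (c *: x))).
  by apply: is_deriveZ; apply: is_derive_scale2; exact: derivableP.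
have E1 : 'D_e1 (fun x => a * f (c *: x)) = (fun x => a * c * 'D_e1 f (c *: x)).
  by apply/funext => x; rewrite -mulrA; exact: derive_val.
have E2 : 'D_e2 (fun x => a * f (c *: x)) = (fun x => a * c * 'D_e2 f (c *: x)).
  by apply/funext => x; rewrite -mulrA; exact: derive_val.
rewrite E1 E2; split; [| |exact: (IH _ (a * c) c1)|exact: (IH _ (a * c) c2)].
- by move=> x; exact: (@ex_derive _ _ _ _ _ _ _ (D1 x)).
- by move=> x; exact: (@ex_derive _ _ _ _ _ _ _ (D2 x)).
Qed.

Lemma supp_sub_disk f (c : R) : c < 1 ->
  (forall x, f x != 0 -> x.1 ^+ 2 + x.2 ^+ 2 <= c) -> compact (supp f) /\ supp f `<=` disk.
Proof.
move=> c1 fc.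
have cF : closed [set x : R * R | x.1 ^+ 2 + x.2 ^+ 2 <= c].
  apply: (@closed_comp _ _ (fun x : R * R => x.1 ^+ 2 + x.2 ^+ 2) [set y | y <= c]).
    by move=> x _; exact: continuous_sqr_norm.
  exact: closed_le.
have sF : supp f `<=` [set x | x.1 ^+ 2 + x.2 ^+ 2 <= c].
  by rewrite [X in _ `<=` X](closure_id _).1//; apply: closure_subset => x; exact: fc.
split; last by move=> x /sF /= h; rewrite diskE (le_lt_trans h).
apply: (@subclosed_compact _ (supp f) (`[(-1 : R), 1]%classic `*` `[(-1 : R), 1]%classic)).
- exact: closed_closure.
- by apply: compact_setX; exact: segment_compact.
- move=> x /sF /= h.
  have /disk_box[x1 x2] : disk x by rewrite diskE (le_lt_trans h).
  by split; rewrite /= in_itv/= -ler_norml.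
Qed.

Lemma disk_scaleE (s : R) x : 0 < s -> disk (s *: x) = (x.1 ^+ 2 + x.2 ^+ 2 < s ^- 2) :> Prop.
Proof.
move=> s0; rewrite diskE /= /GRing.scale /= !exprMn -mulrDr.
by rewrite -ltr_pdivlMl ?exprn_gt0// mulr1.
Qed.

Lemma test_function_scale f (s : R) : 1 < s -> test_function f -> test_function (fun x => f (s *: x)).
Proof.
move=> s1 tf; have C := test_function_disk_C1 tf; have [sf _ _] := tf.
have s0 : 0 < s by exact: lt_trans s1.
have [|x fx|c1 c2] := @supp_sub_disk (fun x => f (s *: x)) (s ^- 2).
- by rewrite invf_lt1 ?exprn_gt0// exprn_egt1.
- apply: ltW; rewrite -disk_scaleE//; apply: contra_neqP fx; exact: (C1_out C).
split=> // k; have := Ck_scale 1 s (sf k).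
by under eq_fun do rewrite mul1r.
Qed.

Definition radial (a b : R) (x : R * R) : R := a + b * (x.1 ^+ 2 + x.2 ^+ 2).

Lemma continuous_radial a b : continuous (radial a b).
Proof.
move=> x; apply: cvgD; first exact: cvg_cst.
by apply: cvgM; [exact: cvg_cst|exact: continuous_sqr_norm].
Qed.

Lemma is_derive_sqr (x : R) : is_derive x 1 (fun y : R => y ^+ 2) (2 * x).
Proof.
by apply: is_derive_eq (is_deriveM (is_derive_id x (1 : R)) (is_derive_id x (1 : R))) _;
  rewrite /GRing.scale /= !mulr1; ring.
Qed.

Lemma is_derive_radial1 a b (x : R * R) : is_derive x (e1 : R * R) (radial a b) (2 * b * x.1).
Proof.
case: x => x y; apply/is_derive_slice1.
apply: is_derive_eq (is_deriveD (is_derive_cst a x (1 : R)) (is_deriveZ b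
  (is_deriveD (is_derive_sqr x) (is_derive_cst (y ^+ 2) x (1 : R))))) _.
by rewrite /GRing.scale /=; ring.
Qed.

Lemma is_derive_radial2 a b (x : R * R) : is_derive x (e2 : R * R) (radial a b) (2 * b * x.2).
Proof.
case: x => x y; apply/is_derive_slice2.
apply: is_derive_eq (is_deriveD (is_derive_cst a y (1 : R)) (is_deriveZ b
  (is_deriveD (is_derive_cst (x ^+ 2) y (1 : R)) (is_derive_sqr y)))) _.
by rewrite /GRing.scale /=; ring.
Qed.

Lemma is_derive_comp1 (h : R -> R) (q : R * R -> R) (d d' : R) (x : R * R) :
  is_derive (q x) 1 h d -> is_derive x (e1 : R * R) q d' ->
  is_derive x (e1 : R * R) (h \o q) (d * d').
Proof.
case: x => x y hd /is_derive_slice1 qd; apply/is_derive_slice1.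
exact: (@is_derive1_comp _ h (fun s => q (s, y))).
Qed.

Lemma is_derive_comp2 (h : R -> R) (q : R * R -> R) (d d' : R) (x : R * R) :
  is_derive (q x) 1 h d -> is_derive x (e2 : R * R) q d' ->
  is_derive x (e2 : R * R) (h \o q) (d * d').
Proof.
case: x => x y hd /is_derive_slice2 qd; apply/is_derive_slice2.
exact: (@is_derive1_comp _ h (fun s => q (x, s))).
Qed.

Inductive radial_comp (a b : R) : (R * R -> R) -> Prop :=
| RadialCst c : radial_comp a b (cst c)
| RadialFst : radial_comp a b fst
| RadialSnd : radial_comp a b snd
| RadialComp h : smooth1 h -> radial_comp a b (h \o radial a b)
| RadialD f g : radial_comp a b f -> radial_comp a b g -> radial_comp a b (fun x => f x + g x)
| RadialM f g : radial_comp a b f -> radial_comp a b g -> radial_comp a b (fun x => f x * g x).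

Lemma derivation_class2_radial a b : derivation_class2 (radial_comp a b).
Proof.
move=> f; elim=> [c|||h sh|f1 f2 C1 [c1 [g1 [g2 [D1 D2 d1 d2]]]] C2 [c2 [g1' [g2' [D1' D2' d1' d2']]]]
  |f1 f2 C1 [c1 [g1 [g2 [D1 D2 d1 d2]]]] C2 [c2 [g1' [g2' [D1' D2' d1' d2']]]]].
- split; first by move=> x; exact: cvg_cst.
  by exists (cst 0), (cst 0); split; [exact: RadialCst..|move=> x; exact: is_derive_cst|move=> x; exact: is_derive_cst].
- split; first exact: continuous_fst.
  exists (cst 1), (cst 0); split; [exact: RadialCst..| |].
    by case=> x y; apply/is_derive_slice1; exact: is_derive_id.
  by case=> x y; apply/is_derive_slice2; exact: is_derive_cst.
- split; first exact: continuous_snd.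
  exists (cst 0), (cst 1); split; [exact: RadialCst..| |].
    by case=> x y; apply/is_derive_slice1; exact: is_derive_cst.
  by case=> x y; apply/is_derive_slice2; exact: is_derive_id.
- split.
    move=> x; apply: continuous_comp; first exact: continuous_radial.
    exact: smooth1_continuous.
  have [h' sh' hh'] := smooth1_derive sh.
  exists (fun x => (h' \o radial a b) x * (cst (2 * b) x * x.1)),
         (fun x => (h' \o radial a b) x * (cst (2 * b) x * x.2)); split.
  + by apply: RadialM; [exact: RadialComp|apply: RadialM; constructor].
  + by apply: RadialM; [exact: RadialComp|apply: RadialM; constructor].
  + by move=> x; exact: is_derive_comp1 (hh' _) (is_derive_radial1 _ _ _).
  + by move=> x; exact: is_derive_comp2 (hh' _) (is_derive_radial2 _ _ _).
- split; first by move=> x; apply: cvgD; [exact: c1|exact: c2].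
  exists (fun x => g1 x + g1' x), (fun x => g2 x + g2' x); split; [exact: RadialD..| |].
    by move=> x; exact: is_deriveD.
  by move=> x; exact: is_deriveD.
- split; first by move=> x; apply: cvgM; [exact: c1|exact: c2].
  exists (fun x => f1 x * g1' x + f2 x * g1 x), (fun x => f1 x * g2' x + f2 x * g2 x); split.
  + by apply: RadialD; apply: RadialM.
  + by apply: RadialD; apply: RadialM.
  + by move=> x; exact: is_deriveM.
  + by move=> x; exact: is_deriveM.
Qed.

Lemma smooth_radial_comp (h : R -> R) (a b : R) : smooth1 h -> smooth (h \o radial a b).
Proof.
by move=> sh; apply: (derivation_class2_smooth (@derivation_class2_radial a b)); exact: RadialComp.
Qed.

Lemma measurable_indic_scaled_disk (c : R) : measurable_fun setT (fun x : plane => \1_(disk : set plane) (c *: x) : R).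
Proof.
apply: (@measurableT_comp _ _ _ _ _ _ (\1_(disk : set plane) : plane -> R)).
  by apply: measurable_indic; exact: measurable_disk.
exact: measurable_scale.
Qed.

Lemma integrable_indic_scaled_disk (c : R) :
  leb2.-integrable disk (EFin \o (fun x => \1_(disk : set (R * R)) (c *: x) : R)).
Proof.
apply: (@integrable_disk_bounded _ 1).
  by apply: measurable_funTS; exact: measurable_indic_scaled_disk.
by move=> x _; rewrite indicE; case: (_ \in _); rewrite ?normr0 ?normr1.
Qed.

Lemma area_scaled_disk (c : R) : 0 < c <= 1 ->
  \int[leb2]_(x in disk) (\1_(disk : set (R * R)) (c^-1 *: x) : R) = c ^+ 2 * pi.
Proof.
move=> /andP[c0 c1]; apply/EFin_inj.
rewrite -Rintegral_EFin; [|exact: measurable_disk|exact: integrable_indic_scaled_disk].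
rewrite -integral_planeE; last first.
  move=> x; rewrite diskE => /negP; rewrite -leNgt => h.
  rewrite indicE memNset// disk_scaleE ?invr_gt0// => h'.
  have c2 : c ^+ 2 <= 1 by rewrite expr_le1// ltW.
  by move: h'; rewrite exprVn invrK; lra.
rewrite (@ge0_integral_scale2 _ c^-1 (fun x => (\1_(disk : set (R * R)) x : R)%:E)) ?invr_gt0//.
- rewrite exprVn invrK integral_indic// ?setIT; [|exact: measurable_disk].
  rewrite (_ : _ disk = pi%:E); last exact: area_disk.
  by rewrite EFinM.
- by apply/measurable_EFinP; apply: measurable_indic; exact: measurable_disk.
Qed.

(** In the variable [|x|^2] the cut-off is an almost affine step between [t^2] and
    a value [r^2 = 1 - delta (1 - t^2)] that leaves room for compact support.
    With an affine step the energy is [4 / (r^2 - t^2)^2] times the integral of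
    [|x|^2], at most [4 pi / (r^2 - t^2)]; for small [delta] and to first order in
    [1 - t] this is the capacity of the annulus [t < |x| < 1]. *)
Lemma cutoff (delta t : R) : 0 < delta -> delta <= 1 / 6 -> 0 < t < 1 ->
  exists xi, [/\ test_function xi, forall x, 0 <= xi x <= 1,
    forall x, enorm x <= t -> [/\ xi x = 1, 'D_e1 xi x = 0 & 'D_e2 xi x = 0] &
    dirichlet ('D_e1 xi) ('D_e2 xi) <= 4 * pi / ((1 - 3 * delta) ^+ 2 * (1 - delta) * (1 - t ^+ 2))].
Proof.
move=> d0 d6 /andP[t0 t1].
have [S [S' [sS dS S0 S1 [S01 S'1 S'0]]]] := exists_ramp d0 d6.
have t2 : t ^+ 2 < 1 by rewrite expr_lt1// ltW.
set c := (1 - delta) * (1 - t ^+ 2).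
have c0 : 0 < c by rewrite mulr_gt0 ?subr_gt0//; lra.
set r2 := 1 - delta * (1 - t ^+ 2).
have r2c : r2 - t ^+ 2 = c by rewrite /r2 /c; ring.
have r21 : r2 < 1 by rewrite /r2 ltrBlDr ltrDl mulr_gt0// subr_gt0.
set a := r2 / c; set b := - c^-1.
have qE x : radial a b x = (r2 - (x.1 ^+ 2 + x.2 ^+ 2)) / c by rewrite /radial /a /b; ring.
have q0 x : r2 <= x.1 ^+ 2 + x.2 ^+ 2 -> radial a b x <= 0.
  by move=> h; rewrite qE ler_pdivrMr// mul0r subr_le0.
have q1 x : x.1 ^+ 2 + x.2 ^+ 2 <= t ^+ 2 -> 1 <= radial a b x.
  by move=> h; rewrite qE ler_pdivlMr// mul1r -r2c lerD2l lerN2.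
pose xi := S \o radial a b.
have D1 (x : R * R) : is_derive x (e1 : R * R) xi (S' (radial a b x) * (2 * b * x.1)).
  by exact: is_derive_comp1 (dS _) (is_derive_radial1 _ _ _).
have D2 (x : R * R) : is_derive x (e2 : R * R) xi (S' (radial a b x) * (2 * b * x.2)).
  by exact: is_derive_comp2 (dS _) (is_derive_radial2 _ _ _).
have E1 (x : R * R) : 'D_e1 xi x = S' (radial a b x) * (2 * b * x.1) by exact: derive_val.
have E2 (x : R * R) : 'D_e2 xi x = S' (radial a b x) * (2 * b * x.2) by exact: derive_val.
have [|cs sd] := @supp_sub_disk xi r2 r21.
  move=> x; apply: contra_neqT; rewrite -ltNge => /ltW/q0; exact: S0.
have txi : test_function xi by split => //; exact: smooth_radial_comp.
exists xi; split => //; first by move=> x; exact: S01.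
  move=> x; rewrite /enorm => h.
  have {}h : 1 <= radial a b x.
    apply: q1; rewrite -(@sqr_sqrtr _ (x.1 ^+ 2 + x.2 ^+ 2)) ?addr_ge0 ?sqr_ge0//.
    by rewrite lerXn2r// nnegrE ?sqrtr_ge0// ltW.
  by rewrite E1 E2 /xi /= S1// S'0 ?mul0r//; right.
have r20 : 0 < r2 by rewrite -(subrK (t ^+ 2) r2) r2c addr_gt0// exprn_gt0.
set r := Num.sqrt r2.
have r0 : 0 < r by rewrite sqrtr_gt0.
have rr : r ^+ 2 = r2 by rewrite sqr_sqrtr// ltW.
have r1 : r <= 1 by rewrite -sqrtr1 ler_sqrt// ltW.
set K := 4 / ((1 - 3 * delta) ^+ 2 * c ^+ 2).
have d3 : 0 < 1 - 3 * delta by lra.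
have K0 : 0 <= K by rewrite divr_ge0// mulr_ge0// sqr_ge0.
have mD := @measurable_disk R.
have I1 := integrable_indic_scaled_disk r^-1.
have I2 := integrable_indic_scaled_disk t^-1.
have I := integrable_scaler mD K (integrable_subr mD I1 I2).
(* the gradient lives on the annulus, a difference of two scaled disks *)
apply: (@le_trans _ _ (\int[leb2]_(x in disk)
  (K * (\1_(disk : set (R * R)) (r^-1 *: x) - \1_(disk : set (R * R)) (t^-1 *: x))))).
  have txC := test_function_disk_C1 txi.
  apply: le_Rintegral => //.
    apply: (integrable_addr mD).
      exact: (integrable_disk_exprn 2 (C1_cont1 txC) (C1_out1 txC)).
    exact: (integrable_disk_exprn 2 (C1_cont2 txC) (C1_out2 txC)).
  move=> x _; rewrite E1 E2 !indicE.
  have [xr|xr] := ltP (x.1 ^+ 2 + x.2 ^+ 2) r2; last first.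
    rewrite S'0; last by left; exact: q0.
    rewrite !memNset ?subrr; first by rewrite !mul0r expr0n/= addr0 mulr0.
      rewrite disk_scaleE ?invr_gt0// exprVn invrK; apply/negP; rewrite -leNgt.
      by apply: le_trans xr; rewrite -(subrK (t ^+ 2) r2) r2c lerDr ltW.
    by rewrite disk_scaleE ?invr_gt0// exprVn invrK rr; apply/negP; rewrite -leNgt.
  rewrite (@mem_set _ disk (r^-1 *: x)); last first.
    by rewrite disk_scaleE ?invr_gt0// exprVn invrK rr.
  have [xt|xt] := ltP (x.1 ^+ 2 + x.2 ^+ 2) (t ^+ 2).
    rewrite S'0; last by right; apply: q1; exact: ltW.
    rewrite mem_set; first by rewrite !mul0r expr0n/= addr0 subrr mulr0.
    by rewrite disk_scaleE ?invr_gt0// exprVn invrK.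
  rewrite memNset; last by rewrite disk_scaleE ?invr_gt0// exprVn invrK; apply/negP; rewrite -leNgt.
  rewrite subr0 mulr1.
  have -> : (S' (radial a b x) * (2 * b * x.1)) ^+ 2 + (S' (radial a b x) * (2 * b * x.2)) ^+ 2 =
    4 / c ^+ 2 * (S' (radial a b x) ^+ 2 * (x.1 ^+ 2 + x.2 ^+ 2)).
    by rewrite /b; field; rewrite gt_eqF.
  have -> : K = 4 / c ^+ 2 * ((1 - 3 * delta)^-1 ^+ 2 * 1).
    by rewrite /K; field; rewrite !gt_eqF.
  have /andP[p0 p1] := S'1 (radial a b x).
  rewrite ler_wpM2l//; first by rewrite divr_ge0// sqr_ge0.
  rewrite ler_pM ?sqr_ge0 ?addr_ge0 ?sqr_ge0//; last by apply/ltW; exact: lt_trans r21.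
  by rewrite lerXn2r// nnegrE ?(le_trans p0).
rewrite (@RintegralZl _ _ _ _ _ _ K mD (integrable_subr mD I1 I2)).
rewrite (RintegralB mD I1 I2) !area_scaled_disk ?t0 ?r0 ?(ltW t1)//.
rewrite rr -mulrBl r2c le_eqVlt; apply/orP; left; apply/eqP.
by rewrite /K /c; field; rewrite !gt_eqF//; [lra|rewrite subr_gt0].
Qed.

End cutoff_functions.

(** * Dilations of weighted integrals *)

Section dilation.
Context {R : realType}.
Notation leb := (@lebesgue_measure R).
Notation leb2 := (leb \x leb)%E.
Notation plane := (measurableTypeR R * measurableTypeR R)%type.

Lemma not_disk_scale (s : R) (x : R * R) : 1 <= s -> ~ disk x -> ~ disk (s *: x).
Proof.
move=> s1; have s0 : 0 <= s by exact: le_trans s1.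
rewrite /disk /= enormZ// => /negP; rewrite -leNgt => h; apply/negP; rewrite -leNgt.
by rewrite (le_trans h)// ler_peMl// sqrtr_ge0.
Qed.

Lemma Rintegral_dilation (s : R) (F : R * R -> R) : 1 <= s ->
  measurable_fun [set: plane] F -> (forall x, 0 <= F x) -> leb2.-integrable disk (EFin \o F) ->
  leb2.-integrable disk (EFin \o (fun x => \1_(disk : set (R * R)) (s *: x) * F (s *: x))) /\
  \int[leb2]_(x in disk) (\1_(disk : set (R * R)) (s *: x) * F (s *: x)) =
    s ^- 2 * \int[leb2]_(x in disk) F x.
Proof.
move=> s1 mF F0 IF; have mD := @measurable_disk R.
have s0 : 0 < s by exact: lt_le_trans s1.
pose F1 (x : R * R) := \1_(disk : set (R * R)) x * F x.
have F10 x : 0 <= F1 x by rewrite mulr_ge0// indicE.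
have mF1 : measurable_fun [set: plane] F1 by apply: measurable_funM => //; exact: measurable_indic.
have out x : ~ disk x -> F1 x = 0 by move=> dx; rewrite /F1 indicE memNset// mul0r.
have E1 : (\int[leb2]_x (F1 x)%:E = (\int[leb2]_(x in disk) F x)%:E)%E.
  rewrite (integral_planeE out) -(Rintegral_EFin mD IF); apply: eq_integral => x xd.
  by rewrite /F1 indicE xd mul1r.
have E2 : (\int[leb2]_(x in disk) (F1 (s *: x))%:E = (s ^- 2 * \int[leb2]_(x in disk) F x)%:E)%E.
  rewrite -(@integral_planeE _ (fun x => F1 (s *: x))); last first.
    by move=> x dx; apply: out; exact: not_disk_scale.
  rewrite (@ge0_integral_scale2 _ s (fun x => (F1 x)%:E)) ?E1 ?EFinM//.
  exact/measurable_EFinP.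
have I : leb2.-integrable disk (EFin \o (fun x => F1 (s *: x))).
  apply: (@ge0_integral_bounded _ _ _ leb2 _ mD (s ^- 2 * \int[leb2]_(x in disk) F x) (fun x => F1 (s *: x)) _ _ _).1.
  - by apply: measurable_funTS; apply: (measurableT_comp mF1); exact: measurable_scale.
  - by [].
  - by rewrite E2.
by split=> //; apply/EFin_inj; rewrite -(Rintegral_EFin mD I).
Qed.

Lemma weight_scale (alpha s : R) x : 0 < s -> weight alpha (s *: x) = s `^ (2 * alpha) * weight alpha x.
Proof. by move=> s0; rewrite /weight enormZ ?(ltW s0)// powRM ?sqrtr_ge0// ltW. Qed.

(** This is [s^(-2 - 2 alpha)]: the Jacobian times the homogeneity of the weight. *)
Definition dilation_rate (alpha s : R) : R := s ^- 2 * s `^ (- (2 * alpha)).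

(** The weight is homogeneous, and [f (s x)] vanishes outside the dilated disk,
    where the exponential is 1. *)
Lemma integral_weight_dilation (alpha s : R) (f : R * R -> R) : 1 <= s -> continuous f ->
  (forall x, ~ disk x -> f x = 0) ->
  leb2.-integrable disk (EFin \o weight alpha) ->
  leb2.-integrable disk (EFin \o (fun x => weight alpha x * expR (f x))) ->
  leb2.-integrable disk (EFin \o (fun x => weight alpha x * expR (f (s *: x)))) /\
  \int[leb2]_(x in disk) (weight alpha x * expR (f (s *: x))) =
    dilation_rate alpha s * \int[leb2]_(x in disk) (weight alpha x * expR (f x)) +
    (1 - dilation_rate alpha s) * \int[leb2]_(x in disk) weight alpha x.
Proof.
move=> s1 cf f0 IV IE; have mD := @measurable_disk R.
have s0 : 0 < s by exact: lt_le_trans s1.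
have mf := continuous_measurable_plane cf.
have mV := @measurable_weight R alpha.
have mE : measurable_fun [set: plane] (fun x => weight alpha x * expR (f x)).
  by apply: measurable_funM => //; exact: measurableT_comp.
have E0 (x : R * R) : 0 <= weight alpha x * expR (f x) by rewrite mulr_ge0 ?weight_ge0 ?expR_ge0.
have [J1 K1] := Rintegral_dilation s1 mE E0 IE.
have [J2 K2] := Rintegral_dilation s1 mV (weight_ge0 alpha) IV.
set c := s `^ (- (2 * alpha)).
have cV x : c * weight alpha (s *: x) = weight alpha x.
  rewrite weight_scale// mulrA -powRD; last by apply/implyP => _; rewrite gt_eqF.
  by rewrite addNr powRr0 mul1r.
have L1 := integrable_scaler mD c J1; have L2 := integrable_scaler mD c J2.
have L12 := integrable_subr mD L1 L2.
have L := integrable_addr mD L12 IV.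
have E (x : R * R) : weight alpha x * expR (f (s *: x)) =
  c * (\1_(disk : set (R * R)) (s *: x) * (weight alpha (s *: x) * expR (f (s *: x))))
  - c * (\1_(disk : set (R * R)) (s *: x) * weight alpha (s *: x)) + weight alpha x.
  rewrite -(cV x) indicE; have [xd|xd] := pselect (disk (s *: x)).
    by rewrite mem_set//= mulr1n; ring.
  by rewrite memNset//= f0// expR0; ring.
have -> : (fun x : R * R => weight alpha x * expR (f (s *: x))) = (fun x =>
  c * (\1_(disk : set (R * R)) (s *: x) * (weight alpha (s *: x) * expR (f (s *: x))))
  - c * (\1_(disk : set (R * R)) (s *: x) * weight alpha (s *: x)) + weight alpha x).
  by apply/funext => x; exact: E.
split=> //.
rewrite (RintegralD mD L12 IV) (RintegralB mD L1 L2).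
rewrite (@RintegralZl _ _ _ _ _ _ c mD J1) (@RintegralZl _ _ _ _ _ _ c mD J2) K1 K2.
by rewrite /dilation_rate -/c; ring.
Qed.

(** Apply [e^z >= 1 + z] twice, for [z = - 2 (1 + alpha) ln s] and for
    [z = 2 ln s]. *)
Lemma dilation_rate_bound (alpha s : R) : -1 < alpha -> 1 <= s ->
  0 <= 1 - dilation_rate alpha s <= (1 + alpha) * (s ^+ 2 * (1 - s ^- 2)).
Proof.
move=> a1 s1; have s0 : 0 < s by exact: lt_le_trans s1.
have -> : dilation_rate alpha s = expR (- (2 * (1 + alpha) * ln s)).
  rewrite /dilation_rate -exprVn /powR gt_eqF//.
  rewrite -{1}(lnK s0) -expRN -expRM_natl -expRD; congr expR; ring.
have l0 : 0 <= ln s by rewrite ln_ge0.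
apply/andP; split.
  by rewrite subr_ge0 -[leRHS]expR0 ler_expR oppr_le0 !mulr_ge0//; lra.
have h1 := @expR_ge1Dx R (- (2 * (1 + alpha) * ln s)).
have h2 : 2 * ln s <= s ^+ 2 - 1.
  have := @expR_ge1Dx R (2 * ln s).
  rewrite expRM_natl lnK//; lra.
have -> : s ^+ 2 * (1 - s ^- 2) = s ^+ 2 - 1 by field; rewrite gt_eqF.
nra.
Qed.

End dilation.

(** * Inequalities for the exponential *)

Section exponential_inequalities.
Context {R : realType}.
Implicit Types a b h V eta : R.

Lemma expR_sub_le a b : expR a - expR b <= expR a * (a - b).
Proof.
have := @expR_ge1Dx R (b - a); have := expR_gt0 a.
have -> : expR b = expR a * expR (b - a) by rewrite -expRD addrC subrK.
by move: (expR a) (expR (b - a)) => p q; nra.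
Qed.

Lemma expR_lipschitz a b : `|expR a - expR b| <= (expR `|a| + expR `|b|) * `|a - b|.
Proof.
have H (p q : R) : expR p - expR q <= (expR `|p| + expR `|q|) * `|p - q|.
  apply: le_trans (expR_sub_le p q) _; apply: le_trans (ler_norm _) _.
  rewrite normrM ger0_norm ?expR_ge0// ler_wpM2r//.
  by apply: (@le_trans _ _ (expR `|p|)); [rewrite ler_expR ler_norm|rewrite lerDl expR_ge0].
rewrite ler_norml H andbT lerNl opprB.
by have := H b a; rewrite [expR `|b| + _]addrC (distrC b a).
Qed.

(** Taylor's formula; the remainder factor is at most the larger of [e^a] and
    [e^b]. *)
Lemma expR_tangent_le a b :
  expR a * (a - b) <= expR a - expR b + (expR `|a| + expR `|b|) * (a - b) ^+ 2.
Proof.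
have h1 := expR_sub_le b a; have h2 := expR_sub_le a b.
have ab (c : R) : expR c <= expR `|c| by rewrite ler_expR ler_norm.
have := ab a; have := ab b; have := expR_gt0 a; have := expR_gt0 b.
move: h1 h2; move: (expR a) (expR b) (expR `|a|) (expR `|b|) => p q P Q h1 h2 q0 p0 qQ pP.
have h3 : p * (a - b) - (p - q) <= (p + q) * (a - b) ^+ 2.
  have ba : b - a = - (a - b) by rewrite opprB.
  move: h1 h2; rewrite ba; move: (a - b) => d h1 h2.
  apply: (@le_trans _ _ ((p - q) * d)); first by nra.
  have [d0|/ltW d0] := leP 0 d.
    by apply: (@le_trans _ _ (p * d * d)); [exact: ler_wpM2r|have := sqr_ge0 d; nra].
  by apply: (@le_trans _ _ (q * d * d)); [apply: ler_wnM2r => //; nra|have := sqr_ge0 d; nra].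
have h4 : (p + q) * (a - b) ^+ 2 <= (P + Q) * (a - b) ^+ 2 by rewrite ler_wpM2r ?sqr_ge0// lerD.
by move: h3 h4; lra.
Qed.

Lemma exchange_pointwise V a b h eta : 0 <= V -> 0 < eta ->
  V * expR a * h <= V * expR b * h +
    (eta^-1 / 2 * (V * expR `|a| * (a - b) ^+ 2 + V * expR `|b| * (a - b) ^+ 2) +
     eta / 2 * (V * expR `|a| * h ^+ 2 + V * expR `|b| * h ^+ 2)).
Proof.
move=> V0 e0.
have L := expR_lipschitz a b.
have A0 : 0 <= expR `|a| + expR `|b| by rewrite addr_ge0 ?expR_ge0.
have Y : `|a - b| * `|h| <= eta^-1 / 2 * (a - b) ^+ 2 + eta / 2 * h ^+ 2.
  rewrite -[(a - b) ^+ 2]real_normK ?num_real// -[h ^+ 2]real_normK ?num_real//.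
  move: `|a - b| `|h| => x y.
  have : 0 <= (x - eta * y) ^+ 2 by exact: sqr_ge0.
  rewrite -(pmulr_rge0 _ (_ : 0 < eta^-1 / 2)); last by rewrite divr_gt0// invr_gt0.
  have -> : eta^-1 / 2 * (x - eta * y) ^+ 2 =
     eta^-1 / 2 * x ^+ 2 + eta / 2 * y ^+ 2 - x * y by field; rewrite gt_eqF.
  by rewrite subr_ge0.
have : (expR a - expR b) * h <= (expR `|a| + expR `|b|) * (eta^-1 / 2 * (a - b) ^+ 2 + eta / 2 * h ^+ 2).
  apply: le_trans (ler_norm _) _; rewrite normrM.
  apply: le_trans (ler_wpM2r (normr_ge0 h) L) _.
  by rewrite -[leLHS]mulrA; exact: ler_wpM2l.
move=> /(ler_wpM2l V0).
move: (expR a) (expR b) (expR `|a|) (expR `|b|) (eta^-1) ((a-b)^+2) => p q P Q z d.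
by rewrite -subr_ge0 => H; rewrite -subr_ge0; apply: le_trans H _; rewrite le_eqVlt; apply/orP; left; apply/eqP; field.
Qed.

End exponential_inequalities.

(** * Weighted exponentials *)

Section tame_functions.
Context {R : realType}.
Notation leb := (@lebesgue_measure R).
Notation leb2 := (leb \x leb)%E.
Notation plane := (measurableTypeR R * measurableTypeR R)%type.
Variable alpha : R.

Notation wexp psi := (fun x : R * R => weight alpha x * expR (psi x)).
Notation wnorm psi := (fun x : R * R => weight alpha x * expR `|psi x|).

(** The properties of [u], of the approximating test functions and of their
    dilations that the weighted estimates use, with common constants. *)
Record tame (m : nat) (K : R) (psi : R * R -> R) := Tame {
  tame_measurable : measurable_fun (disk : set plane) psi;
  tame_integrable : leb2.-integrable disk (EFin \o wnorm psi);
  tame_le : \int[leb2]_(x in disk) (wnorm psi x) <= K;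
  tame_sqr : forall g D N tau, moment_bound g D N -> 0 < D -> 0 <= N -> 0 < tau ->
    leb2.-integrable disk (EFin \o (fun x => wnorm psi x * g x ^+ 2)) /\
    \int[leb2]_(x in disk) (wnorm psi x * g x ^+ 2) <= K * (tau * D + tau^-1 ^+ m * N) }.

Lemma tame_exponential (m : nat) (M : R) (psi : R * R -> R) : (0 < m)%N ->
  -2 < 2 * alpha * (m.+1%:R / m%:R) ^+ 2 -> 0 <= M ->
  measurable_fun (disk : set plane) psi ->
  leb2.-integrable disk (EFin \o (fun x => expR (exponent m * `|psi x|))) ->
  \int[leb2]_(x in disk) expR (exponent m * `|psi x|) <= M ->
  tame m (weight_bound alpha m + M + pi + m.+1`!%:R ^+ 2) psi.
Proof.
move=> m0 am M0 mpsi I IM.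
have mabs : measurable_fun (disk : set plane) (fun x => `|psi x|) by exact: measurableT_comp.
have [J1 J2] := weighted_integrable m0 am mabs I IM.
have f0 : 0 <= (m.+1`!%:R : R) ^+ 2 by exact: sqr_ge0.
have w0 := @weight_bound_ge0 R alpha m; have p0 := @pi_ge0 R.
split => //; first by apply: le_trans J2 _; rewrite lerDl.
move=> g D N tau mb D0 N0 tau0.
have [L1 L2] := weighted_sqr m0 am mabs I IM mb D0 tau0.
split => //; apply: le_trans L2 _; rewrite [leRHS]mulrDr; apply: lerD.
  rewrite mulrC ler_wpM2r//; first by rewrite mulr_ge0// ltW.
  by rewrite -addrA lerDl addr_ge0.
rewrite [leRHS]mulrCA; apply: ler_wpM2l; first by rewrite exprn_ge0// invr_ge0 ltW.
by apply: ler_wpM2r => //; rewrite lerDr addr_ge0// addr_ge0.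
Qed.

Lemma integrable_wexp m K psi : tame m K psi -> leb2.-integrable disk (EFin \o wexp psi).
Proof.
move=> [mp I _ _]; apply: (integrable_dominated (@measurable_disk R) _ I).
  apply: measurable_funM; first by apply: measurable_funTS; exact: measurable_weight.
  exact: measurableT_comp.
move=> x _; rewrite ger0_norm ?mulr_ge0 ?weight_ge0 ?expR_ge0//.
by rewrite ler_wpM2l ?weight_ge0// ler_expR ler_norm.
Qed.

Lemma integrable_wexpM m K psi g D N : tame m K psi -> moment_bound g D N -> 0 < D -> 0 <= N ->
  leb2.-integrable disk (EFin \o (fun x => wexp psi x * g x)).
Proof.
move=> T mb D0 N0; have [mp I _ /(_ g D N 1 mb D0 N0 ltr01)[J _]] := T.
have mD := @measurable_disk R.
apply: (integrable_dominated mD _ (integrable_addr mD I J)).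
  apply: measurable_funM; last by case: mb.
  exact: integrable_measurable (integrable_wexp T).
move=> x _; rewrite normrM ger0_norm ?mulr_ge0 ?weight_ge0 ?expR_ge0//.
apply: (@le_trans _ _ (weight alpha x * expR `|psi x| * (1 + g x ^+ 2))); last by rewrite mulrDr mulr1.
apply: ler_pM => //; first by rewrite mulr_ge0 ?weight_ge0 ?expR_ge0.
  by rewrite ler_wpM2l ?weight_ge0// ler_expR ler_norm.
rewrite -[g x ^+ 2]real_normK ?num_real//; have := sqr_ge0 (`|g x| - 1); have := normr_ge0 (g x); nra.
Qed.

(** Integrate [exchange_pointwise]; for the intended [p] and [q] the bound [e] is
    small while [k] stays bounded, which leaves the choice of [eta]. *)
Lemma tame_exchange p q h e k eta : 0 < eta ->
  leb2.-integrable disk (EFin \o (fun x => wexp p x * h x)) ->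
  leb2.-integrable disk (EFin \o (fun x => wexp q x * h x)) ->
  leb2.-integrable disk (EFin \o (fun x => wnorm p x * (p x - q x) ^+ 2)) ->
  leb2.-integrable disk (EFin \o (fun x => wnorm q x * (p x - q x) ^+ 2)) ->
  leb2.-integrable disk (EFin \o (fun x => wnorm p x * h x ^+ 2)) ->
  leb2.-integrable disk (EFin \o (fun x => wnorm q x * h x ^+ 2)) ->
  \int[leb2]_(x in disk) (wnorm p x * (p x - q x) ^+ 2) <= e ->
  \int[leb2]_(x in disk) (wnorm q x * (p x - q x) ^+ 2) <= e ->
  \int[leb2]_(x in disk) (wnorm p x * h x ^+ 2) <= k ->
  \int[leb2]_(x in disk) (wnorm q x * h x ^+ 2) <= k ->
  \int[leb2]_(x in disk) (wexp p x * h x) <= \int[leb2]_(x in disk) (wexp q x * h x) +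
    (eta^-1 * e + eta * k).
Proof.
move=> e0 Ip Iq I1 I2 I3 I4 l1 l2 l3 l4; have mD := @measurable_disk R.
have I12 := integrable_scaler mD (eta^-1 / 2) (integrable_addr mD I1 I2).
have I34 := integrable_scaler mD (eta / 2) (integrable_addr mD I3 I4).
have I := integrable_addr mD I12 I34.
apply: (@le_trans _ _ (\int[leb2]_(x in disk) (wexp q x * h x +
    (eta^-1 / 2 * (wnorm p x * (p x - q x) ^+ 2 + wnorm q x * (p x - q x) ^+ 2) +
     eta / 2 * (wnorm p x * h x ^+ 2 + wnorm q x * h x ^+ 2))))).
  apply: (le_Rintegral mD Ip (integrable_addr mD Iq I)) => x _ /=.
  by apply: exchange_pointwise; rewrite ?weight_ge0.
rewrite (RintegralD mD Iq I) lerD2l (RintegralD mD I12 I34).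
rewrite (@RintegralZl _ _ _ _ _ _ (eta^-1 / 2) mD (integrable_addr mD I1 I2)).
rewrite (@RintegralZl _ _ _ _ _ _ (eta / 2) mD (integrable_addr mD I3 I4)).
rewrite (RintegralD mD I1 I2) (RintegralD mD I3 I4).
have i0 : 0 < eta^-1 by rewrite invr_gt0.
apply: lerD; rewrite -mulrA ler_pM2l// ler_pdivrMl//.
  by apply: le_trans (lerD l1 l2) _; rewrite mulr_natl mulr2n.
by apply: le_trans (lerD l3 l4) _; rewrite mulr_natl mulr2n.
Qed.

Variables (u : R * R -> R) (G : R * R -> R * R) (phi : nat -> R * R -> R).
Hypothesis alpha1 : -1 < alpha.
Hypothesis uG : H1 u G.
Hypothesis tphi : forall n, test_function (phi n).
Hypothesis phi_cvg : H1_sqdist u G (phi n) (grad (phi n)) @[n --> \oo] --> 0%E.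

(** For the dilated functions, compare [e^(k |phi n (s x)|)] with its part inside
    the dilated disk plus 1. *)
Lemma exists_tame : exists m K N, [/\ 0 <= K, tame m K u &
  forall n, (N <= n)%N -> tame m K (phi n) /\
    forall s, 1 <= s -> tame m K (fun x => phi n (s *: x))].
Proof.
have mD := @measurable_disk R.
have [m [m0 am]] := exists_exponent alpha1.
have [N [M [M0 [HN [Iu uM]]]]] := approx_exp_bound uG tphi phi_cvg (@exponent_ge0 R m).
have p0 := @pi_ge0 R.
have MM : M <= M + pi by rewrite lerDl.
have M1 : 0 <= M + pi by rewrite addr_ge0.
exists m, (weight_bound alpha m + (M + pi) + pi + m.+1`!%:R ^+ 2), N; split.
- by have := @weight_bound_ge0 R alpha m; have := sqr_ge0 (m.+1`!%:R : R); lra.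
- by apply: tame_exponential => //; [exact: measurable_u uG|exact: le_trans MM].
move=> n Nn; have [In nM] := HN n Nn; split.
  by apply: tame_exponential => //; [exact: measurable_phi tphi n|exact: le_trans MM].
move=> s s1; have C := disk_C1_scale s1 (test_function_disk_C1 (tphi n)).
have Cn := test_function_disk_C1 (tphi n).
have mE : measurable_fun [set: plane] (fun x => expR (exponent m * `|phi n x|)).
  apply: measurableT_comp => //; apply: measurable_funM => //; apply: measurableT_comp => //.
  exact: continuous_measurable_plane (C1_cont Cn).
have [J1 J2] := Rintegral_dilation s1 mE (fun x => expR_ge0 _) In.
have Ic : leb2.-integrable disk (EFin \o cst (1 : R)).
  by apply: (@integrable_disk_bounded _ 1) => // x _; rewrite normr1.
have ms : measurable_fun (disk : set plane) (fun x => phi n (s *: x)).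
  by apply: measurable_funTS; exact: continuous_measurable_plane (C1_cont C).
have le x : disk x -> expR (exponent m * `|phi n (s *: x)|) <=
   \1_(disk : set (R * R)) (s *: x) * expR (exponent m * `|phi n (s *: x)|) + cst 1 x.
  move=> _; rewrite indicE; have [xd|xd] := pselect (disk (s *: x)).
    by rewrite mem_set// mul1r lerDl.
  by rewrite memNset// (C1_out Cn)// normr0 mulr0 expR0 mul0r add0r.
have I : leb2.-integrable disk (EFin \o (fun x => expR (exponent m * `|phi n (s *: x)|))).
  apply: (integrable_dominated mD _ (integrable_addr mD J1 Ic)).
    exact: measurable_expR_norm.
  by move=> x dx; rewrite ger0_norm ?expR_ge0//; exact: le.
apply: tame_exponential => //.
apply: le_trans (le_Rintegral mD I (integrable_addr mD J1 Ic) le) _.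
rewrite (RintegralD mD J1 Ic) Rintegral_disk_cst mul1r lerD2r J2.
apply: le_trans nM; rewrite ler_piMl//.
  by apply: Rintegral_ge0 => x _; exact: expR_ge0.
by rewrite invf_le1 ?exprn_gt0 ?exprn_ege1//; exact: lt_le_trans s1.
Qed.

End tame_functions.

(** * Weighted integrals of dilation differences *)

Section weighted_difference.
Context {R : realType}.
Notation leb := (@lebesgue_measure R).
Notation leb2 := (leb \x leb)%E.
Variable alpha : R.
Hypothesis alpha1 : -1 < alpha.

Notation wexp psi := (fun x : R * R => weight alpha x * expR (psi x)).
Notation wnorm psi := (fun x : R * R => weight alpha x * expR `|psi x|).
Notation dilation_dirichlet f1 f2 s :=
  (dirichlet (fun x => f1 x - s * f1 (s *: x)) (fun x => f2 x - s * f2 (s *: x))).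

Lemma integrable_weight : leb2.-integrable disk (EFin \o weight alpha).
Proof. by apply: (@integrable_enorm_powR _ (2 * alpha)); have h := alpha1; lra. Qed.

Lemma approx_arith (c Ef I E0 x y z d d' eps : R) : Ef <= I + (y + z) ->
  0 <= c -> c <= 1 -> 0 <= x -> 0 <= y -> 0 <= z -> x + y <= eps / 3 -> z <= eps / 3 ->
  c * (Ef - E0) + (d + d' + x) <= c * (I - E0) + (d + d' + eps).
Proof.
move=> h c0 c1 x0 y0 z0 xy ze.
have : c * (Ef - E0) <= c * (I - E0) + c * (y + z) by rewrite -mulrDr ler_wpM2l//; lra.
have : c * (y + z) <= y + z by rewrite ler_piMl// addr_ge0.
lra.
Qed.

Lemma step_arith (m : nat) (K B tau t t' e dir q2 a b c d p q : R) :
  a <= b - (d * b + (1 - d) * c) + (p + q) ->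
  p + q <= K * (tau * (dir + q2) + t * (2 * q2 * B)) + K * (tau * (dir + q2) + t * (2 * q2 * B)) ->
  a + (t' * (2 * K * e) + tau * (K * (1 * (dir + q2) + 1^-1 ^+ m * (2 * q2 * B)))) <=
  (1 - d) * (b - c) + (3 * K * tau * dir + (3 * K * tau + 4 * K * B * t + 2 * K * B * tau) * q2 +
    t' * (2 * K * e)).
Proof. by rewrite invr1 expr1n => *; lra. Qed.

Section step.
Variables (m : nat) (K B e : R) (u f f1 f2 : R * R -> R).
Hypothesis K0 : 0 <= K.
Hypothesis Tu : tame alpha m K u.
Hypothesis Tf : tame alpha m K f.
Hypothesis C : disk_C1 f f1 f2.
Hypothesis dB : dirichlet f1 f2 <= B.
Hypothesis e0 : 0 < e.
Hypothesis mb : moment_bound (fun x => u x - f x) e e.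

Let close : [/\ leb2.-integrable disk (EFin \o (fun x => wnorm u x * (u x - f x) ^+ 2)),
  leb2.-integrable disk (EFin \o (fun x => wnorm f x * (u x - f x) ^+ 2)),
  \int[leb2]_(x in disk) (wnorm u x * (u x - f x) ^+ 2) <= 2 * K * e &
  \int[leb2]_(x in disk) (wnorm f x * (u x - f x) ^+ 2) <= 2 * K * e].
Proof.
have [I1 l1] := tame_sqr Tu mb e0 (ltW e0) ltr01.
have [I2 l2] := tame_sqr Tf mb e0 (ltW e0) ltr01.
have E : K * (1 * e + 1^-1 ^+ m * e) = 2 * K * e by rewrite invr1 expr1n; ring.
by rewrite E in l1 l2.
Qed.

Lemma integral_wexp_approx (eta : R) : 0 < eta ->
  \int[leb2]_(x in disk) (wexp f x) <=
  \int[leb2]_(x in disk) (wexp u x) + (eta^-1 * (2 * K * e) + eta * K).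
Proof.
move=> eta0; have [I1 I2 l1 l2] := close.
have If := integrable_wexp Tf; have Iu := integrable_wexp Tu.
have E1 (h : R * R -> R) : (fun x : R * R => h x * cst (1 : R) x) = h.
  by apply/funext => x; rewrite /= mulr1.
have E2 (h : R * R -> R) : (fun x : R * R => h x * (cst (1 : R) x) ^+ 2) = h.
  by apply/funext => x; rewrite /= expr1n mulr1.
have E3 (h : R * R -> R) : (fun x : R * R => h x * (f x - u x) ^+ 2) = (fun x => h x * (u x - f x) ^+ 2).
  by apply/funext => x; rewrite -sqrrN opprB.
have := @tame_exchange R alpha f u (cst 1) (2 * K * e) K eta eta0.
rewrite !E1 !E2 !E3; apply => //.
- exact: tame_integrable Tf.
- exact: tame_integrable Tu.
- exact: tame_le Tf.
- exact: tame_le Tu.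
Qed.

Variables (s tau : R).
Hypothesis s1 : 1 < s.
Hypothesis tau0 : 0 < tau.
Hypothesis Ts : tame alpha m K (fun x => f (s *: x)).

(** Exchange [e^u] for [e^f], then replace [e^f g] by the difference
    [e^f - e^(f (s x))] at the cost of a quadratic remainder; every quadratic
    term is bounded by [tame_sqr], with [integral_sqr_dilation_sub_le] for the
    square integral of [g]. *)
Lemma weighted_dilation_difference_step :
  \int[leb2]_(x in disk) (wexp u x * (f x - f (s *: x))) <=
  (1 - dilation_rate alpha s) *
    (\int[leb2]_(x in disk) (wexp f x) - \int[leb2]_(x in disk) weight alpha x) +
  (3 * K * tau * dilation_dirichlet f1 f2 s +
   (3 * K * tau + 4 * K * B * tau^-1 ^+ m + 2 * K * B * tau) * (s - 1) ^+ 2 + tau^-1 * (2 * K * e)).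
Proof.
have mD := @measurable_disk R; have [I1 I2 l1 l2] := close.
have s1' := ltW s1.
have Cg := disk_C1_sub C (disk_C1_scale s1' C).
set dir := dilation_dirichlet f1 f2 s.
pose g x := f x - f (s *: x).
have sq0 : 0 < (s - 1) ^+ 2 by rewrite exprn_gt0// subr_gt0.
have dir0 : 0 <= dir := dirichlet_ge0 _ _.
have B0 : 0 <= B := le_trans (dirichlet_ge0 _ _) dB.
pose D := dir + (s - 1) ^+ 2.
pose N := 2 * (s - 1) ^+ 2 * B.
have D0 : 0 < D by rewrite ltr_wpDl.
have N0 : 0 <= N by rewrite mulr_ge0// mulr_ge0// ltW.
have mbg : moment_bound g D N.
  apply: (disk_C1_moment_bound Cg); first by rewrite lerDl ltW.
  apply: le_trans (integral_sqr_dilation_sub_le s1' C) _.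
  by rewrite ler_wpM2l// mulr_ge0// ltW.
have [J1 L1] := tame_sqr Tu mbg D0 N0 ltr01.
have [J2 L2] := tame_sqr Tf mbg D0 N0 ltr01.
have [J3 L3] := tame_sqr Tf mbg D0 N0 tau0.
have [J4 L4] := tame_sqr Ts mbg D0 N0 tau0.
have Iug := integrable_wexpM Tu mbg D0 N0.
have Ifg := integrable_wexpM Tf mbg D0 N0.
apply: le_trans (tame_exchange tau0 Iug Ifg I1 I2 J1 J2 l1 l2 L1 L2) _.
have If := integrable_wexp Tf.
have [Is Es] := integral_weight_dilation s1' (C1_cont C) (C1_out C) integrable_weight If.
have I12 := integrable_subr mD If Is.
have I34 := integrable_addr mD J3 J4.
have step : \int[leb2]_(x in disk) (wexp f x * g x) <=
  \int[leb2]_(x in disk) (wexp f x - wexp (fun x => f (s *: x)) x +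
    (wnorm f x * g x ^+ 2 + wnorm (fun x => f (s *: x)) x * g x ^+ 2)).
  apply: (le_Rintegral mD Ifg (integrable_addr mD I12 I34)) => x _ /=.
  rewrite -mulrA; apply: le_trans (ler_wpM2l (weight_ge0 alpha x) (expR_tangent_le (f x) (f (s *: x)))) _.
  by rewrite /g le_eqVlt; apply/orP; left; apply/eqP; ring.
rewrite (RintegralD mD I12 I34) (RintegralB mD If Is) (RintegralD mD J3 J4) Es in step.
have L34 := lerD L3 L4; rewrite /D /N in L34 *.
have H := step_arith m (tau^-1) e step L34.
exact: H.
Qed.

End step.

Variables (u : R * R -> R) (G : R * R -> R * R) (phi : nat -> R * R -> R).
Hypothesis uG : H1 u G.
Hypothesis tphi : forall n, test_function (phi n).
Hypothesis phi_cvg : H1_sqdist u G (phi n) (grad (phi n)) @[n --> \oo] --> 0%E.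

Lemma L2disk_integrable (f : R * R -> R) : L2disk f ->
  leb2.-integrable disk (EFin \o (fun x => f x ^+ 2)).
Proof.
move=> [mf fin]; apply/integrableP; split; first by apply/measurable_EFinP; exact: measurable_funX.
by under eq_integral do rewrite /= ger0_norm ?sqr_ge0//.
Qed.

Lemma sqr_le_sub (a p : R) : a ^+ 2 <= 2 * (p ^+ 2 + (p - a) ^+ 2).
Proof. by have := sqr_ge0 (2 * p - a); nra. Qed.

Lemma integral_sqr2_le_sub (a a' p p' : R * R -> R) :
  leb2.-integrable disk (EFin \o (fun x => a x ^+ 2)) ->
  leb2.-integrable disk (EFin \o (fun x => a' x ^+ 2)) ->
  leb2.-integrable disk (EFin \o (fun x => p x ^+ 2)) ->
  leb2.-integrable disk (EFin \o (fun x => p' x ^+ 2)) ->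
  leb2.-integrable disk (EFin \o (fun x => (p x - a x) ^+ 2)) ->
  leb2.-integrable disk (EFin \o (fun x => (p' x - a' x) ^+ 2)) ->
  dirichlet a a' <= 2 * (\int[leb2]_(x in disk) (p x ^+ 2 + p' x ^+ 2) +
    \int[leb2]_(x in disk) ((p x - a x) ^+ 2 + (p' x - a' x) ^+ 2)).
Proof.
move=> Ia Ia' Ip Ip' Id Id'; have mD := @measurable_disk R.
have I1 := integrable_addr mD Ip Ip'; have I2 := integrable_addr mD Id Id'.
have I := integrable_addr mD I1 I2.
rewrite -(RintegralD mD I1 I2) -(@RintegralZl _ _ _ _ _ _ 2 mD I).
apply: (le_Rintegral mD (integrable_addr mD Ia Ia') (integrable_scaler mD 2 I)) => x _ /=.
by rewrite addrACA mulrDr; apply: lerD; exact: sqr_le_sub.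
Qed.

Lemma approx_dirichlet_bound : exists B N, forall n, (N <= n)%N ->
  dirichlet ('D_e1 (phi n)) ('D_e2 (phi n)) <= B.
Proof.
have [_ G1 G2 _] := uG.
have [N HN] := approx_le phi_cvg ltr01.
exists (2 * (\int[leb2]_(x in disk) ((G x).1 ^+ 2 + (G x).2 ^+ 2) + 1)), N => n Nn.
have [_ _ d1 d2 d] := H1_sqdist_bound uG (tphi n) (HN n Nn).
have [_ c1 c2 _ _ _ o1 o2] := test_function_disk_C1 (tphi n).
have I1 := integrable_disk_exprn 2 c1 o1; have I2 := integrable_disk_exprn 2 c2 o2.
apply: le_trans (integral_sqr2_le_sub I1 I2 (L2disk_integrable G1) (L2disk_integrable G2) d1 d2) _.
by rewrite ler_pM2l// lerD2l.
Qed.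

(** The constant in front of the energy can be made small uniformly in [s], while
    the other error is of second order in [s - 1]. *)
Lemma weighted_dilation_difference : exists C1, 0 <= C1 /\ forall tau, 0 < tau ->
  exists C2, 0 <= C2 /\ forall s, 1 < s -> forall eps, 0 < eps ->
  exists N, forall n, (N <= n)%N ->
  \int[leb2]_(x in disk) (wexp u x * (phi n x - phi n (s *: x))) <=
  (1 - dilation_rate alpha s) *
    (\int[leb2]_(x in disk) (wexp u x) - \int[leb2]_(x in disk) weight alpha x) +
  (tau * C1 * dilation_dirichlet ('D_e1 (phi n)) ('D_e2 (phi n)) s +
   C2 * (s - 1) ^+ 2 + eps).
Proof.
have [m [K [N0 [K0 Tu TN]]]] := exists_tame alpha1 uG tphi phi_cvg.
have [B [N1 BN]] := approx_dirichlet_bound.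
exists (3 * K); split; first by rewrite mulr_ge0.
move=> tau tau0.
pose C2 := 3 * K * tau + 4 * K * `|B| * tau^-1 ^+ m + 2 * K * `|B| * tau.
have t0 := ltW tau0.
have ti : 0 < tau^-1 by rewrite invr_gt0.
exists C2; split.
  by rewrite /C2 !addr_ge0 ?mulr_ge0 ?exprn_ge0// ltW.
move=> s s1 eps eps0.
(* [eta], then [e], split [eps] between the errors of the approximation *)
pose eta := eps / (3 * (K + 1)).
have K1 : 0 < K + 1 by rewrite ltr_wpDl.
have eta0 : 0 < eta by rewrite divr_gt0// mulr_gt0.
have etai : 0 < eta^-1 by rewrite invr_gt0.
pose e := eps / (3 * (2 * K + 1) * (tau^-1 + eta^-1)).
have K2 : 0 < 2 * K + 1 by rewrite ltr_wpDl// mulr_ge0.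
have e0 : 0 < e by rewrite divr_gt0// !mulr_gt0// addr_gt0.
have [N2 HN2] := approx_moment uG tphi phi_cvg e0.
exists (maxn N0 (maxn N1 N2)) => n; rewrite !geq_max => /and3P[n0 n1 n2].
have [Tn Tns] := TN n n0; have [_ mb _] := HN2 n n2.
have Cn := test_function_disk_C1 (tphi n).
have dB := le_trans (BN n n1) (ler_norm B).
have H1 := weighted_dilation_difference_step Tu Tn Cn dB e0 mb s1 tau0 (Tns s (ltW s1)).
have H2 := integral_wexp_approx Tu Tn e0 mb eta0.
have /andP[r0 _] := dilation_rate_bound alpha1 (ltW s1).
have r1 : 1 - dilation_rate alpha s <= 1 by rewrite gerBl mulr_ge0 ?powR_ge0// invr_ge0 sqr_ge0.
have eE1 : eta * K <= eps / 3.
  rewrite /eta -mulrA ler_pM2l// invfM -mulrA ler_piMr// ler_pdivrMl// mulr1 lerDl//.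
have eE2 : (tau^-1 + eta^-1) * (2 * K * e) <= eps / 3.
  have E (w k : R) : w != 0 -> 2 * k + 1 != 0 ->
      w * (2 * k * (eps / (3 * (2 * k + 1) * w))) = eps / 3 * (2 * k / (2 * k + 1)).
    by move=> *; field; apply/andP; split.
  rewrite E ?gt_eqF// ?addr_gt0//.
  by rewrite ler_piMr ?divr_ge0 ?(ltW eps0)// ler_pdivrMr// mul1r lerDl.
apply: le_trans H1 _; rewrite -/C2 (_ : tau * (3 * K) = 3 * K * tau); last by ring.
have Ke : 0 <= 2 * K * e by apply: mulr_ge0; [exact: mulr_ge0|exact: ltW].
have x0 := mulr_ge0 (ltW ti) Ke.
have y0 := mulr_ge0 (ltW etai) Ke.
have z0 : 0 <= eta * K by rewrite mulr_ge0// ltW.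
rewrite mulrDl in eE2.
exact: (approx_arith _ _ _ H2 r0 r1 x0 y0 z0 eE2 eE1).
Qed.

End weighted_difference.

(** * The quadratic form of the system *)

Section toda_energy.
Context {R : realType}.

(** The quadratic form of the inverse of the matrix [(2, -1; -1, 2)]. *)
Definition toda_form (a b : R) : R := 2 / 3 * (a ^+ 2 + a * b + b ^+ 2).

Lemma toda_form_ge0 a b : 0 <= toda_form a b.
Proof. by rewrite /toda_form; have := sqr_ge0 (a + b); have := sqr_ge0 a; have := sqr_ge0 b; nra. Qed.

Lemma toda_form_coercive a b : a ^+ 2 + b ^+ 2 <= 3 * toda_form a b.
Proof. by rewrite /toda_form; have := sqr_ge0 (a + b); nra. Qed.

Lemma toda_form_scale (s a b : R) : toda_form (s * a) (s * b) = s ^+ 2 * toda_form a b.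
Proof. by rewrite /toda_form; ring. Qed.

Lemma young2 (tau x y : R) : 0 < tau -> - (x * y) <= tau^-1 / 2 * x ^+ 2 + tau / 2 * y ^+ 2.
Proof.
move=> t0; have h : 0 <= tau^-1 / 2 * (x + tau * y) ^+ 2 by rewrite mulr_ge0 ?sqr_ge0// divr_ge0// invr_ge0 ltW.
have E : tau^-1 / 2 * (x + tau * y) ^+ 2 = tau^-1 / 2 * x ^+ 2 + tau / 2 * y ^+ 2 + x * y.
  by field; rewrite gt_eqF.
lra.
Qed.

(** Polarization: when [g1 = f] and [g2 = h], the right-hand side is half of the
    form at the difference plus half of the difference of the forms. *)
Lemma pairing_pointwise (tau g1 g2 f h F H : R) : 0 < tau ->
  (2^-1 - 3 / 2 * tau) * toda_form (f - F) (h - H)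
  + 2^-1 * (toda_form f h - toda_form F H)
  - tau^-1 / 2 * ((g1 - f) ^+ 2 + (g2 - h) ^+ 2) <=
  (2 * g1 + g2) / 3 * (f - F) + (g1 + 2 * g2) / 3 * (h - H).
Proof.
move=> t0.
have y1 := young2 ((2 * (g1 - f) + (g2 - h)) / 3) (f - F) t0.
have y2 := young2 (((g1 - f) + 2 * (g2 - h)) / 3) (h - H) t0.
have c := toda_form_coercive (f - F) (h - H).
have t2 : 0 < tau / 2 by rewrite divr_gt0.
have ti : 0 < tau^-1 / 2 by rewrite divr_gt0// invr_gt0.
have {}c : tau / 2 * ((f - F) ^+ 2 + (h - H) ^+ 2) <= tau / 2 * (3 * toda_form (f - F) (h - H)).
  by rewrite ler_pM2l.
have d : ((2 * (g1 - f) + (g2 - h)) / 3) ^+ 2 + (((g1 - f) + 2 * (g2 - h)) / 3) ^+ 2 <=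
   (g1 - f) ^+ 2 + (g2 - h) ^+ 2.
  by have := sqr_ge0 ((g1 - f) - (g2 - h)); nra.
have {}d : tau^-1 / 2 * (((2 * (g1 - f) + (g2 - h)) / 3) ^+ 2 + (((g1 - f) + 2 * (g2 - h)) / 3) ^+ 2) <=
   tau^-1 / 2 * ((g1 - f) ^+ 2 + (g2 - h) ^+ 2) by rewrite ler_pM2l.
have E : 2^-1 * toda_form (f - F) (h - H) + 2^-1 * (toda_form f h - toda_form F H) =
  (2 * f + h) / 3 * (f - F) + (f + 2 * h) / 3 * (h - H) by rewrite /toda_form; field.
have E2 : (2 * g1 + g2) / 3 * (f - F) + (g1 + 2 * g2) / 3 * (h - H) =
  (2 * f + h) / 3 * (f - F) + (f + 2 * h) / 3 * (h - H) +
  ((2 * (g1 - f) + (g2 - h)) / 3 * (f - F) + ((g1 - f) + 2 * (g2 - h)) / 3 * (h - H)) by field.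
rewrite E2 -E; move: y1 y2 c d; clear.
move: ((2 * (g1 - f) + (g2 - h)) / 3) (((g1 - f) + 2 * (g2 - h)) / 3) (toda_form (f - F) (h - H))
  (toda_form f h) (toda_form F H) (f - F) (h - H) ((g1 - f) ^+ 2 + (g2 - h) ^+ 2) => a b c d e m n p.
lra.
Qed.

(** Complete the square at [((2 c1 - c2) X, (2 c2 - c1) X)]. *)
Lemma flux_pointwise (eta c1 c2 g1 g2 f h F H X : R) : 0 < eta -> F * X = 0 -> H * X = 0 ->
  2 * ((c1 * g1 + c2 * g2) * X) - 2 * (c1 ^+ 2 - c1 * c2 + c2 ^+ 2) * X ^+ 2
  - (eta^-1 * ((g1 - f) ^+ 2 + (g2 - h) ^+ 2) + eta * (c1 ^+ 2 + c2 ^+ 2) * X ^+ 2) <=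
  toda_form (f - F) (h - H).
Proof.
move=> e0 FX HX.
have y1 := young2 (- (g1 - f)) (c1 * X) e0.
have y2 := young2 (- (g2 - h)) (c2 * X) e0.
have Q := toda_form_ge0 (f - F - (2 * c1 - c2) * X) (h - H - (2 * c2 - c1) * X).
have E : toda_form (f - F - (2 * c1 - c2) * X) (h - H - (2 * c2 - c1) * X) =
  toda_form (f - F) (h - H) - 2 * ((c1 * f + c2 * h) * X) + 2 * (c1 * (F * X) + c2 * (H * X))
   + 2 * (c1 ^+ 2 - c1 * c2 + c2 ^+ 2) * X ^+ 2 by rewrite /toda_form; field.
rewrite E FX HX !mulr0 addr0 mulr0 addr0 in Q.
move: y1 y2 Q; rewrite !sqrrN !exprMn !mulNr !opprK.
move: (toda_form (f - F) (h - H)) (eta^-1) => q e; clear.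
lra.
Qed.

End toda_energy.

(** * Integrated forms of the energy inequalities *)

Section energy_integrals.
Context {R : realType}.
Notation leb := (@lebesgue_measure R).
Notation leb2 := (leb \x leb)%E.
Notation plane := (measurableTypeR R * measurableTypeR R)%type.
Implicit Types f g a b X : R * R -> R.

Definition sqr_integrable f := measurable_fun (disk : set plane) f /\
  leb2.-integrable disk (EFin \o (fun x => f x ^+ 2)).

Notation pairing f g := (\int[leb2]_(x in disk) (f x * g x)).

Lemma sqr_integrable_mul f g : sqr_integrable f -> sqr_integrable g ->
  leb2.-integrable disk (EFin \o (fun x => f x * g x)).
Proof. by move=> [mf If] [mg Ig]; exact: (integrable_sqr_mul (@measurable_disk R) mf mg If Ig). Qed.

Lemma sqr_integrable_scale (k : R) f : sqr_integrable f -> sqr_integrable (fun x => k * f x).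
Proof.
move=> [mf If]; split; first exact: measurable_funM.
have -> : (fun x => (k * f x) ^+ 2) = (fun x => k ^+ 2 * f x ^+ 2).
  by apply/funext => x; rewrite exprMn.
exact: (integrable_scaler (@measurable_disk R) (k ^+ 2) If).
Qed.

Lemma sqr_integrable_sub f g : sqr_integrable f -> sqr_integrable g ->
  sqr_integrable (fun x => f x - g x).
Proof.
move=> [mf If] [mg Ig]; have mD := @measurable_disk R; split; first exact: measurable_funB.
apply: (integrable_dominated mD _ (integrable_scaler mD 2 (integrable_addr mD If Ig))).
  by apply: measurable_funX; exact: measurable_funB.
move=> x _; rewrite ger0_norm ?sqr_ge0//.
by have := sqr_ge0 (f x + g x); nra.
Qed.

Lemma sqr_integrable_continuous f : continuous f -> (forall x, ~ disk x -> f x = 0) ->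
  sqr_integrable f.
Proof.
move=> cf f0; split; last exact: integrable_disk_exprn.
by apply: measurable_funTS; exact: continuous_measurable_plane.
Qed.

Lemma sqr_integrable_L2disk f : L2disk f -> sqr_integrable f.
Proof. by move=> L; split; [case: L|exact: L2disk_integrable]. Qed.

Lemma integrable_toda_form f g : sqr_integrable f -> sqr_integrable g ->
  leb2.-integrable disk (EFin \o (fun x => toda_form (f x) (g x))).
Proof.
move=> sf sg; have mD := @measurable_disk R.
apply: (integrable_scaler mD); apply: (integrable_addr mD); last exact: sg.2.
by apply: (integrable_addr mD); [exact: sf.2|exact: sqr_integrable_mul].
Qed.

Lemma integral_comb (h1 h2 : R * R -> R) (c1 c2 : R) :
  leb2.-integrable disk (EFin \o h1) -> leb2.-integrable disk (EFin \o h2) ->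
  leb2.-integrable disk (EFin \o (fun x => c1 * h1 x + c2 * h2 x)) /\
  \int[leb2]_(x in disk) (c1 * h1 x + c2 * h2 x) =
    c1 * \int[leb2]_(x in disk) h1 x + c2 * \int[leb2]_(x in disk) h2 x.
Proof.
move=> I1 I2; have mD := @measurable_disk R.
have J1 := integrable_scaler mD c1 I1; have J2 := integrable_scaler mD c2 I2.
split; first exact: integrable_addr.
by rewrite (RintegralD mD J1 J2) (@RintegralZl _ _ _ _ _ _ c1 mD I1) (@RintegralZl _ _ _ _ _ _ c2 mD I2).
Qed.

Definition dilation_difference (s : R) a (x : R * R) : R := a x - s * a (s *: x).

Section one_component.
Variables (g1 g2 a b X : R * R -> R) (s : R).
Hypothesis sg1 : sqr_integrable g1.
Hypothesis sg2 : sqr_integrable g2.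
Hypothesis ca : continuous a.
Hypothesis cb : continuous b.
Hypothesis a0 : forall x, ~ disk x -> a x = 0.
Hypothesis b0 : forall x, ~ disk x -> b x = 0.
Hypothesis s1 : 1 <= s.

Notation As := (fun x : R * R => s * a (s *: x)).
Notation Bs := (fun x : R * R => s * b (s *: x)).
Notation Da := (dilation_difference s a).
Notation Db := (dilation_difference s b).

Let sq_scaled c : continuous c -> (forall x, ~ disk x -> c x = 0) ->
  sqr_integrable (fun x : R * R => s * c (s *: x)).
Proof.
move=> cc c0; apply: sqr_integrable_scale; apply: sqr_integrable_continuous.
  exact: continuous_comp_scale.
by move=> x dx; apply: c0; exact: not_disk_scale.
Qed.

Let sa := sqr_integrable_continuous ca a0.
Let sb := sqr_integrable_continuous cb b0.
Let sA := sq_scaled ca a0.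
Let sB := sq_scaled cb b0.
Let sDa : sqr_integrable Da := sqr_integrable_sub sa sA.
Let sDb : sqr_integrable Db := sqr_integrable_sub sb sB.

(** Conformal invariance: the factor [s ^+ 2] of the form cancels the Jacobian. *)
Lemma toda_form_dilation :
  \int[leb2]_(x in disk) toda_form (As x) (Bs x) = \int[leb2]_(x in disk) toda_form (a x) (b x).
Proof.
have mD := @measurable_disk R; have s0 : 0 < s by exact: lt_le_trans s1.
have mT : measurable_fun [set: plane] (fun x => toda_form (a x) (b x)).
  have ma := continuous_measurable_plane ca; have mb := continuous_measurable_plane cb.
  apply: measurable_funM => //; apply: measurable_funD; last exact: measurable_funX.
  by apply: measurable_funD; [exact: measurable_funX|exact: measurable_funM].
have [I E] := Rintegral_dilation s1 mT (fun x => toda_form_ge0 _ _) (integrable_toda_form sa sb).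
transitivity (s ^+ 2 * (s ^- 2 * \int[leb2]_(x in disk) toda_form (a x) (b x))); last first.
  by rewrite mulVKf// expf_neq0// gt_eqF.
rewrite -E -(@RintegralZl _ _ _ _ _ _ (s ^+ 2) mD I).
apply: eq_Rintegral => x _; rewrite toda_form_scale indicE.
have [xd|xd] := pselect (disk (s *: x)); first by rewrite mem_set// mul1r.
by rewrite memNset// a0// b0// mul0r /toda_form expr0n /= mul0r !addr0 mulr0.
Qed.

Lemma pairing_lower_bound (tau : R) : 0 < tau ->
  (2^-1 - 3 / 2 * tau) * \int[leb2]_(x in disk) toda_form (Da x) (Db x)
  - tau^-1 / 2 * \int[leb2]_(x in disk) ((g1 x - a x) ^+ 2 + (g2 x - b x) ^+ 2) <=
  (2 / 3 * pairing g1 Da + 1 / 3 * pairing g2 Da) + (1 / 3 * pairing g1 Db + 2 / 3 * pairing g2 Db).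
Proof.
move=> tau0; have mD := @measurable_disk R.
have I1 := integrable_toda_form sDa sDb.
have I2 := integrable_toda_form sa sb.
have I3 := integrable_toda_form sA sB.
have I4 := integrable_addr mD (sqr_integrable_sub sg1 sa).2 (sqr_integrable_sub sg2 sb).2.
have [J1 E1] := integral_comb 1 (- 1) I2 I3.
have [J2 E2] := integral_comb (2^-1 - 3 / 2 * tau) 2^-1 I1 J1.
have [J3 E3] := integral_comb 1 (- (tau^-1 / 2)) J2 I4.
have [K1 F1] := integral_comb (2 / 3) (1 / 3) (sqr_integrable_mul sg1 sDa) (sqr_integrable_mul sg2 sDa).
have [K2 F2] := integral_comb (1 / 3) (2 / 3) (sqr_integrable_mul sg1 sDb) (sqr_integrable_mul sg2 sDb).
have [K3 F3] := integral_comb 1 1 K1 K2.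
have := le_Rintegral mD J3 K3.
rewrite E3 F3 F1 F2 E2 E1 toda_form_dilation !mul1r !mulN1r subrr mulr0 addr0 mulNr.
apply => x _ /=; have := pairing_pointwise (g1 x) (g2 x) (a x) (b x) (As x) (Bs x) tau0.
rewrite /dilation_difference.
move: (g1 x) (g2 x) (a x) (b x) (s * a (s *: x)) (s * b (s *: x)) => *; lra.
Qed.

Lemma flux_lower_bound (eta c1 c2 : R) : 0 < eta -> sqr_integrable X ->
  (forall x, a (s *: x) * X x = 0) -> (forall x, b (s *: x) * X x = 0) ->
  2 * (c1 * pairing g1 X + c2 * pairing g2 X)
  - 2 * (c1 ^+ 2 - c1 * c2 + c2 ^+ 2) * \int[leb2]_(x in disk) (X x ^+ 2)
  - (eta^-1 * \int[leb2]_(x in disk) ((g1 x - a x) ^+ 2 + (g2 x - b x) ^+ 2) +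
     eta * (c1 ^+ 2 + c2 ^+ 2) * \int[leb2]_(x in disk) (X x ^+ 2)) <=
  \int[leb2]_(x in disk) toda_form (Da x) (Db x).
Proof.
move=> eta0 sX aX bX; have mD := @measurable_disk R.
have I1 := integrable_toda_form sDa sDb.
have I4 := integrable_addr mD (sqr_integrable_sub sg1 sa).2 (sqr_integrable_sub sg2 sb).2.
have [J1 E1] := integral_comb c1 c2 (sqr_integrable_mul sg1 sX) (sqr_integrable_mul sg2 sX).
have [J2 E2] := integral_comb 2 (- (2 * (c1 ^+ 2 - c1 * c2 + c2 ^+ 2))) J1 sX.2.
have [J3 E3] := integral_comb eta^-1 (eta * (c1 ^+ 2 + c2 ^+ 2)) I4 sX.2.
have [J4 E4] := integral_comb 1 (- 1) J2 J3.
have := le_Rintegral mD J4 I1.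
rewrite E4 E3 E2 E1 mul1r mulN1r (mulNr (2 * _)).
apply => x _ /=.
have FX : As x * X x = 0 by rewrite -mulrA aX mulr0.
have HX : Bs x * X x = 0 by rewrite -mulrA bX mulr0.
have := flux_pointwise c1 c2 (g1 x) (g2 x) (a x) (b x) eta0 FX HX.
by apply: le_trans; rewrite le_eqVlt; apply/orP; left; apply/eqP; ring.
Qed.

Lemma dilation_sqr_le_toda_form :
  \int[leb2]_(x in disk) (Da x ^+ 2) + \int[leb2]_(x in disk) (Db x ^+ 2) <=
  3 * \int[leb2]_(x in disk) toda_form (Da x) (Db x).
Proof.
have mD := @measurable_disk R; have I := integrable_toda_form sDa sDb.
rewrite -(RintegralD mD sDa.2 sDb.2) -(@RintegralZl _ _ _ _ _ _ 3 mD I).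
apply: (le_Rintegral mD (integrable_addr mD sDa.2 sDb.2) (integrable_scaler mD 3 I)) => x _.
exact: toda_form_coercive.
Qed.

End one_component.

End energy_integrals.

(** * Normalized densities *)

Section positivity.
Context {R : realType}.
Notation leb := (@lebesgue_measure R).
Notation leb2 := (leb \x leb)%E.
Notation plane := (measurableTypeR R * measurableTypeR R)%type.
Implicit Types f g : R * R -> R.

Lemma Rintegral_disk_gt0 f : leb2.-integrable disk (EFin \o f) ->
  (forall x, disk x -> 0 <= f x) -> (forall x, disk x -> x <> (0, 0) -> 0 < f x) ->
  0 < \int[leb2]_(x in disk) f x.
Proof.
move=> If f0 fp; have mD := @measurable_disk R.
rewrite lt_neqAle (Rintegral_ge0 leb2 f0) andbT; apply/eqP => /esym int0.
have /(ae_eq_integral_abs leb2 mD (integrableP _ _ _ If).1) [N [mN N0 sN]] :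
    (\int[leb2]_(x in disk) `|(EFin \o f) x| = 0)%E.
  rewrite -(_ : \int[leb2]_(x in disk) (f x)%:E = 0)%E; last by rewrite (Rintegral_EFin mD If) int0.
  by apply: eq_integral => x /set_mem xd; rewrite /= ger0_norm//; exact: f0.
have z0 : leb2 [set (0, 0)] = 0%E.
  have -> : [set ((0 : R), (0 : R))] = [set (0 : R)] `*` [set (0 : R)].
    by apply/seteqP; split=> [[x y] [-> ->]//|[x y] [/= -> ->]].
  transitivity (leb [set 0%R] * leb [set 0%R])%E; first exact: product_measure1E.
  by rewrite lebesgue_measure_set1 mule0.
have mz : measurable ([set (0, 0)] : set plane).
  have -> : [set ((0 : R), (0 : R))] = [set (0 : R)] `*` [set (0 : R)].
    by apply/seteqP; split=> [[x y] [-> ->]//|[x y] [/= -> ->]].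
  exact: measurableX.
have : leb2.-negligible disk.
  exists (N `|` [set (0, 0)]); split.
  - exact: measurableU.
  - apply/eqP; rewrite eq_le measure_ge0 andbT.
    apply: (@le_trans _ _ (leb2 N + leb2 [set (0%R, 0%R)])%E); first exact: (measureU2 _ mN mz).
    by rewrite N0 z0 adde0.
  - move=> x dx; have [->|x0] := pselect (x = (0, 0)); first by right.
    left; apply: sN => /= /(_ dx) [fx].
    by have := fp x dx x0; rewrite fx ltxx.
move=> /(measure_negligible mD) h.
have : (pi%:E : \bar R) = 0%E by rewrite -(@area_disk R); exact: h.
by move=> [] /eqP; rewrite gt_eqF// pi_gt0.
Qed.

Lemma weight_gt0 alpha (x : R * R) : x <> (0, 0) -> 0 < weight alpha x.
Proof.
move=> x0; apply: powR_gt0; rewrite /enorm sqrtr_gt0.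
rewrite lt_neqAle addr_ge0 ?sqr_ge0// andbT eq_sym; apply/eqP => h.
apply: x0; case: x h => a b /= h.
have a2 := sqr_ge0 a; have b2 := sqr_ge0 b.
have /eqP : a ^+ 2 = 0 by lra.
have /eqP : b ^+ 2 = 0 by lra.
by rewrite !sqrf_eq0 => /eqP -> /eqP ->.
Qed.

Lemma integral_weight_gt0 alpha : -1 < alpha -> 0 < \int[leb2]_(x in disk) weight alpha x.
Proof.
move=> a1; apply: Rintegral_disk_gt0; first exact: integrable_weight.
- by move=> x _; exact: weight_ge0.
- by move=> x _; exact: weight_gt0.
Qed.

Section normalization.
Variables (alpha : R) (u : R * R -> R).
Hypothesis Iu : leb2.-integrable disk (EFin \o (fun x => weight alpha x * expR (u x))).

Lemma integral_wexp_gt0 : 0 < \int[leb2]_(x in disk) (weight alpha x * expR (u x)).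
Proof.
apply: Rintegral_disk_gt0 => // x dx; first by rewrite mulr_ge0 ?weight_ge0 ?expR_ge0.
by move=> x0; rewrite mulr_gt0 ?weight_gt0 ?expR_gt0.
Qed.

Lemma normalized_expE x : normalized_exp alpha u x =
  (\int[leb2]_(y in disk) (weight alpha y * expR (u y)))^-1 * (weight alpha x * expR (u x)).
Proof. by rewrite /normalized_exp mulrC. Qed.

Lemma normalized_exp_ge0 x : 0 <= normalized_exp alpha u x.
Proof. by rewrite normalized_expE !mulr_ge0 ?weight_ge0 ?expR_ge0// invr_ge0 ltW// integral_wexp_gt0. Qed.

Lemma integrable_normalized_exp : leb2.-integrable disk (EFin \o normalized_exp alpha u).
Proof.
rewrite (_ : normalized_exp alpha u = fun x => (\int[leb2]_(y in disk) (weight alpha y * expR (u y)))^-1 *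
   (weight alpha x * expR (u x))); first exact: (integrable_scaler (@measurable_disk R) _ Iu).
by apply/funext => x; exact: normalized_expE.
Qed.

Lemma integral_normalized_exp : \int[leb2]_(x in disk) normalized_exp alpha u x = 1.
Proof.
under eq_Rintegral do rewrite normalized_expE.
by rewrite (RintegralZl _ _ Iu) ?mulVf ?gt_eqF ?integral_wexp_gt0//; exact: measurable_disk.
Qed.

Lemma integrable_normalized_expM (M : R) f : measurable_fun (disk : set plane) f ->
  (forall x, disk x -> `|f x| <= M) ->
  leb2.-integrable disk (EFin \o (fun x => normalized_exp alpha u x * f x)).
Proof.
move=> mf fM; have mD := @measurable_disk R; have I := integrable_normalized_exp.
apply: (integrable_dominated mD _ (integrable_scaler mD M I)).
  by apply: measurable_funM => //; exact: integrable_measurable I.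
move=> x dx; rewrite normrM ger0_norm ?normalized_exp_ge0// mulrC.
by rewrite ler_wpM2r ?normalized_exp_ge0//; exact: fM.
Qed.

Lemma integrable_normalized_exp_test f : test_function f ->
  leb2.-integrable disk (EFin \o (fun x => normalized_exp alpha u x * f x)).
Proof.
move=> /test_function_disk_C1 C; have [M [_ fM]] := continuous_disk_bounded (C1_cont C) (C1_out C).
apply: (@integrable_normalized_expM M) => //.
by apply: measurable_funTS; exact: continuous_measurable_plane (C1_cont C).
Qed.

(** Fatou's lemma along the disks of radius [1 - 1 / (k + 2)]. *)
Lemma mass_exhaustion (eta : R) : 0 < eta -> exists t0, 0 < t0 < 1 /\
  forall t xi, t0 <= t -> (forall x, 0 <= xi x) -> (forall x, enorm x <= t -> xi x = 1) ->
  leb2.-integrable disk (EFin \o (fun x => normalized_exp alpha u x * xi x)) ->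
  1 - eta <= \int[leb2]_(x in disk) (normalized_exp alpha u x * xi x).
Proof.
move=> eta0; have mD := @measurable_disk R.
pose t_ (k : nat) : R := 1 - k.+2%:R^-1.
pose h k (x : R * R) : R := \1_[set y | enorm y <= t_ k] x.
have mh k : measurable_fun (disk : set plane) (h k).
  apply: measurable_funTS; apply: measurable_indic.
  have -> : [set y : R * R | enorm y <= t_ k] = setT `&` (enorm @^-1` [set r | r <= t_ k]).
    by apply/seteqP; split=> [y|y []].
  apply: (continuous_measurable_plane continuous_enorm) => //.
  have -> : [set r | r <= t_ k] = `]-oo, t_ k]%classic by apply/seteqP; split => r; rewrite /= in_itv.
  exact: measurable_itv.
have h01 k x : 0 <= h k x <= 1 by rewrite /h indicE; case: (_ \in _); rewrite ?lexx ?ler01.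
have Ih k : leb2.-integrable disk (EFin \o (fun x => normalized_exp alpha u x * h k x)).
  by apply: (@integrable_normalized_expM 1) => // x _; have /andP[? ?] := h01 k x; rewrite ger0_norm.
have [k hk] : exists k, 1 - eta <= \int[leb2]_(x in disk) (normalized_exp alpha u x * h k x).
  apply: contrapT => /forallNP H.
  pose c := 1 - eta; rewrite -/c in H.
  suff : (1%:E <= c%:E)%E by rewrite lee_fin /c; lra.
  rewrite -integral_normalized_exp -(Rintegral_EFin mD integrable_normalized_exp).
  apply: (@fatou_le _ _ _ leb2 _ mD (fun k x => normalized_exp alpha u x * h k x)).
  - by move=> k; exact: integrable_measurable (Ih k).
  - exact: integrable_measurable integrable_normalized_exp.
  - by move=> k x _; rewrite mulr_ge0 ?normalized_exp_ge0//; case/andP: (h01 k x).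
  - by move=> x _; exact: normalized_exp_ge0.
  - apply: aeW => x dx; rewrite -[X in _ --> X]mulr1; apply: cvgM; first exact: cvg_cst.
    have dx' : 0 < 1 - enorm x by rewrite subr_gt0.
    apply: cvg_near_cst; near=> k; rewrite /h indicE mem_set//=.
    rewrite /t_ lerBrDr -lerBrDl; apply: (@le_trans _ _ k.+1%:R^-1).
      by rewrite lef_pV2 ?posrE// ler_nat.
    by apply: ltW; near: k; exact: (near_infty_natSinv_lt (PosNum dx')).
  - move=> k; rewrite (Rintegral_EFin mD (Ih k)) lee_fin ltW// ltNge; apply/negP; exact: H.
exists (t_ k); split.
  rewrite /t_ subr_gt0 invf_lt1// ltr1n/= ltrBlDr ltrDl invr_gt0//.
move=> t xi tt xi0 xi1 Ixi; apply: le_trans hk _.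
apply: (le_Rintegral mD (Ih k) Ixi) => x _; rewrite ler_wpM2l ?normalized_exp_ge0//.
rewrite /h indicE; have [xt|xt] := pselect (enorm x <= t_ k).
  by rewrite mem_set//= xi1//; exact: le_trans tt.
by rewrite memNset.
Unshelve. all: by end_near.
Qed.

End normalization.

End positivity.

(** * The energy balance *)

Section balance_of_energy.
Context {R : realType}.
Notation leb := (@lebesgue_measure R).
Notation leb2 := (leb \x leb)%E.
Implicit Types (psi : R * R -> R) (G : R * R -> R * R).
Notation pairing f g := (\int[leb2]_(x in disk) (f x * g x)).
Notation dirichlet_pairing G psi := (\int[leb2]_(x in disk) dot (G x) (grad psi x)).

Lemma dirichlet_pairingE G (a b : R * R -> R) psi : sqr_integrable (fun x => (G x).1) -> sqr_integrable (fun x => (G x).2) ->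
  test_function psi ->
  (forall x : R * R, 'D_e1 psi x = a x) -> (forall x : R * R, 'D_e2 psi x = b x) ->
  dirichlet_pairing G psi = pairing (fun x => (G x).1) a + pairing (fun x => (G x).2) b.
Proof.
move=> s1 s2 tpsi E1 E2; have mD := @measurable_disk R.
have [_ c1 c2 _ _ _ o1 o2] := test_function_disk_C1 tpsi.
have F1 : a = 'D_e1 psi by apply/funext => x.
have F2 : b = 'D_e2 psi by apply/funext => x.
rewrite F1 F2; rewrite -(RintegralD mD) //.
- exact: (sqr_integrable_mul s1 (sqr_integrable_continuous c1 o1)).
- exact: (sqr_integrable_mul s2 (sqr_integrable_continuous c2 o2)).
Qed.

Lemma integral_sum_exchange (p q p' q' : R * R -> R) (e : R) :
  leb2.-integrable disk (EFin \o p) -> leb2.-integrable disk (EFin \o q) ->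
  leb2.-integrable disk (EFin \o p') -> leb2.-integrable disk (EFin \o q') ->
  \int[leb2]_(x in disk) (p x + q x) <= e / 2 -> \int[leb2]_(x in disk) (p' x + q' x) <= e / 2 ->
  \int[leb2]_(x in disk) (p x + p' x) + \int[leb2]_(x in disk) (q x + q' x) <= e.
Proof.
move=> I1 J1 I2 J2; have mD := @measurable_disk R.
rewrite (RintegralD mD I1 J1) (RintegralD mD I2 J2) (RintegralD mD I1 I2) (RintegralD mD J1 J2).
by rewrite addrACA [X in _ -> _ -> _ <= X]splitr; exact: lerD.
Qed.

Lemma mass_arith (m1 m2 p1 p2 p3 p4 q1 q2 q3 q4 x1 x2 x3 x4 y1 y2 y3 y4 : R) :
  p1 + p2 = 2 * m1 * x1 - m2 * x3 - (2 * m1 * y1 - m2 * y3) ->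
  p3 + p4 = 2 * m1 * x2 - m2 * x4 - (2 * m1 * y2 - m2 * y4) ->
  q1 + q2 = 2 * m2 * x3 - m1 * x1 - (2 * m2 * y3 - m1 * y1) ->
  q3 + q4 = 2 * m2 * x4 - m1 * x2 - (2 * m2 * y4 - m1 * y2) ->
  2 / 3 * p1 + 1 / 3 * q1 + (1 / 3 * p3 + 2 / 3 * q3) +
  (2 / 3 * p2 + 1 / 3 * q2 + (1 / 3 * p4 + 2 / 3 * q4)) = m1 * (x1 - y1) + m2 * (x4 - y4).
Proof. by move=> *; lra. Qed.

Lemma flux_arith (c1 c2 k a b p1 p2 q1 q2 x y z w : R) :
  2 * (c1 * (p1 + p2) + c2 * (q1 + q2)) - k * (x + y) - (a * (z + w) + b * (x + y)) =
  2 * (c1 * p1 + c2 * q1) - k * x - (a * z + b * x) + (2 * (c1 * p2 + c2 * q2) - k * y - (a * w + b * y)).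
Proof. by ring. Qed.

Lemma integrable_mul_C1 (w g g1 g2 : R * R -> R) : leb2.-integrable disk (EFin \o w) ->
  disk_C1 g g1 g2 -> leb2.-integrable disk (EFin \o (fun x => w x * g x)).
Proof.
move=> I Cg; have mD := @measurable_disk R.
have [M [M0 gM]] := continuous_disk_bounded (C1_cont Cg) (C1_out Cg).
have Iabs : leb2.-integrable disk (EFin \o (fun x => `|w x|)) by exact: integrable_abse I.
apply: (integrable_dominated mD _ (integrable_scaler mD M Iabs)).
  apply: measurable_funM; first exact: integrable_measurable I.
  by apply: measurable_funTS; exact: continuous_measurable_plane (C1_cont Cg).
by move=> x _; rewrite normrM mulrC ler_wpM2r.
Qed.

Lemma pairing_dilation_difference (g a : R * R -> R) (s : R) : 1 <= s -> sqr_integrable g ->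
  continuous a -> (forall x, ~ disk x -> a x = 0) ->
  pairing g (dilation_difference s a) = pairing g a - pairing g (fun x => s * a (s *: x)).
Proof.
move=> s1 sg ca a0; have mD := @measurable_disk R.
have sA : sqr_integrable (fun x : R * R => s * a (s *: x)).
  apply: sqr_integrable_scale; apply: sqr_integrable_continuous.
    exact: continuous_comp_scale.
  by move=> x dx; apply: a0; exact: not_disk_scale.
rewrite -(RintegralB mD (sqr_integrable_mul sg (sqr_integrable_continuous ca a0)) (sqr_integrable_mul sg sA)).
by apply: eq_Rintegral => x _; rewrite /dilation_difference mulrBr.
Qed.

Lemma add_sub_arith (p q a b c d x y : R) : p = a - b -> q = c - d -> x = a + c -> y = b + d ->
  p + q = x - y.
Proof. by move=> -> -> -> ->; rewrite opprD addrACA. Qed.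

Lemma derive_dilation psi (s : R) (x : R * R) : test_function psi ->
  'D_e1 (fun x => psi (s *: x)) x = s * 'D_e1 psi (s *: x) /\
  'D_e2 (fun x => psi (s *: x)) x = s * 'D_e2 psi (s *: x).
Proof.
move=> /test_function_disk_C1[_ _ _ d1 d2 _ _ _].
have D1 := is_derive_scale1 (d1 (s *: x)); have D2 := is_derive_scale2 (d2 (s *: x)).
by split; exact: derive_val.
Qed.

Lemma dirichlet_pairing_dilation_difference G psi (s : R) : 1 < s ->
  sqr_integrable (fun x => (G x).1) -> sqr_integrable (fun x => (G x).2) -> test_function psi ->
  pairing (fun x => (G x).1) (dilation_difference s ('D_e1 psi)) +
  pairing (fun x => (G x).2) (dilation_difference s ('D_e2 psi)) =
  dirichlet_pairing G psi - dirichlet_pairing G (fun x => psi (s *: x)).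
Proof.
move=> s1 h1 h2 tpsi; have [_ c1 c2 _ _ _ o1 o2] := test_function_disk_C1 tpsi.
have s1' := ltW s1.
have D1 := @dirichlet_pairingE G ('D_e1 psi) ('D_e2 psi) psi h1 h2 tpsi (fun x => erefl) (fun x => erefl).
have D2 := @dirichlet_pairingE G (fun x => s * 'D_e1 psi (s *: x)) (fun x => s * 'D_e2 psi (s *: x))
  (fun x => psi (s *: x)) h1 h2 (test_function_scale s1 tpsi)
  (fun x => (derive_dilation s x tpsi).1) (fun x => (derive_dilation s x tpsi).2).
exact: (add_sub_arith (pairing_dilation_difference s1' h1 c1 o1) (pairing_dilation_difference s1' h2 c2 o2) D1 D2).
Qed.

Variables (alpha1 alpha2 rho1 rho2 : R) (u1 u2 : R * R -> R) (G1 G2 : R * R -> R * R).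
Variables (phi1 phi2 : nat -> R * R -> R).
Hypothesis a1 : -1 < alpha1.
Hypothesis a2 : -1 < alpha2.
Hypothesis r1 : 0 < rho1.
Hypothesis r2 : 0 < rho2.
Hypothesis uG1 : H1 u1 G1.
Hypothesis uG2 : H1 u2 G2.
Hypothesis tphi1 : forall n, test_function (phi1 n).
Hypothesis tphi2 : forall n, test_function (phi2 n).
Hypothesis phi1_cvg : H1_sqdist u1 G1 (phi1 n) (grad (phi1 n)) @[n --> \oo] --> 0%E.
Hypothesis phi2_cvg : H1_sqdist u2 G2 (phi2 n) (grad (phi2 n)) @[n --> \oo] --> 0%E.
Notation N1 := (normalized_exp alpha1 u1).
Notation N2 := (normalized_exp alpha2 u2).
Hypothesis eq1 : forall psi, test_function psi ->
  dirichlet_pairing G1 psi = \int[leb2]_(x in disk) ((2 * rho1 * N1 x - rho2 * N2 x) * psi x).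
Hypothesis eq2 : forall psi, test_function psi ->
  dirichlet_pairing G2 psi = \int[leb2]_(x in disk) ((2 * rho2 * N2 x - rho1 * N1 x) * psi x).

Lemma integrable_wexp1 : leb2.-integrable disk (EFin \o (fun x => weight alpha1 x * expR (u1 x))).
Proof. by have [m [K [N [_ T _]]]] := exists_tame a1 uG1 tphi1 phi1_cvg; exact: integrable_wexp T. Qed.

Lemma integrable_wexp2 : leb2.-integrable disk (EFin \o (fun x => weight alpha2 x * expR (u2 x))).
Proof. by have [m [K [N [_ T _]]]] := exists_tame a2 uG2 tphi2 phi2_cvg; exact: integrable_wexp T. Qed.

Lemma dirichlet_pairing1 psi : test_function psi ->
  dirichlet_pairing G1 psi = 2 * rho1 * pairing N1 psi - rho2 * pairing N2 psi.
Proof.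
move=> tpsi; rewrite eq1//.
have I1 := integrable_normalized_exp_test integrable_wexp1 tpsi.
have I2 := integrable_normalized_exp_test integrable_wexp2 tpsi.
have [_ E] := integral_comb (2 * rho1) (- rho2) I1 I2.
rewrite -mulNr -E; apply: eq_Rintegral => x _; ring.
Qed.

Lemma dirichlet_pairing2 psi : test_function psi ->
  dirichlet_pairing G2 psi = 2 * rho2 * pairing N2 psi - rho1 * pairing N1 psi.
Proof.
move=> tpsi; rewrite eq2//.
have I1 := integrable_normalized_exp_test integrable_wexp1 tpsi.
have I2 := integrable_normalized_exp_test integrable_wexp2 tpsi.
have [_ E] := integral_comb (2 * rho2) (- rho1) I2 I1.
rewrite -mulNr -E; apply: eq_Rintegral => x _; ring.
Qed.

Definition energy (s : R) (n : nat) : R :=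
  \int[leb2]_(x in disk) toda_form (dilation_difference s ('D_e1 (phi1 n)) x) (dilation_difference s ('D_e1 (phi2 n)) x) +
  \int[leb2]_(x in disk) toda_form (dilation_difference s ('D_e2 (phi1 n)) x) (dilation_difference s ('D_e2 (phi2 n)) x).

Definition gradient_error (n : nat) : R :=
  \int[leb2]_(x in disk) (((G1 x).1 - 'D_e1 (phi1 n) x) ^+ 2 + ((G2 x).1 - 'D_e1 (phi2 n) x) ^+ 2) +
  \int[leb2]_(x in disk) (((G1 x).2 - 'D_e2 (phi1 n) x) ^+ 2 + ((G2 x).2 - 'D_e2 (phi2 n) x) ^+ 2).

Lemma gradient_error_cvg (e : R) : 0 < e -> exists N, forall n, (N <= n)%N -> gradient_error n <= e.
Proof.
move=> e0; have eh : 0 < e / 2 by rewrite divr_gt0.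
have [M1 H1] := approx_le phi1_cvg eh; have [M2 H2] := approx_le phi2_cvg eh.
exists (maxn M1 M2) => n; rewrite geq_max => /andP[n1 n2].
have [_ _ I1 J1 L1] := H1_sqdist_bound uG1 (tphi1 n) (H1 n n1).
have [_ _ I2 J2 L2] := H1_sqdist_bound uG2 (tphi2 n) (H2 n n2).
exact: (integral_sum_exchange I1 J1 I2 J2 L1 L2).
Qed.

Let s11 : sqr_integrable (fun x => (G1 x).1). Proof. by apply: sqr_integrable_L2disk; case: uG1. Qed.
Let s12 : sqr_integrable (fun x => (G1 x).2). Proof. by apply: sqr_integrable_L2disk; case: uG1. Qed.
Let s21 : sqr_integrable (fun x => (G2 x).1). Proof. by apply: sqr_integrable_L2disk; case: uG2. Qed.
Let s22 : sqr_integrable (fun x => (G2 x).2). Proof. by apply: sqr_integrable_L2disk; case: uG2. Qed.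

(** Sum [pairing_lower_bound] over the two partial derivatives; the combinations
    of the equations that appear are the decoupled ones. *)
Lemma energy_le_mass (s tau : R) n : 1 < s -> 0 < tau ->
  (2^-1 - 3 / 2 * tau) * energy s n - tau^-1 / 2 * gradient_error n <=
  rho1 * pairing N1 (fun x => phi1 n x - phi1 n (s *: x)) +
  rho2 * pairing N2 (fun x => phi2 n x - phi2 n (s *: x)).
Proof.
move=> s1 tau0; have mD := @measurable_disk R.
have [_ c1 c2 _ _ _ o1 o2] := test_function_disk_C1 (tphi1 n).
have [_ c1' c2' _ _ _ o1' o2'] := test_function_disk_C1 (tphi2 n).
have B1 := pairing_lower_bound s11 s21 c1 c1' o1 o1' (ltW s1) tau0.
have B2 := pairing_lower_bound s12 s22 c2 c2' o2 o2' (ltW s1) tau0.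
have E11 := dirichlet_pairing_dilation_difference s1 s11 s12 (tphi1 n).
have E12 := dirichlet_pairing_dilation_difference s1 s11 s12 (tphi2 n).
have E21 := dirichlet_pairing_dilation_difference s1 s21 s22 (tphi1 n).
have E22 := dirichlet_pairing_dilation_difference s1 s21 s22 (tphi2 n).
have ts1 := test_function_scale s1 (tphi1 n).
have ts2 := test_function_scale s1 (tphi2 n).
rewrite !dirichlet_pairing1// in E11 E12.
rewrite !dirichlet_pairing2// in E21 E22.
have F1 : pairing N1 (fun x => phi1 n x - phi1 n (s *: x)) = pairing N1 (phi1 n) - pairing N1 (fun x => phi1 n (s *: x)).
  rewrite -(RintegralB mD (integrable_normalized_exp_test integrable_wexp1 (tphi1 n)) (integrable_normalized_exp_test integrable_wexp1 ts1)).
  by apply: eq_Rintegral => x _; rewrite mulrBr.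
have F2 : pairing N2 (fun x => phi2 n x - phi2 n (s *: x)) = pairing N2 (phi2 n) - pairing N2 (fun x => phi2 n (s *: x)).
  rewrite -(RintegralB mD (integrable_normalized_exp_test integrable_wexp2 (tphi2 n)) (integrable_normalized_exp_test integrable_wexp2 ts2)).
  by apply: eq_Rintegral => x _; rewrite mulrBr.
rewrite F1 F2 /energy /gradient_error mulrDr mulrDr opprD addrACA.
apply: le_trans (lerD B1 B2) _; rewrite le_eqVlt; apply/orP; left; apply/eqP.
exact: (mass_arith E11 E12 E21 E22).
Qed.

(** The gradient of [xi] vanishes for [|x| <= 1 / s] and the dilated gradients for
    [|x| >= 1 / s], so that [xi] only sees the undilated part of the difference. *)
Lemma flux_le_energy (s eta c1 c2 : R) (xi : R * R -> R) n : 1 < s -> 0 < eta -> test_function xi ->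
  (forall x, enorm x <= s^-1 -> 'D_e1 xi x = 0 /\ 'D_e2 xi x = 0) ->
  2 * (c1 * dirichlet_pairing G1 xi + c2 * dirichlet_pairing G2 xi)
  - 2 * (c1 ^+ 2 - c1 * c2 + c2 ^+ 2) * dirichlet ('D_e1 xi) ('D_e2 xi)
  - (eta^-1 * gradient_error n + eta * (c1 ^+ 2 + c2 ^+ 2) * dirichlet ('D_e1 xi) ('D_e2 xi)) <=
  energy s n.
Proof.
move=> s1 eta0 txi flat; have mD := @measurable_disk R.
have s0 : 0 < s by exact: lt_trans s1.
have CX := test_function_disk_C1 txi; have [_ x1 x2 _ _ _ ox1 ox2] := CX.
have sX1 := sqr_integrable_continuous x1 ox1.
have sX2 := sqr_integrable_continuous x2 ox2.
have [_ d1 d2 _ _ _ o1 o2] := test_function_disk_C1 (tphi1 n).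
have [_ d1' d2' _ _ _ o1' o2'] := test_function_disk_C1 (tphi2 n).
have disj (a X : R * R -> R) : (forall x, ~ disk x -> a x = 0) ->
    (forall x, enorm x <= s^-1 -> X x = 0) -> forall x, a (s *: x) * X x = 0.
  move=> a0 X0 x; have [sx|sx] := pselect (disk (s *: x)); last by rewrite a0// mul0r.
  rewrite X0 ?mulr0//; move: sx; rewrite /disk /= enormZ ?(ltW s0)// => /ltW.
  by rewrite -ler_pdivlMl// mulr1.
have f1 x : enorm x <= s^-1 -> 'D_e1 xi x = 0 by move=> /flat[].
have f2 x : enorm x <= s^-1 -> 'D_e2 xi x = 0 by move=> /flat[].
have B1 := flux_lower_bound s11 s21 d1 d1' o1 o1' (ltW s1) c1 c2 eta0 sX1 (disj _ _ o1 f1) (disj _ _ o1' f1).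
have B2 := flux_lower_bound s12 s22 d2 d2' o2 o2' (ltW s1) c1 c2 eta0 sX2 (disj _ _ o2 f2) (disj _ _ o2' f2).
apply: le_trans (lerD B1 B2); rewrite le_eqVlt; apply/orP; left; apply/eqP.
rewrite (dirichletE CX) /gradient_error.
rewrite (@dirichlet_pairingE G1 ('D_e1 xi) ('D_e2 xi) xi s11 s12 txi)//.
rewrite (@dirichlet_pairingE G2 ('D_e1 xi) ('D_e2 xi) xi s21 s22 txi)//.
exact: flux_arith.
Qed.

Lemma dirichlet_le_energy (s : R) n : 1 < s ->
  dirichlet (dilation_difference s ('D_e1 (phi1 n))) (dilation_difference s ('D_e2 (phi1 n))) +
  dirichlet (dilation_difference s ('D_e1 (phi2 n))) (dilation_difference s ('D_e2 (phi2 n))) <=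
  3 * energy s n.
Proof.
move=> s1; have s1' := ltW s1.
have C1 := test_function_disk_C1 (tphi1 n); have C2 := test_function_disk_C1 (tphi2 n).
have [_ d1 d2 _ _ _ o1 o2] := C1.
have [_ d1' d2' _ _ _ o1' o2'] := C2.
rewrite (dirichletE (disk_C1_sub C1 (disk_C1_scale s1' C1))) (dirichletE (disk_C1_sub C2 (disk_C1_scale s1' C2))).
rewrite addrACA /energy mulrDr; apply: lerD.
  exact: (dilation_sqr_le_toda_form d1 d1' o1 o1' s1').
exact: (dilation_sqr_le_toda_form d2 d2' o2 o2' s1').
Qed.

Lemma balance_arith (tau ti A1 A2 k1 k2 En er W1 W2 T1 T2 d1 d2 B1 B2 q e M K : R) :
  let kappa := 2^-1 - tau * (3 / 2 + 3 * (k1 * A1 + k2 * A2)) in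
  0 < tau -> 0 <= ti -> 0 <= A1 -> 0 <= A2 -> 0 <= k1 -> 0 <= k2 -> 0 <= kappa ->
  0 < e -> e <= 1 -> 0 <= K -> 0 <= d1 -> 0 <= d2 -> d1 + d2 <= 3 * En -> er <= e ^+ 2 ->
  (2^-1 - 3 / 2 * tau) * En - ti / 2 * er <= k1 * W1 + k2 * W2 ->
  W1 <= T1 + (tau * A1 * d1 + B1 * q + e) -> W2 <= T2 + (tau * A2 * d2 + B2 * q + e) ->
  M - (e^-1 * er + e * K) <= En ->
  kappa * M <= k1 * T1 + k2 * T2 + (k1 * B1 + k2 * B2) * q + e * (kappa * (1 + K) + ti / 2 + k1 + k2).
Proof.
move=> kappa t0 ti0 A10 A20 k10 k20 kap0 e0 e1 K0 d10 d20 hd her hB hA1 hA2 hC.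
have h1 : e^-1 * er <= e by rewrite ler_pdivrMl// -expr2.
have h2 : kappa * M <= kappa * En + kappa * (e + e * K) by rewrite -mulrDr ler_wpM2l//; lra.
have h3 : ti / 2 * er <= ti / 2 * e.
  by rewrite ler_wpM2l ?divr_ge0//; apply: le_trans her _; rewrite expr2 ler_piMl// ltW.
have h4 := ler_wpM2l k10 hA1; have h5 := ler_wpM2l k20 hA2.
have h6 : k1 * A1 * d1 <= k1 * A1 * (3 * En) by rewrite ler_wpM2l ?mulr_ge0//; lra.
have h7 : k2 * A2 * d2 <= k2 * A2 * (3 * En) by rewrite ler_wpM2l ?mulr_ge0//; lra.
have h8 := ler_wpM2l (ltW t0) (lerD h6 h7).
have E : kappa * En = (2^-1 - 3 / 2 * tau) * En - tau * (k1 * A1 * (3 * En) + k2 * A2 * (3 * En)).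
  by rewrite /kappa; ring.
rewrite E in h2; move: (kappa) h2 kap0 => kap h2 kap0; lra.
Qed.

Lemma slack_ge0 (kap K ti k1 k2 : R) : 0 <= kap -> 0 <= K -> 0 <= ti -> 0 <= k1 -> 0 <= k2 ->
  0 <= kap * (1 + K) + ti / 2 + k1 + k2.
Proof. by move=> *; rewrite !addr_ge0 ?divr_ge0 ?mulr_ge0 ?addr_ge0. Qed.

Lemma le_of_slack (x y S : R) : 0 <= S -> (forall e, 0 < e -> e <= 1 -> x <= y + e * S) -> x <= y.
Proof.
move=> S0 h; rewrite leNgt; apply/negP => yx.
have S1 : 0 < S + 1 by rewrite ltr_wpDl.
pose e := Num.min 1 ((x - y) / (2 * (S + 1))).
have e0 : 0 < e by rewrite lt_min ltr01 divr_gt0 ?subr_gt0// mulr_gt0.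
have e1 : e <= 1 by rewrite ge_min lexx.
have e2 : e * (2 * (S + 1)) <= x - y by rewrite -ler_pdivlMr ?mulr_gt0// ge_min lexx orbT.
have := h e e0 e1; nra.
Qed.

Notation mass1 := (\int[leb2]_(x in disk) (weight alpha1 x * expR (u1 x))).
Notation mass2 := (\int[leb2]_(x in disk) (weight alpha2 x * expR (u2 x))).
Notation free1 := (\int[leb2]_(x in disk) weight alpha1 x).
Notation free2 := (\int[leb2]_(x in disk) weight alpha2 x).

Lemma pairing_normalized (alpha m : R) (u g : R * R -> R) :
  leb2.-integrable disk (EFin \o (fun x => weight alpha x * expR (u x) * g x)) ->
  m * pairing (normalized_exp alpha u) g =
  m / (\int[leb2]_(x in disk) (weight alpha x * expR (u x))) *
  \int[leb2]_(x in disk) (weight alpha x * expR (u x) * g x).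
Proof.
move=> I; rewrite -mulrA; congr (_ * _).
rewrite -(RintegralZl _ _ I); last exact: measurable_disk.
by apply: eq_Rintegral => x _; rewrite normalized_expE mulrA.
Qed.

(** The smallness of [tau] lets the energy absorb the quadratic errors; the errors
    of the approximation disappear because the inequality between the remaining
    terms does not involve [n]. *)
Lemma balance : exists C, 0 <= C /\ forall tau, 0 < tau -> 0 <= 2^-1 - tau * (3 / 2 + C) ->
  exists C', 0 <= C' /\ forall s c1 c2 xi, 1 < s -> test_function xi ->
  (forall x, enorm x <= s^-1 -> 'D_e1 xi x = 0 /\ 'D_e2 xi x = 0) ->
  (2^-1 - tau * (3 / 2 + C)) *
    (2 * (c1 * dirichlet_pairing G1 xi + c2 * dirichlet_pairing G2 xi)
     - 2 * (c1 ^+ 2 - c1 * c2 + c2 ^+ 2) * dirichlet ('D_e1 xi) ('D_e2 xi)) <=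
  rho1 / mass1 * ((1 - dilation_rate alpha1 s) * (mass1 - free1)) +
  rho2 / mass2 * ((1 - dilation_rate alpha2 s) * (mass2 - free2)) + C' * (s - 1) ^+ 2.
Proof.
have [A1 [A10 HA1]] := weighted_dilation_difference a1 uG1 tphi1 phi1_cvg.
have [A2 [A20 HA2]] := weighted_dilation_difference a2 uG2 tphi2 phi2_cvg.
have m1 := integral_wexp_gt0 integrable_wexp1; have m2 := integral_wexp_gt0 integrable_wexp2.
set k1 := rho1 / mass1; set k2 := rho2 / mass2.
have k10 : 0 <= k1 := divr_ge0 (ltW r1) (ltW m1).
have k20 : 0 <= k2 := divr_ge0 (ltW r2) (ltW m2).
exists (3 * (k1 * A1 + k2 * A2)); split.
  exact: (mulr_ge0 (ler0n _ 3) (addr_ge0 (mulr_ge0 k10 A10) (mulr_ge0 k20 A20))).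
move=> tau tau0 kap0.
have [B1 [B10 HB1]] := HA1 tau tau0; have [B2 [B20 HB2]] := HA2 tau tau0.
exists (k1 * B1 + k2 * B2); split; first exact: (addr_ge0 (mulr_ge0 k10 B10) (mulr_ge0 k20 B20)).
move=> s c1 c2 xi s1 txi flat.
have ti0 : 0 <= tau^-1 by rewrite invr_ge0; exact: ltW.
set K := (c1 ^+ 2 + c2 ^+ 2) * dirichlet ('D_e1 xi) ('D_e2 xi).
have K0 : 0 <= K := mulr_ge0 (addr_ge0 (sqr_ge0 c1) (sqr_ge0 c2)) (dirichlet_ge0 _ _).
apply: (@le_of_slack _ _ ((2^-1 - tau * (3 / 2 + 3 * (k1 * A1 + k2 * A2))) * (1 + K) + tau^-1 / 2 + k1 + k2)).
  exact: (slack_ge0 kap0 K0 ti0 k10 k20).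
move=> e e0 e1.
have [M1 HM1] := HB1 s s1 e e0; have [M2 HM2] := HB2 s s1 e e0.
have [M3 HM3] := gradient_error_cvg (exprn_gt0 2 e0).
pose n := maxn M1 (maxn M2 M3).
have n1 : (M1 <= n)%N by rewrite leq_maxl.
have n2 : (M2 <= n)%N by rewrite /n maxnCA leq_maxl.
have n3 : (M3 <= n)%N by rewrite /n maxnA leq_maxr.
have W1 := HM1 n n1; have W2 := HM2 n n2; have er := HM3 n n3.
have Bl := @energy_le_mass s tau n s1 tau0.
have bounded (phi : nat -> R * R -> R) : (forall n, test_function (phi n)) -> test_function (fun x => phi n (s *: x)).
  by move=> t; exact: test_function_scale.
have Ig (alpha : R) (u : R * R -> R) (phi : nat -> R * R -> R) : (forall n, test_function (phi n)) ->
   leb2.-integrable disk (EFin \o (fun x => weight alpha x * expR (u x))) ->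
   leb2.-integrable disk (EFin \o (fun x => weight alpha x * expR (u x) * (phi n x - phi n (s *: x)))).
  by move=> tp I; apply: (integrable_mul_C1 I (disk_C1_sub (test_function_disk_C1 (tp n)) (test_function_disk_C1 (bounded _ tp)))).
rewrite (pairing_normalized _ (Ig _ _ _ tphi1 integrable_wexp1)) in Bl.
rewrite (pairing_normalized _ (Ig _ _ _ tphi2 integrable_wexp2)) in Bl.
have hC := @flux_le_energy s e c1 c2 xi n s1 e0 txi flat.
rewrite -(mulrA e) in hC.
have hd := @dirichlet_le_energy s n s1.
exact: (balance_arith tau0 ti0 A10 A20 k10 k20 kap0 e0 e1 K0 (dirichlet_ge0 _ _) (dirichlet_ge0 _ _) hd er Bl W1 W2 hC).
Qed.

End balance_of_energy.

(** * Passage to the limit *)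

Section conclusion.
Context {R : realType}.
Notation leb := (@lebesgue_measure R).
Notation leb2 := (leb \x leb)%E.

Lemma le_of_dilation_limit (s0 L A C : R) : 1 < s0 -> 0 <= A -> 0 <= C ->
  (forall s, 1 < s -> s <= s0 -> L <= s ^+ 2 * (A + C * (s - 1))) -> L <= A.
Proof.
move=> s01 A0 C0 H; apply: (@le_of_slack _ _ _ (3 * A + 4 * C)); first by lra.
move=> h h0 h1; pose k := Num.min h (s0 - 1).
have k0 : 0 < k by rewrite lt_min h0 subr_gt0.
have kh : k <= h by rewrite ge_min lexx.
have ks : k <= s0 - 1 by rewrite ge_min lexx orbT.
have ks0 : 1 + k <= s0 by lra.
have k1 : 1 < 1 + k by lra.
apply: le_trans (H (1 + k) k1 ks0) _; rewrite [1 + k]addrC addrK.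
have k2 : k ^+ 2 <= k by rewrite expr2 ler_piMl ?(ltW k0)// (le_trans kh).
apply: (@le_trans _ _ ((1 + 3 * k) * (A + C * k))).
  by rewrite ler_wpM2r ?addr_ge0 ?mulr_ge0 ?(ltW k0)//; rewrite sqrrD; lra.
apply: (@le_trans _ _ (A + k * (3 * A + 4 * C))); first by nra.
by rewrite lerD2l ler_wpM2r//; lra.
Qed.

Lemma le_of_parameter_limit (e0 c k Q B : R) : 0 < e0 -> 0 <= c -> 0 <= k -> 0 < Q ->
  (forall e, 0 < e -> e <= e0 -> (1 - e * c) * (Q - e * k) * ((1 - 3 * e) ^+ 2 * (1 - e)) <= B) ->
  Q <= B.
Proof.
move=> e00 c0 k0 Q0 H; apply: (@le_of_slack _ _ _ ((c + 7) * Q + k)).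
  by rewrite addr_ge0// mulr_ge0 ?addr_ge0// ltW.
move=> h h0 h1.
have c7 : 0 < c + 7 by rewrite ltr_wpDl.
have k1 : 0 < k + 1 by rewrite ltr_wpDl.
pose e := Num.min (Num.min h e0) (Num.min (c + 7)^-1 (Q / (k + 1))).
have e_gt0 : 0 < e by rewrite !lt_min h0 e00 invr_gt0 c7 divr_gt0.
have eh : e <= h by rewrite !ge_min lexx.
have ee0 : e <= e0 by rewrite !ge_min lexx orbT.
have ec : e * (c + 7) <= 1 by rewrite -ler_pdivlMr// mul1r !ge_min lexx !orbT.
have ek : e * (k + 1) <= Q by rewrite -ler_pdivlMr// !ge_min lexx !orbT.
have hB := H e e_gt0 ee0.
have ec0 : 0 <= e * c by rewrite mulr_ge0// ltW.
have q0 : 0 <= Q - e * k by move: ek; rewrite mulrDr mulr1; lra.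
have f1 : 1 - 7 * e <= (1 - 3 * e) ^+ 2 * (1 - e).
  by move: ec; rewrite mulrDr => ec; have := sqr_ge0 e; nra.
have g0 : 0 <= 1 - e * c by move: ec; rewrite mulrDr; lra.
have f2 : (1 - e * c) * (Q - e * k) * (1 - 7 * e) <= B.
  by apply: le_trans hB; rewrite ler_wpM2l// mulr_ge0.
have f3 : 1 - e * (c + 7) <= (1 - e * c) * (1 - 7 * e) by have := mulr_ge0 ec0 (ltW e_gt0); nra.
have f4 : (1 - e * (c + 7)) * (Q - e * k) <= B.
  by apply: le_trans f2; rewrite [leRHS]mulrAC ler_wpM2r.
have f5 : Q - e * ((c + 7) * Q + k) <= (1 - e * (c + 7)) * (Q - e * k).
  have := mulr_ge0 (mulr_ge0 (ltW e_gt0) (ltW e_gt0)) (mulr_ge0 (ltW c7) k0); nra.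
have S0 : 0 <= (c + 7) * Q + k by rewrite addr_ge0// mulr_ge0 ?ltW.
have := ler_wpM2r S0 eh; lra.
Qed.

Definition quad (x y : R) : R := x ^+ 2 - x * y + y ^+ 2.

Lemma quad_ge0 x y : 0 <= quad x y.
Proof. by rewrite /quad; have := sqr_ge0 (x - y); have := sqr_ge0 x; have := sqr_ge0 y; nra. Qed.

(** The multipliers [P1 / D] and [P2 / D] maximize the right-hand side when
    [d = D]. *)
Lemma flux_optimum (P1 P2 D d : R) : 0 < D -> d <= D ->
  2 * (quad P1 P2 / D) <=
  2 * (P1 / D * (2 * P1 - P2) + P2 / D * (2 * P2 - P1))
  - 2 * ((P1 / D) ^+ 2 - P1 / D * (P2 / D) + (P2 / D) ^+ 2) * d.
Proof.
move=> D0 dD; have q0 := quad_ge0 P1 P2.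
have -> : (P1 / D) ^+ 2 - P1 / D * (P2 / D) + (P2 / D) ^+ 2 = quad P1 P2 / D / D.
  by rewrite /quad; field; rewrite gt_eqF.
have -> : P1 / D * (2 * P1 - P2) + P2 / D * (2 * P2 - P1) = 2 * (quad P1 P2 / D).
  by rewrite /quad; field; rewrite gt_eqF.
have h : 0 <= quad P1 P2 / D by rewrite divr_ge0// ltW.
have : quad P1 P2 / D / D * d <= quad P1 P2 / D.
  by rewrite -mulrA ler_piMr// ler_pdivrMl// mulr1.
lra.
Qed.

Lemma quad_lower (r1 r2 p1 p2 e : R) : 0 < r1 -> 0 < r2 -> 0 < e -> e <= 1 ->
  1 - e <= p1 -> p1 <= 1 -> 1 - e <= p2 -> p2 <= 1 ->
  quad r1 r2 - e * (2 * (r1 ^+ 2 + r2 ^+ 2)) <= quad (r1 * p1) (r2 * p2).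
Proof.
move=> r10 r20 e0 e1 a1 a2 b1 b2.
have e1' : 0 <= 1 - e by rewrite subr_ge0.
have h1 : 1 - 2 * e <= p1 ^+ 2 by have := sqr_ge0 e; nra.
have h2 : 1 - 2 * e <= p2 ^+ 2 by have := sqr_ge0 e; nra.
have h3 : p1 * p2 <= 1.
  by rewrite -[leRHS]mulr1 ler_pM// (le_trans e1').
have g1 := ler_wpM2l (sqr_ge0 r1) h1; have g2 := ler_wpM2l (sqr_ge0 r2) h2.
have g3 := ler_wpM2l (mulr_ge0 (ltW r10) (ltW r20)) h3.
rewrite /quad !exprMn; move: g1 g2 g3; nra.
Qed.

Lemma mass_term_bound (m I E d a s : R) : 0 < m -> 0 < I -> -1 < a ->
  0 <= d <= (1 + a) * (s ^+ 2 * (1 - s ^- 2)) ->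
  m / I * (d * (I - E)) <= m * (1 + a) * Num.max 0 (1 - E / I) * (s ^+ 2 * (1 - s ^- 2)).
Proof.
move=> m0 I0 a1 /andP[d0 d1].
have -> : m / I * (d * (I - E)) = m * (d * (1 - E / I)) by field; rewrite gt_eqF.
rewrite -!mulrA ler_pM2l//.
apply: (@le_trans _ _ (d * Num.max 0 (1 - E / I))); first by rewrite ler_wpM2l// le_max lexx orbT.
rewrite [leRHS](_ : _ = (1 + a) * (s ^+ 2 * (1 - s ^- 2)) * Num.max 0 (1 - E / I)); last by ring.
by rewrite ler_wpM2r// le_max lexx.
Qed.

Lemma cutoff_energy_gt0 (p e t : R) : 0 < p -> e <= 1 / 6 -> 0 < t -> t < 1 ->
  0 < 4 * p / ((1 - 3 * e) ^+ 2 * (1 - e) * (1 - t ^+ 2)).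
Proof.
move=> p0 e6 t0 t1; have h1 : 0 < 1 - 3 * e by lra.
have h2 : 0 < 1 - e by lra.
have h3 : 0 < 1 - t ^+ 2 by rewrite subr_gt0 expr_lt1// ltW.
by apply: divr_gt0; rewrite !mulr_gt0// exprn_gt0.
Qed.

Lemma final_arith (c Q Qe D e t s A1 A2 C' X p : R) : let kap := 2^-1 - e * c in 1 < s -> t = s^-1 -> 0 < e -> e <= 1 / 6 -> 0 < p ->
  D = 4 * p / ((1 - 3 * e) ^+ 2 * (1 - e) * (1 - t ^+ 2)) ->
  0 <= kap -> Qe <= Q -> 2 * (Q / D) <= X -> 0 <= C' ->
  kap * X <= A1 * (s ^+ 2 * (1 - s ^- 2)) + A2 * (s ^+ 2 * (1 - s ^- 2)) + C' * (s - 1) ^+ 2 ->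
  (1 - e * (2 * c)) * Qe * ((1 - 3 * e) ^+ 2 * (1 - e)) / (4 * p) <= s ^+ 2 * (A1 + A2 + C' * (s - 1)).
Proof.
move=> kap s1 -> e0 e6 p0 DE kap0 QQ QX C0; rewrite -mulrDl => H.
have -> : 1 - e * (2 * c) = 2 * kap by rewrite /kap; field.
move: (kap) (A1 + A2) kap0 H => {}kap A kap0 H.
have s0 : 0 < s by exact: lt_trans s1.
set w := 1 - s ^- 2; rewrite -/w in H.
have w0 : 0 < w by rewrite subr_gt0 invf_lt1 ?exprn_gt0// exprn_egt1.
have sw : s ^+ 2 * w = (s - 1) * (s + 1) by rewrite /w; field; rewrite gt_eqF.
set f := (1 - 3 * e) ^+ 2 * (1 - e).
have f0 : 0 < f by rewrite mulr_gt0 ?exprn_gt0//; lra.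
have QD : Q / D = Q * f * w / (4 * p).
  rewrite DE exprVn -/w -/f; field.
  by rewrite !gt_eqF.
rewrite -(ler_pM2r w0).
have -> : s ^+ 2 * (A + C' * (s - 1)) * w = A * (s ^+ 2 * w) + C' * (s - 1) * (s ^+ 2 * w) by ring.
have h1 : C' * (s - 1) ^+ 2 <= C' * (s - 1) * (s ^+ 2 * w).
  have -> : C' * (s - 1) * (s ^+ 2 * w) = C' * (s - 1) ^+ 2 * (s + 1) by rewrite sw; ring.
  by rewrite ler_peMr ?mulr_ge0 ?sqr_ge0//; lra.
have h2 : 2 * kap * Qe * f / (4 * p) * w <= kap * X.
  have -> : 2 * kap * Qe * f / (4 * p) * w = kap * (2 * (Qe * (f * w / (4 * p)))).
    by field; rewrite gt_eqF.
  rewrite ler_wpM2l//; apply: le_trans QX; rewrite QD ler_pM2l//.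
  have -> : Q * f * w / (4 * p) = Q * (f * w / (4 * p)) by rewrite !mulrA.
  exact: (ler_wpM2r (divr_ge0 (mulr_ge0 (ltW f0) (ltW w0)) (mulr_ge0 (ler0n _ 4) (ltW p0))) QQ).
lra.
Qed.

Variables (alpha1 alpha2 rho1 rho2 : R) (u1 u2 : R * R -> R) (G1 G2 : R * R -> R * R).
Variables (phi1 phi2 : nat -> R * R -> R).
Hypothesis a1 : -1 < alpha1.
Hypothesis a2 : -1 < alpha2.
Hypothesis r1 : 0 < rho1.
Hypothesis r2 : 0 < rho2.
Hypothesis uG1 : H1 u1 G1.
Hypothesis uG2 : H1 u2 G2.
Hypothesis tphi1 : forall n, test_function (phi1 n).
Hypothesis tphi2 : forall n, test_function (phi2 n).
Hypothesis phi1_cvg : H1_sqdist u1 G1 (phi1 n) (grad (phi1 n)) @[n --> \oo] --> 0%E.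
Hypothesis phi2_cvg : H1_sqdist u2 G2 (phi2 n) (grad (phi2 n)) @[n --> \oo] --> 0%E.
Notation N1 := (normalized_exp alpha1 u1).
Notation N2 := (normalized_exp alpha2 u2).
Hypothesis eq1 : forall psi, test_function psi ->
  \int[leb2]_(x in disk) dot (G1 x) (grad psi x) =
  \int[leb2]_(x in disk) ((2 * rho1 * N1 x - rho2 * N2 x) * psi x).
Hypothesis eq2 : forall psi, test_function psi ->
  \int[leb2]_(x in disk) dot (G2 x) (grad psi x) =
  \int[leb2]_(x in disk) ((2 * rho2 * N2 x - rho1 * N1 x) * psi x).
Notation mass1 := (\int[leb2]_(x in disk) (weight alpha1 x * expR (u1 x))).
Notation mass2 := (\int[leb2]_(x in disk) (weight alpha2 x * expR (u2 x))).
Notation free1 := (\int[leb2]_(x in disk) weight alpha1 x).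
Notation free2 := (\int[leb2]_(x in disk) weight alpha2 x).

Lemma pairing_cutoff_le1 (alpha : R) (u xi : R * R -> R) :
  leb2.-integrable disk (EFin \o (fun x => weight alpha x * expR (u x))) ->
  test_function xi -> (forall x, 0 <= xi x <= 1) ->
  \int[leb2]_(x in disk) (normalized_exp alpha u x * xi x) <= 1.
Proof.
move=> I txi xi01; rewrite -(integral_normalized_exp I).
apply: (le_Rintegral (@measurable_disk R) (integrable_normalized_exp_test I txi) (integrable_normalized_exp I)).
by move=> x _; rewrite ler_piMr ?(normalized_exp_ge0 I)//; case/andP: (xi01 x).
Qed.

(** In [balance], take the cut-off adapted to [s], divide by [1 - s ^- 2] and let
    [s] tend to 1; the mass of the densities is then entirely seen by the
    cut-off.  The parameter [e] plays the role of [delta], of [tau] and of the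
    lost mass at once. *)
Lemma quad_le_mass : quad rho1 rho2 <= 4 * pi *
  (rho1 * (1 + alpha1) * Num.max 0 (1 - free1 / mass1) +
   rho2 * (1 + alpha2) * Num.max 0 (1 - free2 / mass2)).
Proof.
have I1 := integrable_wexp1 a1 uG1 tphi1 phi1_cvg.
have I2 := integrable_wexp2 a2 uG2 tphi2 phi2_cvg.
have m1 := integral_wexp_gt0 I1; have m2 := integral_wexp_gt0 I2.
have [C [C0 HC]] := balance a1 a2 r1 r2 uG1 uG2 tphi1 tphi2 phi1_cvg phi2_cvg eq1 eq2.
set A := rho1 * (1 + alpha1) * Num.max 0 (1 - free1 / mass1) +
   rho2 * (1 + alpha2) * Num.max 0 (1 - free2 / mass2).
have A0 : 0 <= A.
  have P (r a z : R) : 0 < r -> -1 < a -> 0 <= r * (1 + a) * Num.max 0 z.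
    move=> r0 ha; apply: mulr_ge0; last by rewrite le_max lexx.
    by apply: mulr_ge0; [exact: ltW|lra].
  exact: (addr_ge0 (P _ _ _ r1 a1) (P _ _ _ r2 a2)).
have c30 : 0 < 3 / 2 + C by lra.
pose e0 := Num.min (1 / 6) (2 * (3 / 2 + C))^-1.
have e00 : 0 < e0 by rewrite lt_min divr_gt0//= invr_gt0 mulr_gt0.
have Q0 : 0 < quad rho1 rho2.
  by rewrite /quad; have := mulr_gt0 r1 r2; have := sqr_ge0 (rho1 - rho2); nra.
have k0 : 0 <= 2 * (rho1 ^+ 2 + rho2 ^+ 2) by rewrite mulr_ge0// addr_ge0// sqr_ge0.
have c0 : 0 <= 2 * (3 / 2 + C) by lra.
apply: (le_of_parameter_limit e00 c0 k0 Q0) => e e_gt0 ee0.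
have e6 : e <= 1 / 6 by apply: le_trans ee0 _; rewrite ge_min lexx.
have ele1 : e <= 1 by lra.
have ec : e * (2 * (3 / 2 + C)) <= 1.
  by rewrite -ler_pdivlMr ?mulr_gt0// mul1r; apply: le_trans ee0 _; rewrite ge_min lexx orbT.
have kap0 : 0 <= 2^-1 - e * (3 / 2 + C) by lra.
have [C' [C'0 HC']] := HC e e_gt0 kap0.
have [t1 [/andP[t10 t11] Ht1]] := mass_exhaustion I1 e_gt0.
have [t2 [/andP[t20 t21] Ht2]] := mass_exhaustion I2 e_gt0.
pose t0 := Num.max t1 t2.
have t00 : 0 < t0 by rewrite lt_max t10.
have t01 : t0 < 1 by rewrite gt_max t11.
have s01 : 1 < t0^-1 by rewrite invf_gt1.
have p0 := @pi_gt0 R.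
rewrite -ler_pdivrMl ?mulr_gt0// mulrC.
apply: (le_of_dilation_limit s01 A0 C'0) => s s1 ss0.
have s0 : 0 < s by exact: lt_trans s1.
pose t := s^-1.
have t_gt0 : 0 < t by rewrite invr_gt0.
have t_lt1 : t < 1 by rewrite invf_lt1.
have t0t : t0 <= t by rewrite -[leLHS]invrK lef_pV2 ?posrE ?invr_gt0.
have t1t : t1 <= t by apply: le_trans t0t; rewrite le_max lexx.
have t2t : t2 <= t by apply: le_trans t0t; rewrite le_max lexx orbT.
have [|xi [txi xi01 xit xiD]] := @cutoff R e t e_gt0 e6; first by rewrite t_gt0.
have xi0 x : 0 <= xi x by case/andP: (xi01 x).
have xi1 x : enorm x <= t -> xi x = 1 by move=> /xit[].
have xg x : enorm x <= s^-1 -> 'D_e1 xi x = 0 /\ 'D_e2 xi x = 0 by move=> /xit[].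
have J1 := integrable_normalized_exp_test I1 txi.
have J2 := integrable_normalized_exp_test I2 txi.
have l1 := Ht1 t xi t1t xi0 xi1 J1; have l2 := Ht2 t xi t2t xi0 xi1 J2.
have g1 := pairing_cutoff_le1 I1 txi xi01; have g2 := pairing_cutoff_le1 I2 txi xi01.
set D := 4 * pi / _ in xiD.
have D0 : 0 < D := cutoff_energy_gt0 p0 e6 t_gt0 t_lt1.
set p1 := \int[leb2]_(x in disk) (N1 x * xi x) in l1 g1.
set p2 := \int[leb2]_(x in disk) (N2 x * xi x) in l2 g2.
have HB := HC' s (rho1 * p1 / D) (rho2 * p2 / D) xi s1 txi xg.
rewrite (dirichlet_pairing1 a1 a2 uG1 uG2 tphi1 tphi2 phi1_cvg phi2_cvg eq1 txi)
  (dirichlet_pairing2 a1 a2 uG1 uG2 tphi1 tphi2 phi1_cvg phi2_cvg eq2 txi) -/p1 -/p2 -!(mulrA 2 rho1) -!(mulrA 2 rho2) in HB.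
have X := flux_optimum (rho1 * p1) (rho2 * p2) D0 xiD.
have M1 := mass_term_bound free1 r1 m1 a1 (dilation_rate_bound a1 (ltW s1)).
have M2 := mass_term_bound free2 r2 m2 a2 (dilation_rate_bound a2 (ltW s1)).
have q := quad_lower r1 r2 e_gt0 ele1 l1 g1 l2 g2.
have HB' := le_trans HB (lerD (lerD M1 M2) (lexx _)).
exact: (final_arith s1 (erefl t) e_gt0 e6 p0 (erefl D) kap0 q X C'0 HB').
Qed.

End conclusion.

Theorem theorem1p3 (R : realType) (alpha1 alpha2 rho1 rho2 : R)
  (halpha1 : -1 < alpha1) (halpha2 : -1 < alpha2)
  (hrho1 : 0 < rho1) (hrho2 : 0 < rho2)
  (hrho : 0 <= rho1 ^+ 2 - rho1 * rho2 + rho2 ^+ 2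
               - 4 * pi * (1 + alpha1) * rho1
               - 4 * pi * (1 + alpha2) * rho2) :
  ~ exists u1 u2 : R * R -> R,
      toda_solution alpha1 alpha2 rho1 rho2 u1 u2.
Proof.
move=> [u1 [u2 [[G1 [uG1 [phi1 [t1 c1]]] eq1] [G2 [uG2 [phi2 [t2 c2]]] eq2]]]].
have := quad_le_mass halpha1 halpha2 hrho1 hrho2 uG1 uG2 t1 t2 c1 c2 eq1 eq2.
have I1 := integral_wexp_gt0 (integrable_wexp1 halpha1 uG1 t1 c1).
have I2 := integral_wexp_gt0 (integrable_wexp2 halpha2 uG2 t2 c2).
have E1 := integral_weight_gt0 halpha1; have E2 := integral_weight_gt0 halpha2.
have lt1 (E I : R) : 0 < I -> 0 < E -> Num.max 0 (1 - E / I) < 1.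
  by move=> I0 E0; rewrite gt_max ltr01/= gtrBl divr_gt0.
have := lt1 _ _ I1 E1; have := lt1 _ _ I2 E2.
move: (Num.max _ _) (Num.max _ _) => z1 z2 h2 h1.
rewrite leNgt => /negP; apply.
have p0 := @pi_gt0 R.
have k1 : 0 < rho1 * (1 + alpha1) by rewrite mulr_gt0//; lra.
have k2 : 0 < rho2 * (1 + alpha2) by rewrite mulr_gt0//; lra.
have : rho1 * (1 + alpha1) * z1 + rho2 * (1 + alpha2) * z2 < rho1 * (1 + alpha1) + rho2 * (1 + alpha2).
  by apply: ltrD; rewrite gtr_pMr.
rewrite -(ltr_pM2l (mulr_gt0 (ltr0n R 4) p0)) => h.
apply: lt_le_trans h _; rewrite /quad; move: hrho; clear; move: pi => p; lra.
Qed.
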